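(* Let $\mathbf a=(a_0,a_1,a_2,\dots)$ be a sequence of natural numbers with $a_j>1$, and let $\Sigma_{\mathbf a}$ be the $\mathbf a$-adic solenoid. Assume $\Sigma_{\mathbf a}$ contains no elements of order $2$. Let $\xi_1,\xi_2,\xi_3$ be independent identically distributed random variables with values in $\Sigma_{\mathbf a}$ and a symmetric distribution $\mu$. Let $\alpha$ be a random variable with a Bernoulli distribution taking the values $0$ and $1$ with probability $\frac12$ each, independent of the random vector $(\xi_1,\xi_2,\xi_3)$. Then the following are equivalent: (i) the linear forms $2\xi_1$ and $\xi_1+\xi_2+2\alpha\xi_3$ are identically distributed; (ii) there exist a continuous monomorphism $\tau:\mathbb R\to\Sigma_{\mathbf a}$, a hyperbolic secant distribution $M$ on $\mathbb R$, and a compact Corwin subgroup $K$ of $\Sigma_{\mathbf a}$ such that $\mu=\tau(M)*m_K$.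
   Context: The $\mathbf a$-adic solenoid: let $\Delta_{\mathbf a}$ be the compact group of $\mathbf a$-adic integers (as a set $\prod_{n\ge0}\{0,1,\dots,a_n-1\}$, with addition with carries determined by $\mathbf a$), let $u=(1,0,0,\dots)\in\Delta_{\mathbf a}$, and let $B=\{(n,nu):n\in\mathbb Z\}\subset\mathbb R\times\Delta_{\mathbf a}$; then $\Sigma_{\mathbf a}=(\mathbb R\times\Delta_{\mathbf a})/B$. It is a compact connected Abelian group whose character group is the discrete group $H_{\mathbf a}=\{m/(a_0a_1\cdots a_n): n\ge0,\ m\in\mathbb Z\}\subset\mathbb Q$. A distribution $\mu$ is symmetric if $\mu(B)=\mu(-B)$ for all Borel sets $B$. A distribution $M$ on $\mathbb R$ is a hyperbolic secant distribution if its characteristic function is $\hat M(s)=\frac{2}{e^{\sigma s}+e^{-\sigma s}}$ for some real $\sigma$ (the case $\sigma=0$, i.e. the point mass at $0$, is included). A group $K$ is a Corwin group if $\{2x:x\in K\}=K$. For a compact subgroup $K$, $m_K$ denotes the Haar probability distribution on $K$. $\tau(M)$ is the image of $M$ under $\tau$, i.e. $\tau(M)(E)=M(\tau^{-1}(E))$, and $*$ denotes convolution of distributions. *)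

(* Defs.v *)
From HB Require Import structures.
From mathcomp Require Import all_boot all_order all_algebra.
From mathcomp Require Import all_classical all_reals all_analysis.
Set Implicit Arguments.
Unset Strict Implicit.
Unset Printing Implicit Defensive.
Import Order.TTheory GRing.Theory Num.Theory.
Import numFieldNormedType.Exports.
Local Open Scope classical_set_scope.
Local Open Scope ring_scope.

Record seqa := SeqA { aseq :> nat -> nat ; aseq_gt1 : forall n, (1 < aseq n)%N }.

Definition Pa (a : seqa) (n : nat) : nat := (\prod_(k < n) a k)%N.

Lemma Pa_gt0 (a : seqa) n : (0 < Pa a n)%N.
Proof.
rewrite /Pa; apply: prodn_gt0 => k; exact: leq_trans (aseq_gt1 a k).
Qed.

Lemma PaS (a : seqa) n : Pa a n.+1 = (Pa a n * a n)%N.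
Proof. by rewrite /Pa big_ord_recr. Qed.

Definition Delta (a : seqa) := {x : nat -> nat | forall n, (x n < a n)%N}.

Definition digit (a : seqa) (x : Delta a) (n : nat) : nat := proj1_sig x n.

(* the residue modulo a_0...a_(n-1) represented by the first n digits *)
Definition dval (a : seqa) (x : Delta a) (n : nat) : nat :=
  (\sum_(k < n) digit x k * Pa a k)%N.

Lemma digits_of_proof (a : seqa) (f : nat -> nat) n :
  ((f n.+1 %% Pa a n.+1) %/ Pa a n < a n)%N.
Proof.
rewrite ltn_divLR ?Pa_gt0 // mulnC -PaS.
by rewrite ltn_pmod // Pa_gt0.
Qed.

(* the a-adic integer whose residue mod a_0...a_(n-1) is f n (for a
   compatible family f of residues): digit n = (f (n+1) mod P_(n+1)) / P_n *)
Definition digits_of (a : seqa) (f : nat -> nat) : Delta a :=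
  exist _ (fun n => (f n.+1 %% Pa a n.+1) %/ Pa a n)%N (@digits_of_proof a f).

Definition dadd (a : seqa) (x y : Delta a) : Delta a :=
  digits_of a (fun m => dval x m + dval y m)%N.
Definition dopp (a : seqa) (x : Delta a) : Delta a :=
  digits_of a (fun m => Pa a m - dval x m)%N.
Definition dsub (a : seqa) (x y : Delta a) : Delta a := dadd x (dopp y).
Definition dnat (a : seqa) (m : nat) : Delta a := digits_of a (fun _ => m).
(* the image n u of an integer n, where u = (1, 0, 0, ...) *)
Definition dint (a : seqa) (z : int) : Delta a :=
  match z with
  | Posz m => dnat a m
  | Negz m => dopp (dnat a m.+1)
  end.

(* Product topology on Delta_a (each factor discrete) times R:
   W is open iff around each point it contains a basic neighbourhood
   (real interval) x (cylinder fixing the first N digits). *)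
Definition RxDelta_open (R : realType) (a : seqa) (W : set (R * Delta a)) :=
  forall p, W p -> exists e : R, 0 < e /\ exists N : nat,
    forall (s : R) (y : Delta a), `|s - p.1| < e ->
      (forall k, (k < N)%N -> digit y k = digit p.2 k) -> W (s, y).

(* The a-adic solenoid Sigma_a = (R x Delta_a) / B, B = {(n, n u)}.         *)
(* Each class has a unique representative (t, x) with 0 <= t < 1.           *)
Record Sol (R : realType) (a : seqa) := MkSol {
  sol_t : R ; sol_x : Delta a ; sol_range : (0 <= sol_t < 1) }.

Lemma frac_range (R : realType) (s : R) : 0 <= s - (Num.floor s)%:~R < 1.
Proof.
have /andP[h1 h2] := floor_itv s.
apply/andP; split; first by rewrite subr_ge0.
by rewrite intrD in h2; rewrite ltrBlDl.
Qed.

(* the quotient map R x Delta_a -> Sigma_a :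
   (s, x) |-> class of (s, x) = (s - floor s, x - (floor s) u) *)
Definition sol_proj (R : realType) (a : seqa) (s : R) (x : Delta a) : Sol R a :=
  @MkSol R a (s - (Num.floor s)%:~R) (dsub x (dint a (Num.floor s)))
    (frac_range s).

HB.instance Definition _ (R : realType) (a : seqa) := gen_eqMixin (Sol R a).
HB.instance Definition _ (R : realType) (a : seqa) := gen_choiceMixin (Sol R a).

Definition sol0 (R : realType) (a : seqa) : Sol R a := sol_proj (0 : R) (dnat a 0).
Definition sol_add (R : realType) (a : seqa) (p q : Sol R a) : Sol R a :=
  sol_proj (sol_t p + sol_t q) (dadd (sol_x p) (sol_x q)).
Definition sol_opp (R : realType) (a : seqa) (p : Sol R a) : Sol R a :=
  sol_proj (- sol_t p) (dopp (sol_x p)).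
Definition sol_muln (R : realType) (a : seqa) (n : nat) (p : Sol R a) : Sol R a :=
  iter n (sol_add p) (sol0 R a).

HB.instance Definition _ (R : realType) (a : seqa) :=
  isPointed.Build (Sol R a) (sol0 R a).

Definition sol_open (R : realType) (a : seqa) (U : set (Sol R a)) : Prop :=
  RxDelta_open [set p : R * Delta a | U (sol_proj p.1 p.2)].

Definition sol_compact (R : realType) (a : seqa) (K : set (Sol R a)) : Prop :=
  forall C : set (set (Sol R a)), C `<=` @sol_open R a ->
    K `<=` \bigcup_(U in C) U ->
    exists F : seq (set (Sol R a)),
      [set` F] `<=` C /\ K `<=` \bigcup_(U in [set` F]) U.

Definition sol_subgroup (R : realType) (a : seqa) (K : set (Sol R a)) : Prop :=
  K (sol0 R a) /\ (forall x y, K x -> K y -> K (sol_add x y)) /\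
  (forall x, K x -> K (sol_opp x)).

Definition corwin (R : realType) (a : seqa) (K : set (Sol R a)) : Prop :=
  [set sol_muln 2 x | x in K] = K.

Definition cont_monomorphism (R : realType) (a : seqa) (tau : R -> Sol R a) :=
  (forall s t, tau (s + t) = sol_add (tau s) (tau t)) /\ injective tau /\
  (forall U : set (Sol R a), sol_open U -> open (tau @^-1` U)).

Definition SolM (R : realType) (a : seqa) := g_sigma_algebraType (@sol_open R a).

Definition symmetric_distr (R : realType) (a : seqa) (mu : probability (SolM R a) R) :=
  forall B : set (SolM R a), measurable B ->
    mu B = mu [set sol_opp x | x in B].

Definition haar_of (R : realType) (a : seqa) (K : set (Sol R a))
    (m : probability (SolM R a) R) :=
  m (K : set (SolM R a)) = 1%E /\
  forall k, K k -> forall E : set (SolM R a), measurable E ->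
    m [set sol_add k x | x in E] = m E.

(* hyperbolic secant distribution on R:
   hat M(s) = int e^{isx} dM(x) = 2 / (e^{sigma s} + e^{- sigma s}) *)
Definition hyp_secant (R : realType) (M : probability (measurableTypeR R) R) :=
  exists sigma : R, forall s : R,
    (\int[M]_x (cos (s * x))%:E = (2 / (expR (sigma * s) + expR (- (sigma * s))))%:E)%E /\
    (\int[M]_x (sin (s * x))%:E = 0)%E.

Definition conv_image (R : realType) (a : seqa) (tau : R -> Sol R a)
    (M : probability (measurableTypeR R) R) (m : probability (SolM R a) R)
    (E : set (Sol R a)) : \bar R :=
  (\int[m]_k M [set t : measurableTypeR R | E (sol_add (tau t) k)])%E.

(* Main.v *)
(* The coordinates x |-> t - (x_0 + x_1 a_0 + ...) mod a_0 ... a_(n-1) identify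
   the solenoid with the inverse limit of circles of these lengths.  Characters
   separate probability measures, so (i) becomes a functional equation
     f (2 y) = f (y)^2 (1 + f (2 y)) / 2
   for the (real) characteristic function f of mu on H_a.

   (ii) => (i): a continuous homomorphism from R to the circle is t |-> e^(ist),
   the integral of a character against m_K is 1 or 0 according to whether it
   annihilates K, and since K is Corwin, y annihilates K as soon as 2 y does.
   Hence f is a hyperbolic secant on the annihilator of K and 0 elsewhere.

   (i) => (ii): absence of elements of order 2 makes H_a divisible by 2, so f >= 0.
   On its support N write f = 1 / cosh l.  The equation gives l (2 y) = 2 l (y).
   As sqrt (2 - 2 f) is the L^2 norm of 1 - character, it is subadditive; evaluated
   at y / 2^n, n -> oo, this makes N a subgroup and l subadditive, and then
   l (y) = sigma |y|.  Instead of constructing M from the density of the secant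
   law and m_K from Haar's theorem, both are read off mu.  By Borel-Cantelli, for
   mu-almost every x the arguments of the characters y / 2^n at x are eventually
   halved at each step, so the characters y in N take at x the value
   e^(2 i pi y L(x)) for a measurable real L(x).  With tau t the class of (t, 0),
   M is the law of L, K the annihilator of N, and m_K the law of x - tau (L x). *)
Require Import Defs.
From mathcomp Require Import all_boot all_order all_algebra.
From mathcomp Require Import all_classical all_reals all_analysis.
From mathcomp Require Import measurable_realfun.
From mathcomp Require Import ring lra zify.
Import Defs.
Set Implicit Arguments.
Unset Strict Implicit.
Unset Printing Implicit Defensive.
Import Order.TTheory GRing.Theory Num.Theory.
Import numFieldNormedType.Exports.
Local Open Scope classical_set_scope.
Local Open Scope ring_scope.

(** * Coordinates on the solenoid *)

(** No complex numbers occur: a character is represented by its argument [phase y], kept modulo 2 pi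
    through [eqm], and the real functions cos (phase y x + c), over all shifts c, carry the whole
    Fourier transform. The same relation with modulus P_n serves for the coordinates. The triangle
    inequality is used in squared form with a free weight t, which avoids square roots until the
    weight is optimised. Subadditivity becomes linearity on positive elements because l is exactly
    homogeneous under powers of 2 and any two positive elements of H_a are commensurable. The law M
    must be known at all real frequencies, but mu informs only about those in N. The gap closes
    because N, if nonzero, is stable under halving and integer multiples, hence dense in R; if N =
    {0}, then L = 0 and M is the point mass at 0. Density also shows that a character y outside N
    integrates to 0 against the law of x - tau (L x): for z in N close to y, y - z is again outside
    N, so f (y - z) = 0. K is a Corwin group because N is stable under halving and every point of
    the solenoid is a double. *)

Definition eqm (R : realType) (c x y : R) := exists k : int, x = y + k%:~R * c.

Section EqM.
Variable R : realType.
Implicit Types c x y z : R.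

Lemma eqm_refl c x : eqm c x x.
Proof. by exists 0; rewrite mul0r addr0. Qed.

Lemma eqm_sym c x y : eqm c x y -> eqm c y x.
Proof. by move=> [k ->]; exists (- k); rewrite mulrNz mulNr addrK. Qed.

Lemma eqm_trans c y x z : eqm c x y -> eqm c y z -> eqm c x z.
Proof. by move=> [k ->] [l ->]; exists (l + k); rewrite intrD mulrDl addrA. Qed.

Lemma eqmD c x y x' y' : eqm c x y -> eqm c x' y' -> eqm c (x + x') (y + y').
Proof. by move=> [k ->] [l ->]; exists (k + l); rewrite intrD mulrDl addrACA. Qed.

Lemma eqmN c x y : eqm c x y -> eqm c (- x) (- y).
Proof. by move=> [k ->]; exists (- k); rewrite opprD mulrNz mulNr. Qed.

Lemma eqmB c x y x' y' : eqm c x y -> eqm c x' y' -> eqm c (x - x') (y - y').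
Proof. by move=> h /eqmN; apply: eqmD. Qed.

Lemma eqm_subl c x y z : eqm c (x - y) (x - z) -> eqm c y z.
Proof.
move=> /(eqmB (eqm_refl c x)).
have -> : x - (x - y) = y by ring.
by have -> : x - (x - z) = z by ring.
Qed.

Lemma eqmM c a x y : eqm c x y -> eqm (a * c) (a * x) (a * y).
Proof. by move=> [k ->]; exists k; rewrite mulrDr mulrCA. Qed.

Lemma eqmMz c (l : int) x y : eqm c x y -> eqm c (l%:~R * x) (l%:~R * y).
Proof. by move=> [k ->]; exists (l * k); rewrite intrM mulrDr mulrA. Qed.

Lemma eqm_dvd c (l : int) x y : eqm (l%:~R * c) x y -> eqm c x y.
Proof. by move=> [k ->]; exists (k * l); rewrite intrM mulrA. Qed.

Lemma eqm_modn (d m n : nat) : m = n %[mod d] -> eqm (d%:R : R) m%:R n%:R.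
Proof.
move=> h; exists ((m %/ d)%:Z - (n %/ d)%:Z).
rewrite {1}(divn_eq m d) {1}(divn_eq n d) h intrB !natrD !natrM /=.
by rewrite mulrBl; ring.
Qed.

Lemma eqm_nat_modn (d m n : nat) : (0 < d)%N -> eqm (d%:R : R) m%:R n%:R -> m = n %[mod d].
Proof.
move=> d0 [k hk]; have {}hk : (m%:Z = n%:Z + k * d%:Z)%R.
  by apply/eqP; rewrite -(eqr_int R) intrD intrM; apply/eqP; exact: hk.
by apply/eqP; have := congr1 (modz^~ d%:Z) hk; rewrite addrC modzMDl !modz_nat => -[->].
Qed.

Lemma eqm_small c x y : 0 < c -> eqm c x y -> `|x - y| < c -> x = y.
Proof.
move=> c0 [k ->]; rewrite [_ + _ - _]addrC addKr normrM (gtr0_norm c0) -{2}[c]mul1r.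
rewrite ltr_pM2r // -intr_norm -[1]/(1%:~R) ltr_int => k1.
suff -> : k = 0 by rewrite mul0r addr0.
by move: k1; lia.
Qed.

Lemma cos_eqm x y : eqm (2 * pi) x y -> cos x = cos y.
Proof.
move=> [k ->]; case: k => n.
  elim: n => [|n ih]; first by rewrite mul0r addr0.
  by rewrite intS intrD mulrDl mul1r [2 * pi]mulrC mulr_natr addrCA addrC cosD2pi -mulr_natr [pi * _]mulrC.
rewrite NegzE; elim: n => [|n ih]; first by rewrite -[LHS]cosD2pi; congr cos; rewrite -mulr_natr; ring.
by rewrite -ih -[LHS]cosD2pi; congr cos; rewrite -mulr_natr !mulrNz -!natz [n.+2%:R]mulrS intrD; ring.
Qed.

Lemma sin_eqm x y : eqm (2 * pi) x y -> sin x = sin y.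
Proof.
move=> h; have := @cos_eqm (x - pi / 2) (y - pi / 2) (eqmB h (eqm_refl _ _)).
by rewrite !cosB cos_pihalf sin_pihalf !mulr0 !mulr1 !add0r.
Qed.

End EqM.

(** * The a-adic integers as an inverse limit of residues *)

Section Digits.
Variable a : seqa.
Implicit Types x y : Delta a.

Lemma dval_rec x n : dval x n.+1 = (dval x n + digit x n * Pa a n)%N.
Proof. by rewrite /dval big_ord_recr. Qed.

Lemma dval_lt x n : (dval x n < Pa a n)%N.
Proof.
elim: n => [|n ih]; first by rewrite /dval /Pa !big_ord0.
have hd : (digit x n < a n)%N by rewrite /digit; case: x {ih}.
rewrite dval_rec PaS (@leq_trans (Pa a n + digit x n * Pa a n)%N) ?ltn_add2r //.
by rewrite -mulSn mulnC leq_mul2l hd orbT.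
Qed.

(** Division with remainder by P_n: digit n is the quotient of f (n+1) mod P_(n+1), and
    compatibility identifies the remainder with f n mod P_n. Hence the operations of Delta_a can be
    computed residue by residue. *)
Lemma dval_digits_of (f : nat -> nat) :
  (forall n, f n.+1 = f n %[mod Pa a n]) ->
  forall n, dval (digits_of a f) n = (f n %% Pa a n)%N.
Proof.
move=> hf; elim => [|n ih]; first by rewrite /dval big_ord0 /Pa big_ord0 modn1.
rewrite dval_rec ih -hf.
have dv : (Pa a n %| Pa a n.+1)%N by rewrite PaS dvdn_mulr.
rewrite -(modn_dvdm _ dv) addnC [digit _ _]/(_ %/ _)%N.
by rewrite -divn_eq.
Qed.

Lemma dvalS x n : dval x n.+1 = dval x n %[mod Pa a n].
Proof. by rewrite dval_rec addnC modnMDl. Qed.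

Lemma dvdn_Pa m n : (m <= n)%N -> (Pa a m %| Pa a n)%N.
Proof.
move=> /subnK <-; elim: (n - m)%N => [//|k ih].
by rewrite addSn PaS dvdn_mulr.
Qed.

Lemma digit_eq x y : (forall n, digit x n = digit y n) -> x = y.
Proof.
case: x => x hx; case: y => y hy /= h.
have e : x = y by apply/funext => n; exact: h.
by subst y; congr exist; apply: Prop_irrelevance.
Qed.

Lemma dval_digit x y N :
  dval x N = dval y N -> forall k, (k < N)%N -> digit x k = digit y k.
Proof.
have hl (z : Delta a) n : (dval z n.+1 %/ Pa a n)%N = digit z n.
  rewrite dval_rec addnC divnMDl ?Pa_gt0 //.
  by rewrite divn_small ?addn0 ?dval_lt.
have hm (z : Delta a) m n : (m <= n)%N -> (dval z n %% Pa a m)%N = dval z m.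
  move=> /subnK <-; elim: (n - m)%N => [|k ih]; first by rewrite add0n modn_small ?dval_lt.
  by rewrite addSn -ih -(modn_dvdm (dval z (k + m).+1) (dvdn_Pa (leq_addl k m))) dvalS modn_dvdm // dvdn_Pa ?leq_addl.
by move=> e k kN; rewrite -!hl -(hm x k.+1 N) // -(hm y k.+1 N) // e.
Qed.

Lemma eq_dval x y : (forall n, dval x n = dval y n) -> x = y.
Proof. by move=> h; apply: digit_eq => n; apply: (@dval_digit x y n.+1). Qed.

Variable R : realType.

Definition PR n : R := (Pa a n)%:R.

Lemma PR_gt0 n : 0 < PR n.
Proof. by rewrite ltr0n Pa_gt0. Qed.

Lemma eqm_PR m n (x y : R) : (m <= n)%N -> eqm (PR n) x y -> eqm (PR m) x y.
Proof.
move=> /dvdn_Pa /dvdnP[k e]; rewrite /PR e natrM => h.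
by apply: (@eqm_dvd R _ k%:Z).
Qed.

Lemma dval_dnat (k n : nat) : eqm (PR n) (dval (dnat a k) n)%:R k%:R.
Proof. by rewrite dval_digits_of //; apply: eqm_modn; rewrite modn_mod. Qed.

Lemma dval_dadd x y n : eqm (PR n) (dval (dadd x y) n)%:R ((dval x n)%:R + (dval y n)%:R).
Proof.
rewrite -natrD dval_digits_of; first by apply: eqm_modn; rewrite modn_mod.
by move=> m; rewrite -modnDm !dvalS modnDm.
Qed.

Lemma dval_dopp x n : eqm (PR n) (dval (dopp x) n)%:R (- (dval x n)%:R).
Proof.
have hm m : eqm (PR m) ((Pa a m - dval x m)%N%:R) (- (dval x m)%:R).
  by rewrite natrB ?(ltnW (dval_lt _ _)) //; exists 1; rewrite mul1r addrC.
rewrite dval_digits_of; last first.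
  move=> m; apply: (@eqm_nat_modn R); first exact: Pa_gt0.
  apply: eqm_trans (eqm_PR (leqnSn m) (hm _)) _.
  apply: eqm_trans (eqm_sym (hm m)).
  by apply: eqmN; apply: eqm_modn; rewrite dvalS.
apply: eqm_trans (hm n); apply: eqm_modn; by rewrite modn_mod.
Qed.

Lemma dval_dint (z : int) n : eqm (PR n) (dval (dint a z) n)%:R z%:~R.
Proof.
case: z => m; first exact: dval_dnat.
rewrite NegzE mulrNz; apply: eqm_trans (dval_dopp _ _) _.
by apply: eqmN; apply: dval_dnat.
Qed.

End Digits.

Section Coordinates.
Variables (R : realType) (a : seqa).
Local Notation Sol := (Sol R a).
Local Notation PR := (PR a R).
Implicit Types x y : Sol.

(* [coord n x], defined modulo [Pa a n], is the n-th coordinate of x when the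
   solenoid is seen as the inverse limit of the circles R / (Pa a n) Z. *)
Definition coord n x : R := sol_t x - (dval (sol_x x) n)%:R.

(** The shift by floor s in the real component and by floor s times u in the other cancel modulo
    P_n, so the coordinate depends only on the class of (s, y). *)
Lemma coord_proj n s (y : Delta a) : eqm (PR n) (coord n (sol_proj s y)) (s - (dval y n)%:R).
Proof.
rewrite /coord /=.
have h : eqm (PR n) (dval (dsub y (dint a (Num.floor s))) n)%:R
   ((dval y n)%:R - (Num.floor s)%:~R).
  apply: eqm_trans (dval_dadd _ _ _ _) _; apply: eqmD (eqm_refl _ _) _.
  by apply: eqm_trans (dval_dopp _ _ _) _; apply: eqmN; exact: dval_dint.
apply: eqm_trans (eqmB (eqm_refl _ _) h) _.
have -> : s - (Num.floor s)%:~R - ((dval y n)%:R - (Num.floor s)%:~R) = s - (dval y n)%:R by ring.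
exact: eqm_refl.
Qed.

Lemma coord_add n x y : eqm (PR n) (coord n (sol_add x y)) (coord n x + coord n y).
Proof.
apply: eqm_trans (coord_proj _ _ _) _.
apply: eqm_trans (eqmB (eqm_refl _ _) (dval_dadd _ _ _ _)) _.
rewrite /coord opprD addrACA; exact: eqm_refl.
Qed.

Lemma coord_opp n x : eqm (PR n) (coord n (sol_opp x)) (- coord n x).
Proof.
apply: eqm_trans (coord_proj _ _ _) _.
apply: eqm_trans (eqmB (eqm_refl _ _) (dval_dopp _ _ _)) _.
rewrite /coord opprB opprK addrC; exact: eqm_refl.
Qed.

Lemma coord0 n : eqm (PR n) (coord n (sol0 R a)) 0.
Proof.
apply: eqm_trans (coord_proj _ _ _) _.
apply: eqm_trans (eqmB (eqm_refl _ _) (dval_dnat _ _ _ _)) _.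
by rewrite subrr; exact: eqm_refl.
Qed.

Lemma coord_muln n k x : eqm (PR n) (coord n (sol_muln k x)) (k%:R * coord n x).
Proof.
elim: k => [|k ih]; first by rewrite mul0r; exact: coord0.
apply: eqm_trans (coord_add _ _ _) _.
by rewrite mulrS mulrDl mul1r; apply: eqmD => //; exact: eqm_refl.
Qed.

Lemma coordS n x : eqm (PR n) (coord n.+1 x) (coord n x).
Proof. by apply: eqmB (eqm_refl _ _) _; apply: eqm_modn; rewrite dvalS. Qed.

Lemma coord_le m n x : (m <= n)%N -> eqm (PR m) (coord n x) (coord m x).
Proof.
move=> /subnK <-; elim: (n - m)%N => [|k ih]; first exact: eqm_refl.
by rewrite addSn; apply: eqm_trans ih; apply: eqm_PR (coordS _ _); exact: leq_addl.
Qed.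

Lemma coord_inj x y : (forall n, eqm (PR n) (coord n x) (coord n y)) -> x = y.
Proof.
case: x => t x ht; case: y => s y hs h.
(* At level 0 the modulus is the empty product 1, and both representatives lie in [0, 1). *)
have ts : t = s.
  apply: (@eqm_small R 1) => //.
    have := h 0%N; rewrite /coord /= /dval !big_ord0 !subr0.
    by rewrite /PR /Pa big_ord0.
  have /andP[t0 t1] := ht; have /andP[s0 s1] := hs.
  by rewrite ltr_norml; apply/andP; split; lra.
subst s; have -> : x = y.
  apply: eq_dval => n; rewrite -(modn_small (dval_lt x n)) -(modn_small (dval_lt y n)).
  apply: (@eqm_nat_modn R); first exact: Pa_gt0.
  exact: eqm_subl (h n).
by congr MkSol; apply: Prop_irrelevance.
Qed.

(** Modulo 1 every v n agrees with v 0. The residues r n modulo P_n of the integers v 0 - v n form a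
    compatible family, and the point is the class of v 0 paired with the a-adic integer of residues
    r n. *)
Lemma coord_exists (v : nat -> R) :
  (forall n, eqm (PR n) (v n.+1) (v n)) ->
  exists x, forall n, eqm (PR n) (coord n x) (v n).
Proof.
move=> hv.
have [r hr] : exists r : nat -> nat, forall n, eqm (PR n) (v 0%N - (r n)%:R) (v n).
  have h0 n : eqm (1 : R) (v 0%N) (v n).
    elim: n => [|n ih]; first exact: eqm_refl.
    apply: eqm_trans ih _; apply: eqm_sym.
    have := eqm_PR (leq0n n) (hv n); rewrite {1}/PR /Pa big_ord0 //.
  suff /choice[r hr] : forall n, exists r : nat, eqm (PR n) (v 0%N - r%:R) (v n) by exists r.
  move=> n.
  have [k hk] := h0 n; exists `|(k %% (Pa a n)%:Z)%Z|%N.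
  exists (k %/ (Pa a n)%:Z)%Z; rewrite hk mulr1 -addrA; congr (_ + _).
  have hk0 : 0 <= (k %% (Pa a n)%:Z)%Z by apply: modz_ge0; rewrite eqz_nat -lt0n Pa_gt0.
  rewrite -[(`|_|%N)%:R]/((`|(k %% (Pa a n)%:Z)%Z|%N)%:Z%:~R) (gez0_abs hk0).
  rewrite {1}(divz_eq k (Pa a n)%:Z) intrD intrM addrK //.
have cr n : r n.+1 = r n %[mod Pa a n].
  apply: (@eqm_nat_modn R); first exact: Pa_gt0.
  have h := eqm_trans (eqm_trans (eqm_PR (leqnSn n) (hr n.+1)) (hv n)) (eqm_sym (hr n)).
  exact: eqm_subl h.
exists (sol_proj (v 0%N) (digits_of a r)) => n.
apply: eqm_trans (coord_proj _ _ _) _; apply: eqm_trans (hr n).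
apply: eqmB (eqm_refl _ _) _; rewrite dval_digits_of //.
by apply: eqm_modn; rewrite modn_mod.
Qed.

Lemma sol_addC x y : sol_add x y = sol_add y x.
Proof.
apply: coord_inj => n; apply: eqm_trans (coord_add _ _ _) _.
by rewrite addrC; exact: eqm_sym (coord_add _ _ _).
Qed.

Lemma sol_addA x y z : sol_add x (sol_add y z) = sol_add (sol_add x y) z.
Proof.
apply: coord_inj => n; apply: eqm_trans (coord_add _ _ _) _.
apply: eqm_trans (eqmD (eqm_refl _ _) (coord_add _ _ _)) _.
rewrite addrA; apply: eqm_sym; apply: eqm_trans (coord_add _ _ _) _.
by apply: eqmD (coord_add _ _ _) (eqm_refl _ _).
Qed.

Lemma sol_add0 x : sol_add (sol0 R a) x = x.
Proof.
apply: coord_inj => n; apply: eqm_trans (coord_add _ _ _) _.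
by rewrite -{2}[coord n x]add0r; apply: eqmD (coord0 _) (eqm_refl _ _).
Qed.

Lemma sol_addN x : sol_add (sol_opp x) x = sol0 R a.
Proof.
apply: coord_inj => n; apply: eqm_trans (coord_add _ _ _) _.
apply: eqm_trans (eqmD (coord_opp _ _) (eqm_refl _ _)) _.
by rewrite addNr; exact: eqm_sym (coord0 _).
Qed.

Lemma sol_oppK x : sol_opp (sol_opp x) = x.
Proof.
apply: coord_inj => n; apply: eqm_trans (coord_opp _ _) _.
by rewrite -[X in eqm _ _ X]opprK; apply: eqmN (coord_opp _ _).
Qed.

Lemma sol_projK x : sol_proj (sol_t x) (sol_x x) = x.
Proof. by apply: coord_inj => n; exact: coord_proj. Qed.

Definition near_coord n (e : R) x y := exists2 d : R, `|d| < e &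
  eqm (PR n) (coord n y) (coord n x + d).

(** Fixing N digits and confining the real component to an interval amounts to confining the single
    coordinate N: the topology is that of the inverse limit of circles. *)
Lemma sol_openP (U : set Sol) :
  sol_open U <-> forall x, U x -> exists n, exists2 e : R, 0 < e &
    forall y, near_coord n e x y -> U y.
Proof.
split.
  move=> oU x Ux; have [|e [e0 [N hN]]] := oU (sol_t x, sol_x x) _.
    by rewrite /= sol_projK.
  exists N, e => // y [d de [k hk]].
  (* Moving the representative of y along B by the integer [m] brings its real component to that of
     x plus d; its first N digits then become those of x. *)
  pose m : int := (dval (sol_x y) N)%:Z - (dval (sol_x x) N)%:Z + k * (Pa a N)%:Z.
  have hm : sol_t y - m%:~R = sol_t x + d.
    move: hk; rewrite /coord /m intrD intrB intrM /PR => hk.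
    have -> : sol_t y = sol_t x - (dval (sol_x x) N)%:R + d + k%:~R * (Pa a N)%:R + (dval (sol_x y) N)%:R.
      by rewrite -hk subrK.
    by rewrite -!pmulrn; ring.
  have hd n : eqm (PR n) (dval (dsub (sol_x y) (dint a m)) n)%:R ((dval (sol_x y) n)%:R - m%:~R).
    apply: eqm_trans (dval_dadd _ _ _ _) _; apply: eqmD (eqm_refl _ _) _.
    by apply: eqm_trans (dval_dopp _ _ _) _; apply: eqmN; exact: dval_dint.
  have -> : y = sol_proj (sol_t x + d) (dsub (sol_x y) (dint a m)).
    apply: coord_inj => n; apply: eqm_sym; apply: eqm_trans (coord_proj _ _ _) _.
    apply: eqm_trans (eqmB (eqm_refl _ _) (hd _)) _.
    rewrite -hm /coord opprB addrA subrK; exact: eqm_refl.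
  suff hv : dval (dsub (sol_x y) (dint a m)) N = dval (sol_x x) N.
    by apply: hN; [rewrite /= addrC addKr|exact: dval_digit hv].
  rewrite -(modn_small (dval_lt _ N)) -[RHS](modn_small (dval_lt _ N)).
  apply: (@eqm_nat_modn R); first exact: Pa_gt0.
  apply: eqm_trans (hd N) _; rewrite /m; exists (- k).
  by rewrite intrD intrB intrM /PR mulrNz -!pmulrn; ring.
move=> h [s y] /= Us; have [n [e e0 he]] := h _ Us.
exists e; split => //; exists n => s' y' /= hs hy; apply: he.
exists (s' - s) => //.
apply: eqm_trans (coord_proj _ _ _) _.
apply: eqm_sym; apply: eqm_trans (eqmD (coord_proj _ _ _) (eqm_refl _ _)) _.
have -> : dval y' n = dval y n by apply: eq_bigr => k _; rewrite hy.
have -> : s - (dval y n)%:R + (s' - s) = s' - (dval y n)%:R by ring.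
exact: eqm_refl.
Qed.

End Coordinates.

(** * Expectations and laws *)

Section BoundedMeasurable.
Context d (T : measurableType d) (R : realType).
Implicit Types f g : T -> R.

(** Such functions are integrable for every probability and closed under sums and products, so
    expectations are handled in R without separate integrability conditions. *)
Definition bmf f := measurable_fun setT f /\ exists M, forall x, `|f x| <= M.

Lemma bmf_cst (c : R) : bmf (fun=> c).
Proof. by split; [exact: measurable_cst|exists `|c|]. Qed.

Lemma bmfD f g : bmf f -> bmf g -> bmf (fun x => f x + g x).
Proof.
move=> [mf [M hM]] [mg [N hN]]; split; first exact: measurable_funD.
by exists (M + N) => x; apply: le_trans (ler_normD _ _) _; apply: lerD.
Qed.

Lemma bmfM f g : bmf f -> bmf g -> bmf (fun x => f x * g x).
Proof.
move=> [mf [M hM]] [mg [N hN]]; split; first exact: measurable_funM.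
by exists (M * N) => x; rewrite normrM; apply: ler_pM.
Qed.

Lemma bmfZ c f : bmf f -> bmf (fun x => c * f x).
Proof. exact: bmfM (bmf_cst c). Qed.

Lemma bmfN f : bmf f -> bmf (fun x => - f x).
Proof.
by move=> /(bmfZ (-1)); congr bmf; apply/funext => x; rewrite mulN1r.
Qed.

Lemma bmfB f g : bmf f -> bmf g -> bmf (fun x => f x - g x).
Proof. by move=> hf /bmfN; exact: bmfD. Qed.

Lemma bmf_indic (A : set T) : measurable A -> bmf (\1_A : T -> R).
Proof.
move=> mA; split; first exact: measurable_indic.
by exists 1 => x; rewrite indicE; case: (_ \in _); rewrite ?normr1 ?normr0.
Qed.

Lemma bmf_cos f : measurable_fun setT f -> bmf (fun x => cos (f x)).
Proof.
move=> mf; split; last by exists 1 => x; exact: cos_max.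
apply: (@measurableT_comp _ _ _ _ _ _ (@cos R)) => //.
exact: continuous_measurable_fun (@continuous_cos R).
Qed.

Lemma bmf_sin f : measurable_fun setT f -> bmf (fun x => sin (f x)).
Proof.
move=> mf; split; last by exists 1 => x; exact: sin_max.
apply: (@measurableT_comp _ _ _ _ _ _ (@sin R)) => //.
exact: continuous_measurable_fun (@continuous_sin R).
Qed.

End BoundedMeasurable.

Lemma bmf_comp d (T : measurableType d) d' (T' : measurableType d')
  (R : realType) (F : T -> T') (g : T' -> R) :
  measurable_fun setT F -> bmf g -> bmf (g \o F).
Proof.
move=> mF [mg [M hM]]; split; last by exists M => x; exact: hM.
exact: measurableT_comp.
Qed.

Section Expectation.
Context d (T : measurableType d) (R : realType) (mu : probability T R).
Implicit Types f g : T -> R.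

Definition Ex f : R := \int[mu]_x f x.

Lemma bmf_integrable f : bmf f -> mu.-integrable setT (EFin \o f).
Proof.
move=> [mf [M hM]]; apply: measurable_bounded_integrable => //.
  by rewrite [X in (X < _)%E]probability_setT ltry.
exists M; split; first exact: num_real.
by move=> B MB x _; apply: le_trans (hM x) (ltW MB).
Qed.

Lemma ExE f : bmf f -> (\int[mu]_x (f x)%:E = (Ex f)%:E)%E.
Proof.
move=> bf; rewrite /Ex /Rintegral fineK //.
by apply: integrable_fin_num => //; exact: bmf_integrable.
Qed.

Lemma Ex_cst (c : R) : Ex (fun=> c) = c.
Proof. by rewrite /Ex Rintegral_cst // [X in fine X]probability_setT mulr1. Qed.

Lemma ExD f g : bmf f -> bmf g -> Ex (fun x => f x + g x) = Ex f + Ex g.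
Proof. by move=> bf bg; apply: RintegralD => //; exact: bmf_integrable. Qed.

Lemma ExB f g : bmf f -> bmf g -> Ex (fun x => f x - g x) = Ex f - Ex g.
Proof. by move=> bf bg; apply: RintegralB => //; exact: bmf_integrable. Qed.

Lemma ExZ c f : bmf f -> Ex (fun x => c * f x) = c * Ex f.
Proof. by move=> bf; apply: RintegralZl => //; exact: bmf_integrable. Qed.

Lemma ler_Ex f g : bmf f -> bmf g -> (forall x, f x <= g x) -> Ex f <= Ex g.
Proof. by move=> bf bg h; apply: le_Rintegral => //; exact: bmf_integrable. Qed.

Lemma Ex_indic (A : set T) : measurable A -> (Ex \1_A)%:E = mu A.
Proof.
by move=> mA; rewrite -ExE ?integral_indic ?setIT //; exact: bmf_indic.
Qed.

Lemma Ex_ae f g : bmf f -> bmf g ->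
  (\forall x \ae mu, f x = g x) -> Ex f = Ex g.
Proof.
move=> [mf _] [mg _] h; congr fine; apply: ae_eq_integral => //.
- exact/measurable_EFinP.
- exact/measurable_EFinP.
- by apply: filterS h => x -> _.
Qed.

Lemma ae_mono (A B : T -> Prop) : (forall x, A x -> B x) ->
  {ae mu, forall x, A x} -> {ae mu, forall x, B x}.
Proof. by move=> AB; apply: filterS. Qed.

Lemma ae_mono2 (A B C : T -> Prop) : (forall x, A x -> B x -> C x) ->
  {ae mu, forall x, A x} -> {ae mu, forall x, B x} -> {ae mu, forall x, C x}.
Proof. by move=> ABC; apply: filterS2. Qed.

Lemma ae_probability1 (A : set T) : measurable A ->
  {ae mu, forall x, A x} -> mu A = 1%E.
Proof.
move=> mA h; rewrite -Ex_indic // (Ex_ae (bmf_indic _ mA) (bmf_cst _ 1)) ?Ex_cst //.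
by apply: ae_mono h => x Ax; rewrite indicE mem_set.
Qed.

Lemma Ex_cvg (F : nat -> T -> R) f M : (forall n, bmf (F n)) -> bmf f ->
  (forall n x, `|F n x| <= M) ->
  (\forall x \ae mu, (fun n => F n x) @ \oo --> f x) ->
  (fun n => Ex (F n)) @ \oo --> Ex f.
Proof.
move=> bF bf hM hF.
have /= := @dominated_convergence _ T R mu setT measurableT
  (fun n x => (F n x)%:E) (fun x => (f x)%:E) (fun=> M%:E).
case.
- by move=> n; apply/measurable_EFinP; case: (bF n).
- by apply/measurable_EFinP; case: bf.
- apply: filterS hF => x hx _; apply: cvg_EFin => //.
  by apply: nearW.
- exact: (@bmf_integrable (fun=> M) (bmf_cst _ _)).
- by apply: aeW => x n _; rewrite /= lee_fin.
- move=> _ _; rewrite ExE // => /fine_cvg /=.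
  exact.
Qed.

End Expectation.

Section Law.
Context d (T : measurableType d) d' (T' : measurableType d') (R : realType).

Lemma law_exists (P : probability T R) (F : T -> T') : measurable_fun setT F ->
  exists Q : probability T' R, forall A, Q A = P (F @^-1` A).
Proof.
move=> mF.
pose F' : {mfun T >-> T'} := MeasurableFun.Pack (MeasurableFun.Class (isMeasurableFun.Build _ _ _ _ _ mF)).
by exists (distribution P F').
Qed.

Lemma Ex_law (P : probability T R) (Q : probability T' R) (F : T -> T') g :
  measurable_fun setT F -> (forall A, measurable A -> Q A = P (F @^-1` A)) ->
  bmf g -> Ex Q g = Ex P (g \o F).
Proof.
move=> mF QP bg; congr fine.
pose F' : {mfun T >-> T'} := MeasurableFun.Pack (MeasurableFun.Class (isMeasurableFun.Build _ _ _ _ _ mF)).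
rewrite (@eq_measure_integral _ _ _ setT (distribution P F')); last by move=> A mA _; exact: QP.
rewrite integral_distribution //; first by apply/measurable_EFinP; case: bg.
exact: (@bmf_integrable _ _ _ P _ (bmf_comp mF bg)).
Qed.

End Law.

Lemma Ex_eq d (T : measurableType d) (R : realType) (P Q : probability T R) f :
  (forall A, measurable A -> P A = Q A) -> Ex P f = Ex Q f.
Proof. by move=> h; congr fine; apply: eq_measure_integral => A mA _; exact: h. Qed.

(** * Equality of probabilities from equal expectations on an algebra of functions *)

Section Uniqueness.
Context d (T : measurableType d) (R : realType).

Record bounded_algebra (A : (T -> R) -> Prop) : Prop := {
  balg_bmf : forall f, A f -> bmf f ;
  balg_cst : forall c, A (fun=> c) ;
  balg_add : forall f g, A f -> A g -> A (fun x => f x + g x) ;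
  balg_mul : forall f g, A f -> A g -> A (fun x => f x * g x) }.

Lemma balg_pow A (f : T -> R) n : bounded_algebra A -> A f -> A (fun x => f x ^+ n).
Proof.
move=> hA Af; elim: n => [|n ih]; first exact: balg_cst.
rewrite (_ : (fun x => _) = (fun x => f x * f x ^+ n)); first exact: balg_mul.
by apply/funext => x; rewrite exprS.
Qed.

Lemma balg_1sub A (f : T -> R) : bounded_algebra A -> A f -> A (fun x => 1 - f x).
Proof.
move=> hA Af; rewrite (_ : (fun x => _) = (fun x => 1 + (-1) * f x)); last first.
  by apply/funext => x; rewrite mulN1r.
apply: balg_add => //; first exact: balg_cst.
by apply: balg_mul => //; exact: balg_cst.
Qed.

(** The bounds 0 and 1 supply the domination for passing to the limit under expectations, and they
    survive products, which approximate intersections. *)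
Definition approximable A (E : set T) := exists F : nat -> T -> R,
  [/\ forall n, A (F n), forall n x, 0 <= F n x <= 1 &
      forall x, (fun n => F n x) @ \oo --> (\1_E x : R)].

Lemma approximableI A E E' : bounded_algebra A ->
  approximable A E -> approximable A E' -> approximable A (E `&` E').
Proof.
move=> hA [F [AF F01 cF]] [G [AG G01 cG]]; exists (fun n x => F n x * G n x); split.
- by move=> n; apply: balg_mul.
- move=> n x; have /andP[a0 a1] := F01 n x; have /andP[b0 b1] := G01 n x.
  by rewrite mulr_ge0 //= mulr_ile1.
- move=> x; rewrite indicI; exact: cvgM.
Qed.

Lemma Ex_approximable A (mu nu : probability T R) E : bounded_algebra A ->
  (forall f, A f -> Ex mu f = Ex nu f) -> measurable E ->
  approximable A E -> mu E = nu E.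
Proof.
move=> hA e mE [F [AF F01 cF]]; rewrite -!Ex_indic //; congr EFin.
have h (m : probability T R) : (fun n => Ex m (F n)) @ \oo --> Ex m \1_E.
  apply: (@Ex_cvg _ _ _ _ _ _ 1).
  - by move=> n; exact: (balg_bmf hA).
  - exact: bmf_indic.
  - by move=> n x; have /andP[a0 a1] := F01 n x; rewrite ger0_norm.
  - exact: aeW.
have := h mu; rewrite (_ : (fun n => _) = (fun n => Ex nu (F n))); last first.
  by apply/funext => n; exact: e.
by move=> h1; apply: cvg_unique h1 (h nu).
Qed.

(* For v in [0, 1], (1 - v^n)^(2^n) tends to 1 if v < 1/2 and to 0 if v > 1/2. *)
Lemma pow_switch_cvg1 (v : R) : 0 <= v < 1 / 2 ->
  (fun n => (1 - v ^+ n) ^+ (2 ^ n)) @ \oo --> (1 : R).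
Proof.
move=> /andP[v0 v1].
(* Bernoulli's inequality; with exponent 2^n and u = v^n it bounds the sequence below by 1 - (2
   v)^n. *)
have bern (u : R) n : 0 <= u <= 1 -> 1 - n%:R * u <= (1 - u) ^+ n.
  move=> /andP[u0 u1]; elim: n => [|n ih]; first by rewrite mul0r subr0 expr0.
  rewrite exprS; have : (1 - u) * (1 - n%:R * u) <= (1 - u) * (1 - u) ^+ n.
    by apply: ler_wpM2l => //; rewrite subr_ge0.
  apply: le_trans; rewrite -natr1.
  have : 0 <= n%:R * u * u by rewrite !mulr_ge0.
  by lra.
have h0 : (fun n => (2 * v) ^+ n) @ \oo --> (0 : R).
  by apply: cvg_expr; rewrite ger0_norm ?mulr_ge0 //; lra.
have h1 : (fun n => 1 - (2 * v) ^+ n) @ \oo --> (1 : R).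
  rewrite -[X in _ --> X]subr0; apply: cvgB => //; exact: cvg_cst.
apply: (squeeze_cvgr _ h1 (cvg_cst (1 : R))); apply: nearW => n.
have u01 : 0 <= v ^+ n <= 1 by rewrite exprn_ge0 //= exprn_ile1 //; lra.
have := bern _ (2 ^ n)%N u01; rewrite natrX exprMn => ->/=.
by case/andP: u01 => u0 u1; apply: exprn_ile1; lra.
Qed.

Lemma pow_switch_cvg0 (v : R) : 1 / 2 < v <= 1 ->
  (fun n => (1 - v ^+ n) ^+ (2 ^ n)) @ \oo --> (0 : R).
Proof.
move=> /andP[v1 v2].
(* A companion of Bernoulli's inequality; with exponent 2^n and u = v^n it bounds the sequence above
   by (2 v)^(-n). *)
have bern (u : R) n : 0 <= u <= 1 -> (1 - u) ^+ n * (1 + n%:R * u) <= 1.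
  move=> /andP[u0 u1]; elim: n => [|n ih]; first by rewrite mul0r addr0 expr0 mulr1.
  apply: le_trans ih; rewrite exprS -mulrA.
  have p0 : 0 <= (1 - u) ^+ n by apply: exprn_ge0; lra.
  rewrite mulrCA; apply: ler_wpM2l => //; rewrite -natr1.
  have : 0 <= n%:R * u * u by rewrite !mulr_ge0.
  have : 0 <= u * u by rewrite mulr_ge0.
  by lra.
have h0 : (fun n => ((2 * v)^-1) ^+ n) @ \oo --> (0 : R).
  apply: cvg_expr; rewrite ger0_norm ?invr_ge0; last by lra.
  by rewrite invf_lt1 //; lra.
apply: (squeeze_cvgr _ (cvg_cst 0) h0); apply: nearW => n.
have u01 : 0 <= v ^+ n <= 1 by rewrite exprn_ge0 ?exprn_ile1 //=; lra.
have := bern _ (2 ^ n)%N u01; rewrite natrX -exprMn => hb.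
have /andP[u0 u1] := u01.
have p0 : 0 <= (1 - v ^+ n) ^+ (2 ^ n) by apply: exprn_ge0; lra.
have q0 : 0 < (2 * v) ^+ n by apply: exprn_gt0; lra.
rewrite p0 /= exprVn -[leRHS]mul1r ler_pdivlMr //.
apply: le_trans hb; apply: ler_wpM2l => //; lra.
Qed.

(** After scaling, v = (1 - f / B) / 2 is below 1/2 exactly where f > 0, so (1 - v^n)^(2^n)
    separates the signs of f. Where f = 0 it tends to 1 / e rather than 0; the second factor, built
    from w = (f / B)^2, vanishes there for every n and tends to 1 elsewhere. *)
Lemma approximable_gt0 A (f : T -> R) : bounded_algebra A -> A f ->
  approximable A [set x | 0 < f x].
Proof.
move=> hA Af; have [_ [M hM]] := balg_bmf hA Af.
pose B : R := `|M| + 1; have B0 : 0 < B by rewrite /B; have := normr_ge0 M; lra.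
have fB x : `|f x| < B by rewrite /B; have := hM x; have := ler_norm M; lra.
pose v x : R := 1 / 2 - (2 * B)^-1 * f x.
have vE x : v x = (1 - f x / B) / 2 by rewrite /v; field; rewrite gt_eqF.
have q1 x : -1 < f x / B < 1.
  have := fB x; rewrite ltr_norml => /andP[h1 h2].
  by rewrite ltr_pdivlMr // ltr_pdivrMr // mulN1r mul1r h1.
have v01 x : 0 <= v x <= 1 by rewrite vE; have := q1 x; lra.
have Av : A v.
  rewrite (_ : v = (fun x => 1 / 2 + (- (2 * B)^-1) * f x)); last first.
    by apply/funext => x; rewrite /v mulNr.
  apply: balg_add => //; first exact: balg_cst.
  by apply: balg_mul => //; exact: balg_cst.
pose w x : R := (2 * v x - 1) ^+ 2.
have Aw : A w.
  apply: (balg_pow 2 hA); apply: balg_add => //; last exact: balg_cst.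
  by apply: balg_mul => //; exact: balg_cst.
have wE x : w x = (f x / B) ^+ 2 by rewrite /w vE; field; rewrite gt_eqF.
have w01 x : 0 <= w x < 1.
  rewrite wE sqr_ge0 /= -real_normK ?num_real // expr_lt1 //.
  by rewrite ltr_norml; exact: q1.
exists (fun n x => (1 - v x ^+ n) ^+ (2 ^ n) * (1 - (1 - w x) ^+ n)); split.
- move=> n; apply: balg_mul => //.
    by apply: balg_pow => //; apply: balg_1sub => //; exact: balg_pow.
  by apply: balg_1sub => //; apply: balg_pow => //; exact: balg_1sub.
- move=> n x; have /andP[v0 v1] := v01 x; have /andP[w0 w1] := w01 x.
  have p01 : 0 <= 1 - v x ^+ n <= 1.
    by rewrite subr_ge0 exprn_ile1 //= lerBlDr lerDl exprn_ge0.
  have r01 : 0 <= 1 - (1 - w x) ^+ n <= 1.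
    have : 0 <= (1 - w x) ^+ n <= 1 by rewrite exprn_ge0 ?exprn_ile1 //; lra.
    by move=> /andP[r0 r1]; apply/andP; split; lra.
  case/andP: p01 => p0 p1; case/andP: r01 => r0 r1.
  by rewrite mulr_ge0 ?exprn_ge0 //= mulr_ile1 ?exprn_ge0 ?exprn_ile1.
- move=> x; have /andP[v0 v1] := v01 x; have /andP[w0 w1] := w01 x.
  have cw : f x != 0 -> (fun n => 1 - (1 - w x) ^+ n) @ \oo --> (1 : R).
    move=> fx0; rewrite -[X in _ --> X]subr0; apply: cvgB; first exact: cvg_cst.
    apply: cvg_expr; have : 0 < w x.
      by rewrite wE exprn_even_gt0 //= mulf_neq0 // invr_neq0 // gt_eqF.
    by rewrite ltr_norml; lra.
  rewrite indicE; have [fx|fx|fx] := ltgtP (f x) 0.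
  + rewrite memNset; last by rewrite /= ltNge ltW.
    rewrite -[X in _ --> X](mulr1 0); apply: cvgM; last by apply: cw; rewrite lt_eqF.
    apply: pow_switch_cvg0; rewrite v1 andbT vE.
    have : f x / B < 0 by rewrite pmulr_llt0 ?invr_gt0.
    by lra.
  + rewrite mem_set //= -[X in _ --> X](mulr1 1); apply: cvgM; last by apply: cw; rewrite gt_eqF.
    apply: pow_switch_cvg1; rewrite v0 /= vE.
    have : 0 < f x / B by rewrite divr_gt0.
    by lra.
  + rewrite memNset; last by rewrite /= fx ltxx.
    have -> : w x = 0 by rewrite wE fx mul0r expr0n.
    apply: cvg_near_cst; apply: nearW => n.
    by rewrite subr0 expr1n subrr mulr0.
Qed.

(** The measurable approximable sets form a pi-system on which both measures agree by dominated
    convergence; uniqueness of measures extends the equality to the sigma-algebra they generate. *)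
Lemma eq_probability_algebra A (mu nu : probability T R) : bounded_algebra A ->
  (forall f, A f -> Ex mu f = Ex nu f) ->
  @measurable _ T = <<s [set E | measurable E /\ approximable A E] >> ->
  forall E, measurable E -> mu E = nu E.
Proof.
move=> hA e mG E mE.
apply: (measure_unique [set E | measurable E /\ approximable A E] (fun=> setT)) => //.
- by move=> E1 E2 [m1 a1] [m2 a2]; split; [exact: measurableI|exact: approximableI].
- move=> _; split=> //; exists (fun _ _ => 1); split.
  + by move=> n; exact: balg_cst.
  + by move=> n x; rewrite ler01 lexx.
  + by move=> x; rewrite indicE in_setT; exact: cvg_cst.
- by rewrite bigcup_const.
- by move=> F [mF aF]; exact: (Ex_approximable hA).
- by move=> _; rewrite -ge0_fin_numE // fin_num_measure.
Qed.

End Uniqueness.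

(** * Characters *)

Section Trigonometry.
Variable R : realType.
Implicit Types u v w : R.

Lemma eqm_reduce u : exists w, - pi <= w < pi /\ eqm (2 * pi) u w.
Proof.
have p0 : 0 < 2 * pi :> R by have := pi_gt0 R; lra.
have /andP[h1 h2] := floor_itv (u / (2 * pi) + 1 / 2).
exists (u - (Num.floor (u / (2 * pi) + 1 / 2))%:~R * (2 * pi)).
split; last first.
  by apply: eqm_sym; exists (- Num.floor (u / (2 * pi) + 1 / 2)); rewrite mulrNz mulNr.
move: h1 h2; rewrite intrD; move: (_%:~R) => k h1 h2.
have {}h1 : k * (2 * pi) <= (u / (2 * pi) + 1 / 2) * (2 * pi) by rewrite ler_pM2r.
have {}h2 : (u / (2 * pi) + 1 / 2) * (2 * pi) < (k + 1) * (2 * pi) by rewrite ltr_pM2r.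
have e2 : (u / (2 * pi) + 1 / 2) * (2 * pi) = u + pi.
  by rewrite mulrDl divfK ?gt_eqF //; lra.
rewrite e2 in h1 h2.
by apply/andP; split; lra.
Qed.

Lemma cos_gt_small u v : 0 <= v <= pi -> cos v < cos u ->
  exists w, `|w| < v /\ eqm (2 * pi) u w.
Proof.
move=> v01; have [w [/andP[w1 w2] uw]] := eqm_reduce u.
rewrite (cos_eqm uw) -(cos_norm w) => h; exists w; split => //.
rewrite -ltr_cos // in_itv /=.
by rewrite normr_ge0 ler_norml w1 ltW.
Qed.

Lemma cosM u v : cos u * cos v = 1 / 2 * cos (u + v) + 1 / 2 * cos (u - v).
Proof. by rewrite cosD cosB; lra. Qed.

(** An argument is meaningful only modulo 2 pi, so measurability is asked of its cosine and sine,
    which do not change along [eqm]. *)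
Definition trig_measurable d (T : measurableType d) (g : T -> R) :=
  measurable_fun setT (fun t => cos (g t)) /\ measurable_fun setT (fun t => sin (g t)).

Section TrigMeasurable.
Context d (T : measurableType d).
Implicit Types g h : T -> R.

Lemma trig_measurable_real g : measurable_fun setT g -> trig_measurable g.
Proof. by move=> mg; split; [have [] := bmf_cos mg|have [] := bmf_sin mg]. Qed.

Lemma trig_measurableD g h : trig_measurable g -> trig_measurable h ->
  trig_measurable (fun t => g t + h t).
Proof.
move=> [cg sg] [ch sh]; split.
  under eq_fun do rewrite cosD.
  by apply: measurable_funB; apply: measurable_funM.
under eq_fun do rewrite sinD.
by apply: measurable_funD; apply: measurable_funM.
Qed.

Lemma trig_measurableN g : trig_measurable g -> trig_measurable (fun t => - g t).
Proof.
move=> [cg sg]; split; first by under eq_fun do rewrite cosN.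
under eq_fun do rewrite sinN.
exact: measurableT_comp.
Qed.

Lemma trig_measurable_eqm g h : (forall t, eqm (2 * pi) (g t) (h t)) ->
  trig_measurable g -> trig_measurable h.
Proof.
move=> gh [cg sg]; split.
  by move: cg; congr measurable_fun; apply/funext => t; apply: cos_eqm.
by move: sg; congr measurable_fun; apply/funext => t; apply: sin_eqm.
Qed.

Lemma trig_measurable_bmf g : trig_measurable g ->
  bmf (fun t => cos (g t)) /\ bmf (fun t => sin (g t)).
Proof.
by move=> [cg sg]; split; split => //; exists 1 => x; [exact: cos_max|exact: sin_max].
Qed.

Lemma trig_measurable_cosD g c : trig_measurable g -> bmf (fun t => cos (g t + c)).
Proof.
move=> mg; apply: (trig_measurable_bmf _).1; exact: trig_measurableD.
Qed.

End TrigMeasurable.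

Lemma trig_measurable_comp d (T : measurableType d) d' (T' : measurableType d')
  (F : T -> T') (g : T' -> R) :
  measurable_fun setT F -> trig_measurable g -> trig_measurable (g \o F).
Proof.
move=> mF [cg sg]; split.
  exact: (measurableT_comp cg mF).
exact: (measurableT_comp sg mF).
Qed.

End Trigonometry.

(** * Characters of the solenoid and uniqueness of the Fourier transform *)

Section Characters.
Variables (R : realType) (a : seqa).
Local Notation Sol := (Sol R a).
Local Notation SolM := (SolM R a).
Local Notation PR := (PR a R).
Implicit Types (x : Sol) (y z : R).

Definition int_at n y := exists j : int, y * PR n = j%:~R.

(* The group H_a. *)
Definition inH y := exists n, int_at n y.

(** An arbitrary admissible level is chosen, with default 0 outside H_a; [phase_at] shows that the
    choice does not matter modulo 2 pi. *)
Definition level y : nat := xget 0%N [set n | int_at n y].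

(* [phase y x], defined modulo 2 pi, is the argument of the value at x of the
   character indexed by y. *)
Definition phase y x : R := 2 * pi * y * coord (level y) x.

Lemma int_at_le m n y : (m <= n)%N -> int_at m y -> int_at n y.
Proof.
move=> /(dvdn_Pa a) /dvdnP[k e] [j hj]; exists (k%:Z * j).
by rewrite /PR e natrM mulrCA hj intrM.
Qed.

Lemma int_at_level y : inH y -> int_at (level y) y.
Proof. by move=> [n hn]; rewrite /level; case: xgetP => [m -> //|/(_ n)]. Qed.

Lemma inH0 : inH 0. Proof. by exists 0%N, 0; rewrite mul0r. Qed.

Lemma inHD y z : inH y -> inH z -> inH (y + z).
Proof.
move=> [n hy] [m hz]; exists (maxn n m).
have [j ej] := int_at_le (leq_maxl n m) hy.
have [k ek] := int_at_le (leq_maxr n m) hz.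
by exists (j + k); rewrite mulrDl ej ek intrD.
Qed.

Lemma inHMz (k : int) y : inH y -> inH (k%:~R * y).
Proof. by move=> [n [j e]]; exists n, (k * j); rewrite -mulrA e intrM. Qed.

Lemma inHN y : inH y -> inH (- y).
Proof. by move=> /(inHMz (-1)); rewrite mulN1r. Qed.

Lemma inHB y z : inH y -> inH z -> inH (y - z).
Proof. by move=> hy /inHN; apply: inHD. Qed.

Lemma inH_invP n : inH (PR n)^-1.
Proof. by exists n, 1; rewrite mulVf // gt_eqF // PR_gt0. Qed.

Lemma eqm_char n y u v : int_at n y -> eqm (PR n) u v ->
  eqm (2 * pi) (2 * pi * y * u) (2 * pi * y * v).
Proof.
move=> [j e] /(eqmM (2 * pi * y)); rewrite -mulrA e mulrC.
exact: eqm_dvd.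
Qed.

Lemma phase_at n y x : int_at n y -> eqm (2 * pi) (phase y x) (2 * pi * y * coord n x).
Proof.
move=> hn; have hl := int_at_level (ex_intro _ n hn).
have [le|/ltnW le] := leqP n (level y).
  exact: eqm_char hn (coord_le x le).
by apply: eqm_sym; apply: eqm_char hl (coord_le x le).
Qed.

Lemma phase0 x : phase 0 x = 0.
Proof. by rewrite /phase mulr0 mul0r. Qed.

Lemma phaseD y z x : inH y -> inH z ->
  eqm (2 * pi) (phase (y + z) x) (phase y x + phase z x).
Proof.
move=> [n hy] [m hz].
have {}hy := int_at_le (leq_maxl n m) hy.
have {}hz := int_at_le (leq_maxr n m) hz.
have hs : int_at (maxn n m) (y + z).
  by have [j ej] := hy; have [k ek] := hz; exists (j + k); rewrite mulrDl ej ek intrD.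
apply: eqm_trans (phase_at x hs) _; rewrite (mulrDr (2 * pi)) (mulrDl (2 * pi * y)).
by apply: eqm_sym; apply: eqmD; exact: phase_at.
Qed.

Lemma phaseMz (k : int) y x : inH y ->
  eqm (2 * pi) (phase (k%:~R * y) x) (k%:~R * phase y x).
Proof.
move=> [n hy]; have hs : int_at n (k%:~R * y).
  by have [j e] := hy; exists (k * j); rewrite -mulrA e intrM.
apply: eqm_trans (phase_at x hs) _.
have -> : 2 * pi * (k%:~R * y) * coord n x = k%:~R * (2 * pi * y * coord n x) by ring.
by apply: eqmMz; apply: eqm_sym; exact: phase_at.
Qed.

Lemma phaseN y x : inH y -> eqm (2 * pi) (phase (- y) x) (- phase y x).
Proof. by move=> /(phaseMz (-1) x); rewrite !mulN1r. Qed.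

Lemma phaseB y z x : inH y -> inH z ->
  eqm (2 * pi) (phase (y - z) x) (phase y x - phase z x).
Proof.
move=> hy hz; apply: eqm_trans (phaseD x hy (inHN hz)) _.
by apply: eqmD (eqm_refl _ _) (phaseN _ hz).
Qed.

Lemma phase_char y x (v : nat -> R) : inH y ->
  (forall n, eqm (PR n) (coord n x) (v n)) ->
  eqm (2 * pi) (phase y x) (2 * pi * y * v (level y)).
Proof. by move=> /int_at_level hy hv; apply: eqm_char hy (hv _). Qed.

Lemma phase_add y x x' : inH y ->
  eqm (2 * pi) (phase y (sol_add x x')) (phase y x + phase y x').
Proof.
move=> hy; have := @phase_char y (sol_add x x') (fun n => coord n x + coord n x') hy.
by rewrite (mulrDr (2 * pi * y)); apply => n; exact: coord_add.
Qed.

Lemma phase_opp y x : inH y -> eqm (2 * pi) (phase y (sol_opp x)) (- phase y x).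
Proof.
move=> hy; have := @phase_char y (sol_opp x) (fun n => - coord n x) hy.
by rewrite mulrN; apply => n; exact: coord_opp.
Qed.

Lemma phase_muln y k x : inH y ->
  eqm (2 * pi) (phase y (sol_muln k x)) (k%:R * phase y x).
Proof.
move=> hy; have := @phase_char y (sol_muln k x) (fun n => k%:R * coord n x) hy.
by rewrite mulrCA; apply => n; exact: coord_muln.
Qed.

Lemma phase_sol0 y : inH y -> eqm (2 * pi) (phase y (sol0 R a)) 0.
Proof.
move=> hy; have := @phase_char y (sol0 R a) (fun=> 0) hy.
by rewrite mulr0; apply => n; exact: coord0.
Qed.

(** The character indexed by 1 / P_n is the n-th coordinate rescaled by 2 pi / P_n. This is why
    characters separate points and generate the topology. *)
Lemma phase_invP n x w : eqm (2 * pi) (phase (PR n)^-1 x) w ->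
  eqm (PR n) (coord n x) (PR n / (2 * pi) * w).
Proof.
have p0 := PR_gt0 a R n; have pi0 := pi_gt0 R.
move=> h; have hn : int_at n (PR n)^-1 by exists 1; rewrite mulVf // gt_eqF.
have {h} /(eqmM (PR n / (2 * pi))) := eqm_trans (eqm_sym (phase_at x hn)) h.
rewrite divfK; last by rewrite gt_eqF // mulr_gt0.
have e (p q c : R) : 0 < p -> 0 < q -> q / (2 * p) * (2 * p / q * c) = c.
  by move=> hp hq; field; rewrite !gt_eqF.
by rewrite e.
Qed.

Lemma phase_inj x x' :
  (forall y, inH y -> eqm (2 * pi) (phase y x) (phase y x')) -> x = x'.
Proof.
move=> h; apply: coord_inj => n.
apply: eqm_trans (phase_invP (eqm_refl _ _)) _.
by apply: eqm_sym; apply: phase_invP; apply: eqm_sym; apply: h; exact: inH_invP.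
Qed.

Lemma phase_near y n (e : R) x x' : int_at n y -> near_coord n e x x' ->
  exists2 d, `|d| <= 2 * pi * `|y| * e & eqm (2 * pi) (phase y x') (phase y x + d).
Proof.
move=> hn [d de hd]; have pi0 := pi_gt0 R.
exists (2 * pi * y * d).
  rewrite 2!normrM [`|2 * pi|]ger0_norm; last by rewrite mulr_ge0 // ltW.
  by apply: ler_wpM2l; [rewrite !mulr_ge0 // ltW|exact: ltW].
apply: eqm_trans (phase_at x' hn) _; apply: eqm_trans (eqm_char hn hd) _.
by rewrite (mulrDr (2 * pi * y)); apply: eqmD (eqm_sym (phase_at x hn)) (eqm_refl _ _).
Qed.

Lemma sol_open_phase y (h : R -> R) (V : set R) : inH y -> continuous h ->
  (forall u v, eqm (2 * pi) u v -> h u = h v) -> open V ->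
  sol_open [set x : Sol | V (h (phase y x))].
Proof.
move=> /int_at_level hy ch hp oV; apply/sol_openP => x /= Vx.
have : nbhs (phase y x) (h @^-1` V) by apply: ch; exact: open_nbhs_nbhs.
move=> /nbhs_ballP[e /= e0 he]; have pi0 := pi_gt0 R.
have c0 : 0 < 2 * pi * `|y| + 1 by rewrite ltr_wpDl // !mulr_ge0 // ltW.
exists (level y), (e / (2 * pi * `|y| + 1)); first by rewrite divr_gt0.
move=> x' hx'; have [d dl hd] := phase_near hy hx'.
rewrite (hp _ _ hd); apply: he; rewrite /ball /= opprD addrA subrr sub0r normrN.
apply: le_lt_trans dl _; rewrite mulrA ltr_pdivrMr // mulrC ltr_pM2l //.
by rewrite ltrDl.
Qed.

Lemma sol_open_cos_gt y (c t : R) : inH y ->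
  sol_open [set x : Sol | t < cos (phase y x + c)].
Proof.
move=> hy; have := @sol_open_phase y (fun u => cos (u + c)) `]t, +oo[%classic hy.
rewrite (_ : [set x | `]t, +oo[%classic _] = [set x | t < cos (phase y x + c)]); last first.
  by apply/seteqP; split => x /=; rewrite in_itv /= andbT.
apply; last exact: interval_open.
- move=> u; apply: (@continuous_comp _ _ _ (fun u => u + c) cos); last exact: continuous_cos.
  by apply: cvgD => //; exact: cvg_cst.
- by move=> u v huv; apply: cos_eqm; apply: eqmD huv (eqm_refl _ _).
Qed.

Lemma measurable_cos_phase y c : inH y ->
  measurable_fun setT (fun x : SolM => cos (phase y x + c)).
Proof.
move=> hy; refine (measurability _ (RGenOInfty.measurableE R) _).
move=> _ [_ [t ->] <-]; rewrite setTI; apply: sub_sigma_algebra.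
rewrite (_ : _ @^-1` _ = [set x | t < cos (phase y x + c)]); first exact: sol_open_cos_gt.
by apply/seteqP; split => x /=; rewrite in_itv /= andbT.
Qed.

Lemma trig_measurable_phase y : inH y -> trig_measurable (phase y : SolM -> R).
Proof.
move=> hy; split.
  by have := @measurable_cos_phase y 0 hy; under eq_fun do rewrite addr0.
have := @measurable_cos_phase y (- (pi / 2)) hy.
by under eq_fun do rewrite cosBpihalf.
Qed.

Definition arc y (c t : R) : set Sol := [set x | t < cos (phase y x + c)].
Definition arcs : set (set Sol) := [set A | exists y c t, inH y /\ A = arc y c t].

(** Rational shifts and half-widths 2 / (k + 1) leave only countably many arcs, so that every open
    set is a countable union of arcs. *)
Lemma near_arc n (e : R) x : 0 < e ->
  exists (q : rat) (k : nat), arc (PR n)^-1 (ratr q) (cos (2 * k.+1%:R^-1)) x /\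
    arc (PR n)^-1 (ratr q) (cos (2 * k.+1%:R^-1)) `<=` near_coord n e x.
Proof.
move=> e0; have p0 := PR_gt0 a R n; have pi0 := pi_gt0 R; have pi2 := pi_ge2 R.
(* With t = 1 / (k + 1), the arc has half-width 2 t and its centre lies within t of the argument of
   x, so its points differ from x by less than 3 t in argument. The n-th coordinate is the argument
   times P_n / (2 pi), whence 3 c = 2 pi e / P_n. *)
pose c := e * (2 * pi) / (3 * PR n).
have c0 : 0 < c by rewrite divr_gt0 ?mulr_gt0.
have [k hk] : exists k : nat, k.+1%:R^-1 < c.
  exists (Num.bound c^-1); rewrite invf_plt ?posrE //.
  apply: lt_le_trans (archi_boundP _) _; first by rewrite invr_ge0 ltW.
  by rewrite ler_nat.
have k0 : 0 < k.+1%:R^-1 :> R by rewrite invr_gt0.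
have k1 : k.+1%:R^-1 <= 1 :> R by rewrite invf_le1 // ler1n.
have [t et] : exists t : R, t = k.+1%:R^-1 by exists k.+1%:R^-1.
rewrite -et in hk k0 k1.
have hlt : - phase (PR n)^-1 x - t < - phase (PR n)^-1 x + t by lra.
have [q] := rat_in_itvoo hlt.
rewrite in_itv /= => /andP[q1 q2]; exists q, k; rewrite -et; set u := phase _ x in q1 q2 *.
have uq : `|u + ratr q| < t by rewrite ltr_norml; apply/andP; split; lra.
split.
  have h1 : 2 * t \in `[0, pi] by rewrite in_itv /=; apply/andP; split; lra.
  have h2 : `|u + ratr q| \in `[0, pi].
    by rewrite in_itv /= normr_ge0 /=; apply: (le_trans (ltW uq)); lra.
  by rewrite /arc /= -/u -[cos (u + _)]cos_norm (ltr_cos h2 h1); apply: (lt_trans uq); lra.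
move=> z /= hz; have [|w [w1 w2]] := cos_gt_small _ hz.
  by apply/andP; split; lra.
exists (PR n / (2 * pi) * (w - (u + ratr q))).
  have h : `|w - (u + ratr q)| < 3 * c.
    by apply: le_lt_trans (ler_normB _ _) _; lra.
  rewrite normrM ger0_norm; last by rewrite divr_ge0 ?mulr_ge0 // ltW.
  rewrite -ltr_pdivlMl ?divr_gt0 ?mulr_gt0 //; apply: lt_le_trans h _.
  have ee (p r : R) : 0 < p -> 0 < r -> 3 * (e * (2 * p) / (3 * r)) = (r / (2 * p))^-1 * e.
    by move=> hp hq; field; rewrite !gt_eqF.
  by rewrite /c ee.
have hw : eqm (2 * pi) (phase (PR n)^-1 z) (u + (w - (u + ratr q))).
  have -> : u + (w - (u + ratr q)) = w - ratr q by ring.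
  have := eqmB w2 (eqm_refl _ (ratr q)); by rewrite addrK.
apply: eqm_trans (phase_invP hw) _; rewrite (mulrDr (PR n / (2 * pi))).
by apply: eqmD (eqm_refl _ _); apply: eqm_sym; apply: phase_invP; exact: eqm_refl.
Qed.

Lemma measurable_arcs : @measurable _ SolM = <<s arcs >>.
Proof.
apply/seteqP; split; last first.
  apply: smallest_sub; first exact: sigma_algebra_measurable.
  by move=> _ [y [c [t [hy ->]]]]; apply: sub_sigma_algebra; exact: sol_open_cos_gt.
apply: smallest_sub; first exact: smallest_sigma_algebra.
move=> U /sol_openP oU.
pose A (i : nat * rat * nat) := arc (PR i.1.1)^-1 (ratr i.1.2) (cos (2 * i.2.+1%:R^-1)).
have -> : U = \bigcup_(m : nat) (if unpickle m is Some i then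
    (if `[< A i `<=` U >] then A i else set0) else set0).
  apply/seteqP; split => x.
    move=> Ux; have [n [e e0 he]] := oU x Ux.
    have [q [k [hx hs]]] := near_arc n x e0.
    exists (pickle (n, q, k)) => //; rewrite pickleK.
    case: asboolP => // -[]; exact: subset_trans hs he.
  move=> [m _]; case: (unpickle m) => // i.
  by case: asboolP => // h /h.
apply: (@bigcupT_measurable _ (g_sigma_algebraType arcs)) => m.
case: (unpickle m) => [i|]; last exact: measurable0.
case: ifP => _; last exact: measurable0.
by apply: sub_sigma_algebra; exists (PR i.1.1)^-1, (ratr i.1.2), (cos (2 * i.2.+1%:R^-1)); split => //; exact: inH_invP.
Qed.

Lemma measurable_sol d (T : measurableType d) (F : T -> SolM) :
  (forall y, inH y -> trig_measurable (fun t => phase y (F t))) ->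
  measurable_fun setT F.
Proof.
move=> h; refine (measurability _ measurable_arcs _).
move=> _ [_ [y [c [t [hy ->]]]] <-].
have [mc _] := trig_measurable_cosD c (h y hy).
have := mc measurableT `]t, +oo[%classic (measurable_itv _).
rewrite !setTI; congr measurable.
by apply/seteqP; split => s /=; rewrite in_itv /= andbT.
Qed.

(** Real trigonometric polynomials: the shift c supplies the sines, and the product-to-sum formula
    keeps the class closed under multiplication. *)
Inductive trig_poly : (Sol -> R) -> Prop :=
| trig_poly_char y c : inH y -> trig_poly (fun x => cos (phase y x + c))
| trig_poly_add f g : trig_poly f -> trig_poly g -> trig_poly (fun x => f x + g x)
| trig_poly_scale c f : trig_poly f -> trig_poly (fun x => c * f x).

Lemma trig_poly_mul f g : trig_poly f -> trig_poly g -> trig_poly (fun x => f x * g x).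
Proof.
move=> hf hg; elim: hf => {f} [y c hy|f1 f2 _ h1 _ h2|c f _ h].
- elim: hg => {g} [z e hz|g1 g2 _ h1 _ h2|e g _ h].
  + have := trig_poly_add
      (trig_poly_scale (1 / 2) (trig_poly_char (c + e) (inHD hy hz)))
      (trig_poly_scale (1 / 2) (trig_poly_char (c - e) (inHB hy hz))).
    congr trig_poly; apply/funext => x; rewrite cosM; congr (_ * _ + _ * _).
      by apply: cos_eqm; rewrite addrACA; apply: eqmD (phaseD x hy hz) (eqm_refl _ _).
    apply: cos_eqm; rewrite opprD addrACA.
    exact: eqmD (phaseB x hy hz) (eqm_refl _ _).
  + have := trig_poly_add h1 h2.
    by congr trig_poly; apply/funext => x; rewrite mulrDr.
  + have := trig_poly_scale e h.
    by congr trig_poly; apply/funext => x; rewrite mulrCA.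
- have := trig_poly_add h1 h2.
  by congr trig_poly; apply/funext => x; rewrite mulrDl.
- have := trig_poly_scale c h.
  by congr trig_poly; apply/funext => x; rewrite mulrA.
Qed.

Lemma bmf_cos_phase y c : inH y -> bmf (fun x : SolM => cos (phase y x + c)).
Proof. by move=> hy; apply: trig_measurable_cosD; exact: trig_measurable_phase. Qed.

Lemma trig_poly_algebra : bounded_algebra (trig_poly : (SolM -> R) -> Prop).
Proof.
split.
- move=> f; elim => {f} [y c hy|f g _ bf _ bg|c f _ bf].
  + exact: bmf_cos_phase.
  + exact: bmfD.
  + exact: bmfZ.
- move=> c; have := trig_poly_scale c (trig_poly_char 0 inH0).
  by congr trig_poly; apply/funext => x; rewrite phase0 addr0 cos0 mulr1.
- exact: trig_poly_add.
- exact: trig_poly_mul.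
Qed.

(** An arc is the positivity set of the trigonometric polynomial cos (phase y x + c) - t, hence
    approximable, and arcs generate the Borel sets. *)
Lemma fourier_unique (mu nu : probability SolM R) :
  (forall y c, inH y -> Ex mu (fun x => cos (phase y x + c)) = Ex nu (fun x => cos (phase y x + c))) ->
  forall A, measurable A -> mu A = nu A.
Proof.
move=> h; apply: (eq_probability_algebra trig_poly_algebra).
  move=> f; elim => {f} [y c hy|f g hf ef hg eg|c f hf ef].
  - exact: h.
  - by rewrite !ExD ?ef ?eg //; exact: (balg_bmf trig_poly_algebra).
  - by rewrite !ExZ ?ef //; exact: (balg_bmf trig_poly_algebra).
apply/seteqP; split; last first.
  apply: smallest_sub; first exact: sigma_algebra_measurable.
  by move=> E [].
rewrite {1}measurable_arcs; apply: sub_smallest2r.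
  exact: smallest_sigma_algebra.
move=> _ [y [c [t [hy ->]]]]; split; first by apply: sub_sigma_algebra; exact: sol_open_cos_gt.
have -> : arc y c t = [set x : SolM | 0 < cos (phase y x + c) + - t].
  by apply/seteqP; split => x /=; rewrite /arc /= subr_gt0.
apply: (approximable_gt0 trig_poly_algebra).
apply: trig_poly_add; first exact: trig_poly_char.
exact: (balg_cst trig_poly_algebra).
Qed.

End Characters.

(** * The functional equation of the characteristic function *)

Section Independence.
Context d (T : measurableType d) (R : realType) (P : probability T R).
Context d' (S : measurableType d') (mu : probability S R).
Variables (X : T -> S) (w : T -> R).
Hypotheses (mX : measurable_fun setT X) (bw : bmf w).

(** The sum counts the integers from 1 to N not exceeding g x (n + 1), that is, it is the floor of
    that number; dividing by n + 1 leaves an error of at most 1 / (n + 1). *)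
Lemma indep_approx (g : S -> R) (n N : nat) : bmf g ->
  (forall x, 0 <= g x) -> (forall x, g x * n.+1%:R < N%:R) -> forall x,
  `|g x - n.+1%:R^-1 * \sum_(k < N) \1_[set x | k.+1%:R <= g x * n.+1%:R] x| <= n.+1%:R^-1 :> R.
Proof.
move=> bg g0 gN x.
have sumE m (t : R) : 0 <= t -> t < m%:R ->
    `|t - \sum_(k < m) (if k.+1%:R <= t then 1 else 0)| <= 1.
  elim: m t => [|m ih] t t0 tm; first by move: t0; rewrite leNgt tm.
  rewrite big_ord_recl /=; case: ifP => h1.
    have := ih (t - 1); rewrite subr_ge0 h1 => /(_ isT).
    have -> : t - 1 < m%:R by rewrite ltrBlDr natr1.
    move=> /(_ isT); congr (_ <= _); congr `|_|.
    rewrite opprD addrA; congr (_ - _); apply: eq_bigr => k _.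
    by rewrite /bump /= add1n lerBrDr natr1.
  have {}h1 : t < 1 by rewrite ltNge h1.
  rewrite big1 ?addr0 ?subr0; first by rewrite ger0_norm // ltW.
  move=> k _; rewrite /bump /= add1n; case: ifP => // h2; exfalso.
  by move: h2; rewrite leNgt (lt_le_trans h1) // ler1n.
have e : g x = n.+1%:R^-1 * (g x * n.+1%:R) by rewrite mulrC mulfK // gt_eqF.
rewrite [X in `|X - _|]e -mulrBr normrM ger0_norm ?invr_ge0 //.
rewrite -[leRHS]mulr1 ler_pM2l ?invr_gt0 //.
have := sumE N (g x * n.+1%:R); rewrite mulr_ge0 // gN => /(_ isT isT).
congr (`|_ - _| <= _); apply: eq_bigr => k _; rewrite indicE.
by case: ifP => h; [rewrite mem_set|rewrite memNset //= h].
Qed.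

Lemma bmf_sum (U : measurableType d') N (F : nat -> U -> R) : (forall k, bmf (F k)) ->
  bmf (fun x => \sum_(k < N) F k x).
Proof.
move=> bF; elim: N => [|N ih].
  by under [X in bmf X]eq_fun do rewrite big_ord0; exact: bmf_cst.
under [X in bmf X]eq_fun do rewrite big_ord_recr /=.
exact: bmfD.
Qed.

(** Simple functions approximate a nonnegative bounded g uniformly. The weight w is fixed, so the
    lemma can be applied to one variable at a time while w carries the others. *)
Lemma indep_bmf :
  (forall A, measurable A -> Ex P (fun t => \1_A (X t) * w t) = Ex mu \1_A * Ex P w) ->
  forall g, bmf g -> Ex P (fun t => g (X t) * w t) = Ex mu g * Ex P w.
Proof.
move=> hA.
have bX (g : S -> R) : bmf g -> bmf (fun t => g (X t)) by exact: bmf_comp mX.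
have hnn g : bmf g -> (forall x, 0 <= g x) ->
    Ex P (fun t => g (X t) * w t) = Ex mu g * Ex P w.
  move=> bg g0; have [mg [M hM]] := bg; have [_ [W hW]] := bw.
  pose N n := Num.bound (M * n.+1%:R).
  pose I n k : S -> R := \1_[set x | k.+1%:R <= g x * n.+1%:R].
  have bI n k : bmf (I n k).
    apply: bmf_indic.
    have -> : [set x | k.+1%:R <= g x * n.+1%:R] =
        (fun x => g x * n.+1%:R) @^-1` `[k.+1%:R, +oo[%classic.
      by apply/seteqP; split => x /=; rewrite in_itv /= andbT.
    rewrite -[X in measurable X]setTI.
    by apply: (measurable_funM mg (measurable_cst _)) => //; exact: measurable_itv.
  pose G n x : R := n.+1%:R^-1 * \sum_(k < N n) I n k x.
  have bG n : bmf (G n) by apply: bmfZ; exact: bmf_sum.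
  have GE n : Ex P (fun t => G n (X t) * w t) = Ex mu (G n) * Ex P w.
    rewrite /G; have hs m : Ex P (fun t => (\sum_(k < m) I n k (X t)) * w t) =
        Ex mu (fun x => \sum_(k < m) I n k x) * Ex P w.
      elim: m => [|m ih].
        rewrite (_ : (fun t => _) = (fun=> 0)); last by apply/funext => t; rewrite big_ord0 mul0r.
        rewrite (_ : (fun x => _) = (fun=> 0)); last by apply/funext => t; rewrite big_ord0.
        by rewrite !Ex_cst mul0r.
      rewrite (_ : (fun t => _) = (fun t => (\sum_(k < m) I n k (X t)) * w t + I n m (X t) * w t)); last first.
        by apply/funext => t; rewrite big_ord_recr /= mulrDl.
      rewrite (_ : (fun x => _) = (fun x => (\sum_(k < m) I n k x) + I n m x)); last first.
        by apply/funext => t; rewrite big_ord_recr.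
      have bs := bmf_sum m (bI n).
      rewrite (ExD P (bmfM (bX _ bs) bw) (bmfM (bX _ (bI n m)) bw)) (ExD mu bs (bI n m)).
      rewrite ih mulrDl; congr (_ + _); apply: hA.
      have -> : [set x | m.+1%:R <= g x * n.+1%:R] =
        (fun x => g x * n.+1%:R) @^-1` `[m.+1%:R, +oo[%classic.
        by apply/seteqP; split => x /=; rewrite in_itv /= andbT.
      rewrite -[X in measurable X]setTI.
      by apply: (measurable_funM mg (measurable_cst _)) => //; exact: measurable_itv.
    rewrite (_ : (fun t => _) = (fun t => n.+1%:R^-1 * ((\sum_(k < N n) I n k (X t)) * w t))); last first.
      by apply/funext => t; rewrite mulrA.
    have bs := bmf_sum (N n) (bI n).
    rewrite !ExZ //; first by rewrite hs mulrA.
    exact: (bmfM (bX _ bs) bw).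
  have Gg n x : `|g x - G n x| <= n.+1%:R^-1.
    apply: indep_approx => // z; apply: le_lt_trans (archi_boundP _); last first.
      by rewrite mulr_ge0 // (le_trans _ (hM z)).
    by rewrite ler_pM2r // (le_trans _ (hM z)) // ler_norm.
  have GM n x : `|G n x| <= M + 1.
    have -> : G n x = g x - (g x - G n x) by rewrite opprB addrC subrK.
    apply: le_trans (ler_normB _ _) _; apply: lerD => //.
    by apply: le_trans (Gg n x) _; rewrite invf_le1 // ler1n.
  have Gcvg x : (fun n => G n x) @ \oo --> g x.
    have h0 : (fun n => n.+1%:R^-1 : R) @ \oo --> (0 : R) by exact: cvg_harmonic.
    have hl : (fun n => g x - n.+1%:R^-1 : R) @ \oo --> g x.
      by rewrite -[X in _ --> X]subr0; apply: cvgB => //; exact: cvg_cst.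
    have hr : (fun n => g x + n.+1%:R^-1 : R) @ \oo --> g x.
      by rewrite -[X in _ --> X]addr0; apply: cvgD => //; exact: cvg_cst.
    apply: (squeeze_cvgr _ hl hr); apply: nearW => n.
    by have := Gg n x; rewrite distrC ler_distl.
  have c1 : (fun n => Ex P (fun t => G n (X t) * w t)) @ \oo --> Ex P (fun t => g (X t) * w t).
    apply: (@Ex_cvg _ _ _ _ _ _ ((M + 1) * W)).
    - by move=> n; exact: (bmfM (bX _ (bG n)) bw).
    - exact: (bmfM (bX _ bg) bw).
    - by move=> n t; rewrite normrM; apply: ler_pM.
    - by apply: aeW => t; apply: cvgM => //; exact: cvg_cst.
  have c2 : (fun n => Ex mu (G n)) @ \oo --> Ex mu g.
    by apply: (@Ex_cvg _ _ _ _ _ _ (M + 1)) => //; exact: aeW.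
  have c3 : (fun n => Ex mu (G n) * Ex P w) @ \oo --> Ex mu g * Ex P w.
    by apply: cvgM => //; exact: cvg_cst.
  rewrite (funext GE : (fun n => Ex P (fun t => G n (X t) * w t)) = _) in c1.
  exact: cvg_unique c1 c3.
move=> g bg; have [mg [M hM]] := bg.
(* A bounded g is made nonnegative by adding M; the contribution M times the expectation of w
   appears on both sides and cancels. *)
have bgM : bmf (fun x => g x + M) by apply: bmfD => //; exact: bmf_cst.
have := hnn _ bgM; rewrite ExD ?Ex_cst //; last exact: bmf_cst.
rewrite (_ : (fun t => _) = (fun t => g (X t) * w t + M * w t)); last first.
  by apply/funext => t; rewrite mulrDl.
rewrite ExD ?ExZ ?mulrDl //; [|exact: (bmfM (bX _ bg) bw)|exact: bmfZ].
move=> /(_ _)/addIr; apply => x.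
by rewrite -lerBlDr sub0r; have := hM x; rewrite ler_norml => /andP[].
Qed.

End Independence.

(** Meant for w -> 2 alpha(w) xi3(w), where the number of summands depends on w but takes countably
    many values. *)
Lemma measurable_glue d (T : measurableType d) d' (S : measurableType d')
  (F : nat -> T -> S) (k : T -> nat) : (forall n, measurable_fun setT (F n)) ->
  measurable_fun setT k -> measurable_fun setT (fun t => F (k t) t).
Proof.
move=> mF mk _ A mA; rewrite setTI.
rewrite (_ : _ @^-1` A = \bigcup_n ((k @^-1` [set n]) `&` (F n @^-1` A))); last first.
  by apply/seteqP; split => [t At|t [n _ [/= -> //]]]; exists (k t).
apply: bigcupT_measurable => n; apply: measurableI.
  by rewrite -[X in measurable X]setTI; apply: mk.
by rewrite -[X in measurable X]setTI; apply: mF.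
Qed.

Section SolenoidMeasurable.
Variables (R : realType) (a : seqa).
Context d (T : measurableType d).
Local Notation SolM := (SolM R a).
Implicit Types F G : T -> SolM.

Lemma trig_measurable_phase_comp y F : inH a y -> measurable_fun setT F ->
  trig_measurable (fun t => phase y (F t)).
Proof.
by move=> hy mF; apply: (trig_measurable_comp mF); exact: trig_measurable_phase.
Qed.

Lemma measurable_sol_add F G : measurable_fun setT F -> measurable_fun setT G ->
  measurable_fun setT (fun t => sol_add (F t) (G t) : SolM).
Proof.
move=> mF mG; apply: measurable_sol => y hy.
apply: (@trig_measurable_eqm _ _ _ (fun t => phase y (F t) + phase y (G t))).
  by move=> t; apply: eqm_sym; exact: phase_add.
by apply: trig_measurableD; exact: trig_measurable_phase_comp.
Qed.

Lemma measurable_sol_opp F : measurable_fun setT F ->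
  measurable_fun setT (fun t => sol_opp (F t) : SolM).
Proof.
move=> mF; apply: measurable_sol => y hy.
apply: (@trig_measurable_eqm _ _ _ (fun t => - phase y (F t))).
  by move=> t; apply: eqm_sym; exact: phase_opp.
by apply: trig_measurableN; exact: trig_measurable_phase_comp.
Qed.

Lemma measurable_sol_muln k F : measurable_fun setT F ->
  measurable_fun setT (fun t => sol_muln k (F t) : SolM).
Proof.
move=> mF; elim: k => [|k ih]; first exact: measurable_cst.
exact: measurable_sol_add.
Qed.

End SolenoidMeasurable.

(** * The characteristic function of a symmetric distribution *)

Section CharFun.
Variables (R : realType) (a : seqa).
Local Notation SolM := (SolM R a).
Variable mu : probability SolM R.

Definition charf y : R := Ex mu (fun x : SolM => cos (phase y x)).

Lemma bmf_cosp y : inH a y -> bmf (fun x : SolM => cos (phase y x)).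
Proof. by move=> hy; have [] := trig_measurable_bmf (trig_measurable_phase hy). Qed.

Lemma bmf_sinp y : inH a y -> bmf (fun x : SolM => sin (phase y x)).
Proof. by move=> hy; have [] := trig_measurable_bmf (trig_measurable_phase hy). Qed.

Hypothesis sym : symmetric_distr mu.

Lemma symmetric_sin y : inH a y -> Ex mu (fun x => sin (phase y x)) = 0.
Proof.
move=> hy; have mopp : measurable_fun setT (@sol_opp R a : SolM -> SolM).
  exact: measurable_sol_opp.
have := @Ex_law _ _ _ _ _ mu mu (@sol_opp R a) (fun x => sin (phase y x)) mopp.
have hm A : measurable A -> mu A = mu ((@sol_opp R a) @^-1` A).
  move=> mA; rewrite sym //; congr (mu _); apply/seteqP; split => x /=.
    by move=> [z Az <-]; rewrite sol_oppK.
  by move=> Ax; exists (sol_opp x) => //; rewrite sol_oppK.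
move=> /(_ hm (bmf_sinp hy)).
rewrite (_ : _ \o _ = (fun x => -1 * sin (phase y x))); last first.
  by apply/funext => x /=; rewrite (sin_eqm (phase_opp x hy)) sinN mulN1r.
by rewrite ExZ; [lra|exact: bmf_sinp].
Qed.

(** Symmetry kills the sine integral, so [charf] alone determines every expectation that
    [fourier_unique] compares. *)
Lemma symmetric_cosD y c : inH a y ->
  Ex mu (fun x => cos (phase y x + c)) = cos c * charf y.
Proof.
move=> hy; rewrite (_ : (fun x => _) =
    (fun x => cos c * cos (phase y x) + - sin c * sin (phase y x))); last first.
  by apply/funext => x; rewrite cosD mulNr ![_ * cos (phase y x)]mulrC ![_ * sin (phase y x)]mulrC.
rewrite ExD ?ExZ ?symmetric_sin ?mulr0 ?addr0 //; try exact: bmf_cosp; try exact: bmf_sinp.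
  by apply: bmfZ; exact: bmf_cosp.
by apply: bmfZ; exact: bmf_sinp.
Qed.

End CharFun.

Section FunctionalEquation.
Variables (R : realType) (a : seqa).
Local Notation SolM := (SolM R a).
Context (d : measure_display) (Omega : measurableType d) (P : probability Omega R).
Variables (xi1 xi2 xi3 : Omega -> SolM) (alpha : Omega -> nat) (mu : probability SolM R).
Hypotheses (m1 : measurable_fun setT xi1) (m2 : measurable_fun setT xi2)
  (m3 : measurable_fun setT xi3) (malpha : measurable_fun setT alpha).
Hypothesis ident : forall A : set SolM, measurable A ->
     [/\ P (xi1 @^-1` A) = mu A, P (xi2 @^-1` A) = mu A & P (xi3 @^-1` A) = mu A].
Hypothesis indep : forall A1 A2 A3 : set SolM,
     measurable A1 -> measurable A2 -> measurable A3 ->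
     P (xi1 @^-1` A1 `&` xi2 @^-1` A2 `&` xi3 @^-1` A3) =
     (P (xi1 @^-1` A1) * P (xi2 @^-1` A2) * P (xi3 @^-1` A3))%E.
Hypothesis sym : symmetric_distr mu.
Hypotheses (alpha0 : P (alpha @^-1` [set 0%N]) = (1 / 2)%:E)
  (alpha1 : P (alpha @^-1` [set 1%N]) = (1 / 2)%:E).
Hypothesis indep_alpha : forall (E : set (SolM * SolM * SolM)) (F : set nat),
     measurable E -> measurable F ->
     P ((fun w => (xi1 w, xi2 w, xi3 w)) @^-1` E `&` alpha @^-1` F) =
     (P ((fun w => (xi1 w, xi2 w, xi3 w)) @^-1` E) * P (alpha @^-1` F))%E.

Let triple w := (xi1 w, xi2 w, xi3 w).
Let phi := charf mu.

Lemma Ex_triple_indic A1 A2 A3 : measurable A1 -> measurable A2 -> measurable A3 ->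
  Ex P (fun w => \1_A1 (xi1 w) * \1_A2 (xi2 w) * \1_A3 (xi3 w)) =
  Ex mu \1_A1 * Ex mu \1_A2 * Ex mu \1_A3.
Proof.
move=> h1 h2 h3; apply: EFin_inj.
have mpre (X : Omega -> SolM) A : measurable_fun setT X -> measurable A -> measurable (X @^-1` A).
  by move=> mX mA; rewrite -[X in measurable X]setTI; exact: mX.
have -> : (fun w => \1_A1 (xi1 w) * \1_A2 (xi2 w) * \1_A3 (xi3 w)) =
    (\1_(xi1 @^-1` A1 `&` xi2 @^-1` A2 `&` xi3 @^-1` A3) : Omega -> R).
  by apply/funext => w; rewrite !indicE !in_setI -!mulnb !natrM.
rewrite Ex_indic; last by apply: measurableI; [apply: measurableI|]; exact: mpre.
rewrite indep // 2!EFinM !Ex_indic //.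
by have [-> _ _] := ident h1; have [_ -> _] := ident h2; have [_ _ ->] := ident h3.
Qed.

(** Independence is given for indicators; they are replaced by bounded functions in the first, the
    second and the third variable in turn. *)
Lemma Ex_triple g1 g2 g3 : bmf g1 -> bmf g2 -> bmf g3 ->
  Ex P (fun w => g1 (xi1 w) * g2 (xi2 w) * g3 (xi3 w)) = Ex mu g1 * Ex mu g2 * Ex mu g3.
Proof.
have c1 (g : SolM -> R) : bmf g -> bmf (fun w => g (xi1 w)) by exact: bmf_comp m1.
have c2 (g : SolM -> R) : bmf g -> bmf (fun w => g (xi2 w)) by exact: bmf_comp m2.
have c3 (g : SolM -> R) : bmf g -> bmf (fun w => g (xi3 w)) by exact: bmf_comp m3.
have ET : Ex mu (\1_(@setT SolM) : SolM -> R) = 1.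
  by apply: EFin_inj; rewrite Ex_indic //; exact: probability_setT.
have one (X : Omega -> SolM) (h : Omega -> R) :
    (fun w => \1_(@setT SolM) (X w) * h w) = h.
  by apply/funext => w; rewrite indicE in_setT mul1r.
have s1 g1' A2 A3 : bmf g1' -> measurable A2 -> measurable A3 ->
    Ex P (fun w => g1' (xi1 w) * (\1_A2 (xi2 w) * \1_A3 (xi3 w))) =
    Ex mu g1' * (Ex mu \1_A2 * Ex mu \1_A3).
  move=> b1 mA2 mA3.
  have bw : bmf (fun w => \1_A2 (xi2 w) * \1_A3 (xi3 w) : R).
    by apply: bmfM; [apply: c2|apply: c3]; exact: bmf_indic.
  have ew : Ex P (fun w => \1_A2 (xi2 w) * \1_A3 (xi3 w)) = Ex mu \1_A2 * Ex mu \1_A3.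
    have := @Ex_triple_indic setT A2 A3 measurableT mA2 mA3.
    rewrite ET mul1r => <-; congr (Ex _ _); apply/funext => w.
    by rewrite [\1_setT _]indicE in_setT mul1r.
  rewrite -ew; apply: indep_bmf => // A mA; rewrite ew mulrA -Ex_triple_indic //.
  by congr (Ex _ _); apply/funext => w; rewrite mulrA.
have s2 g1' g2' A3 : bmf g1' -> bmf g2' -> measurable A3 ->
    Ex P (fun w => g2' (xi2 w) * (g1' (xi1 w) * \1_A3 (xi3 w))) =
    Ex mu g2' * (Ex mu g1' * Ex mu \1_A3).
  move=> b1 b2 mA3.
  have bw : bmf (fun w => g1' (xi1 w) * \1_A3 (xi3 w)).
    by apply: bmfM; [apply: c1|apply: c3; exact: bmf_indic].
  have ew : Ex P (fun w => g1' (xi1 w) * \1_A3 (xi3 w)) = Ex mu g1' * Ex mu \1_A3.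
    have := s1 g1' setT A3 b1 measurableT mA3.
    rewrite ET mul1r => <-; congr (Ex _ _); apply/funext => w.
    by rewrite [\1_setT _]indicE in_setT mul1r.
  rewrite -ew; apply: indep_bmf => // A mA; rewrite ew mulrCA -s1 //.
  by congr (Ex _ _); apply/funext => w; rewrite mulrCA.
move=> b1 b2 b3.
have bw : bmf (fun w => g1 (xi1 w) * g2 (xi2 w)).
  by apply: bmfM; [apply: c1|apply: c2].
have ew : Ex P (fun w => g1 (xi1 w) * g2 (xi2 w)) = Ex mu g1 * Ex mu g2.
  have := s2 g1 g2 setT b1 b2 measurableT.
  rewrite ET mulr1 [X in _ = X]mulrC => <-; congr (Ex _ _); apply/funext => w.
  by rewrite [\1_setT _]indicE in_setT mulr1 mulrC.
rewrite -ew mulrC; under [X in Ex P X]eq_fun do rewrite mulrC.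
apply: indep_bmf => // A mA; rewrite ew mulrC -mulrA mulrCA -s2 //.
by congr (Ex _ _); apply/funext => w; rewrite mulrC -mulrA mulrCA.
Qed.

(** In the addition formula every term but the product of three cosines contains the sine of the
    first or of the second argument, whose expectation is 0 by symmetry. The shift c is absorbed in
    the third argument. *)
Lemma Ex_triple_cos y1 y2 y3 c : inH a y1 -> inH a y2 -> inH a y3 ->
  Ex P (fun w => cos (phase y1 (xi1 w) + phase y2 (xi2 w) + phase y3 (xi3 w) + c)) =
  cos c * phi y1 * phi y2 * phi y3.
Proof.
move=> h1 h2 h3.
pose C1 (x : SolM) : R := cos (phase y1 x); pose S1 (x : SolM) : R := sin (phase y1 x).
pose C2 (x : SolM) : R := cos (phase y2 x); pose S2 (x : SolM) : R := sin (phase y2 x).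
pose C3 (x : SolM) : R := cos (phase y3 x + c); pose S3 (x : SolM) : R := sin (phase y3 x + c).
have bC1 : bmf C1 := bmf_cosp h1.
have bC2 : bmf C2 := bmf_cosp h2.
have bS1 : bmf S1 := bmf_sinp h1.
have bS2 : bmf S2 := bmf_sinp h2.
have bC3 : bmf C3 := bmf_cos_phase c h3.
have bS3 : bmf S3.
  have := bmf_cos_phase (c - pi / 2) h3.
  by under [X in bmf X]eq_fun do rewrite addrA cosBpihalf.
have b3 g1 g2 g3 : bmf g1 -> bmf g2 -> bmf g3 ->
    bmf (fun w => g1 (xi1 w) * g2 (xi2 w) * g3 (xi3 w)).
  move=> b1 b2 b3; apply: bmfM; last exact: bmf_comp m3 b3.
  by apply: bmfM; [exact: bmf_comp m1 b1|exact: bmf_comp m2 b2].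
rewrite (_ : (fun w => _) = (fun w =>
   C1 (xi1 w) * C2 (xi2 w) * C3 (xi3 w) - C1 (xi1 w) * S2 (xi2 w) * S3 (xi3 w)
   - (S1 (xi1 w) * C2 (xi2 w) * S3 (xi3 w) + S1 (xi1 w) * S2 (xi2 w) * C3 (xi3 w)))); last first.
  apply/funext => w; rewrite -!addrA cosD [cos (_ + (_ + _))]cosD [sin (_ + (_ + _))]sinD.
  by rewrite /C1 /C2 /C3 /S1 /S2 /S3; ring.
rewrite !(ExB, ExD) ?Ex_triple //; try by [exact: b3|apply: bmfB; exact: b3|apply: bmfD; exact: b3].
rewrite [Ex mu S1]symmetric_sin // [Ex mu S2]symmetric_sin // [Ex mu C3]symmetric_cosD //.
by rewrite -/(charf mu y1) -/(charf mu y2) /phi /C1 /C2 /charf; ring.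
Qed.

(** Passing to the law [Q] of the triple puts the independence of alpha into the shape required by
    [indep_bmf]. *)
Lemma Ex_alpha (h : SolM * SolM * SolM -> R) k : bmf h ->
  Ex P (fun w => h (triple w) * \1_(alpha @^-1` [set k]) w) =
  Ex P (fun w => h (triple w)) * fine (P (alpha @^-1` [set k])).
Proof.
have mt : measurable_fun setT triple.
  by apply: measurable_fun_pair => //; exact: measurable_fun_pair.
have mA : measurable (alpha @^-1` [set k]).
  by rewrite -[X in measurable X]setTI; apply: malpha.
have [Q hQ] := law_exists P mt.
move=> bh; have eQ : Ex P (fun w => h (triple w)) = Ex Q h.
  by rewrite (Ex_law mt (fun A _ => hQ A) bh).
have -> : fine (P (alpha @^-1` [set k])) = Ex P \1_(alpha @^-1` [set k]).
  by rewrite -Ex_indic.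
rewrite eQ; apply: indep_bmf => //; first exact: bmf_indic.
move=> E mE; apply: EFin_inj; rewrite EFinM !Ex_indic // hQ -indep_alpha //.
rewrite -Ex_indic; last first.
  by apply: measurableI => //; rewrite -[X in measurable X]setTI; exact: mt.
by congr (Ex _ _)%:E; apply/funext => w; rewrite !indicE !in_setI -!mulnb !natrM.
Qed.

Let lhs w : SolM := sol_muln 2 (xi1 w).
Let rhs w : SolM := sol_add (sol_add (xi1 w) (xi2 w)) (sol_muln (2 * alpha w) (xi3 w)).

Lemma measurable_lhs : measurable_fun setT lhs.
Proof. exact: measurable_sol_muln. Qed.

Lemma measurable_rhs : measurable_fun setT rhs.
Proof.
apply: measurable_sol_add; first exact: measurable_sol_add.
apply: (@measurable_glue _ _ _ _ (fun k w => sol_muln (2 * k) (xi3 w) : SolM)) => // n.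
exact: measurable_sol_muln.
Qed.

Lemma phase_double y (x : SolM) : inH a y ->
  eqm (2 * pi) (phase y (sol_muln 2 x)) (phase (2 * y) x : R).
Proof.
move=> hy; apply: eqm_trans (phase_muln 2 x hy) _.
by apply: eqm_sym; exact: (phaseMz 2 x hy).
Qed.

Lemma inH_double y : inH a y -> inH a (2 * y : R).
Proof. exact: (@inHMz R a 2). Qed.

Lemma Ex_lhs y c : inH a y -> Ex P (fun w => cos (phase y (lhs w) + c)) = cos c * phi (2 * y).
Proof.
move=> hy; rewrite (_ : (fun w => _) = (fun x => cos (phase (2 * y) x + c)) \o xi1); last first.
  apply/funext => w /=; apply: cos_eqm; apply: eqmD (eqm_refl _ _).
  exact: phase_double.
rewrite -(@Ex_law _ _ _ _ _ P mu) //; first exact: symmetric_cosD (inH_double hy).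
  by move=> A mA; have [-> _ _] := ident mA.
exact: bmf_cos_phase (inH_double hy).
Qed.

Lemma Ex_rhs y c : inH a y ->
  Ex P (fun w => cos (phase y (rhs w) + c)) = cos c * (phi y ^+ 2 * (1 + phi (2 * y)) / 2).
Proof.
move=> hy.
(* Given alpha = 0 the third variable enters through the character 0, given alpha = 1 through 2 y;
   both cases are then instances of [Ex_triple_cos]. *)
pose h0 (t : SolM * SolM * SolM) : R := cos (phase y t.1.1 + phase y t.1.2 + phase 0 t.2 + c).
pose h1 (t : SolM * SolM * SolM) : R := cos (phase y t.1.1 + phase y t.1.2 + phase (2 * y) t.2 + c).
have bh z : inH a z -> bmf (fun t : SolM * SolM * SolM =>
    cos (phase y t.1.1 + phase y t.1.2 + phase z t.2 + c)).
  move=> hz; apply: trig_measurable_cosD; apply: trig_measurableD; last first.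
    by apply: trig_measurable_phase_comp => //; exact: measurable_snd.
  apply: trig_measurableD; apply: trig_measurable_phase_comp => //.
    exact: (measurableT_comp measurable_fst measurable_fst).
  exact: (measurableT_comp measurable_snd measurable_fst).
have bh0 : bmf h0 := bh _ (inH0 R a).
have bh1 : bmf h1 := bh _ (inH_double hy).
have mA k : measurable (alpha @^-1` [set k]).
  by rewrite -[X in measurable X]setTI; apply: malpha.
have mt : measurable_fun setT triple.
  by apply: measurable_fun_pair => //; exact: measurable_fun_pair.
pose F w := h0 (triple w) * \1_(alpha @^-1` [set 0%N]) w + h1 (triple w) * \1_(alpha @^-1` [set 1%N]) w.
have bF0 : bmf (fun w => h0 (triple w) * \1_(alpha @^-1` [set 0%N]) w).
  by apply: bmfM; [exact: bmf_comp mt bh0|exact: bmf_indic].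
have bF1 : bmf (fun w => h1 (triple w) * \1_(alpha @^-1` [set 1%N]) w).
  by apply: bmfM; [exact: bmf_comp mt bh1|exact: bmf_indic].
have -> : Ex P (fun w => cos (phase y (rhs w) + c)) = Ex P F.
  apply: Ex_ae.
  - exact: bmf_comp measurable_rhs (bmf_cos_phase c hy).
  - exact: bmfD.
  (* [alpha] has values in nat; the event alpha > 1 is null because the two given probabilities add
     up to 1. *)
  exists (~` (alpha @^-1` [set 0%N] `|` alpha @^-1` [set 1%N])); split.
  - by apply: measurableC; exact: measurableU.
  - rewrite probability_setC; last exact: measurableU.
    rewrite measureU //; last first.
      by rewrite -preimage_setI; apply/seteqP; split => w //= [-> //].
    rewrite [X in (_ - X)%E](_ : _ = 1%E) ?subee //.
    by transitivity ((1 / 2)%:E + (1 / 2)%:E : \bar R)%E; [congr (_ + _)%E|rewrite -EFinD; congr EFin; lra].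
  move=> w /= nF [aw|aw]; apply: nF; rewrite /F !indicE.
  - rewrite mem_set // memNset /=; last by rewrite aw.
    rewrite mulr1 mulr0 addr0 /h0 /=; apply: cos_eqm; apply: eqmD (eqm_refl _ _).
    rewrite phase0 addr0; apply: eqm_trans (phase_add _ _ hy) _.
    rewrite aw muln0 -[X in eqm _ _ X]addr0.
    by apply: eqmD; [exact: phase_add|exact: phase_sol0].
  - rewrite memNset /=; last by rewrite aw.
    rewrite mem_set // mulr1 mulr0 add0r /h1 /=; apply: cos_eqm; apply: eqmD (eqm_refl _ _).
    apply: eqm_trans (phase_add _ _ hy) _; rewrite aw muln1.
    by apply: eqmD; [exact: phase_add|exact: phase_double].
rewrite ExD // !Ex_alpha // alpha0 alpha1 /=.
rewrite (Ex_triple_cos c hy hy (inH0 R a)) (Ex_triple_cos c hy hy (inH_double hy)).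
have -> : phi 0 = 1.
  rewrite /phi /charf -[RHS](Ex_cst mu); congr (Ex _ _).
  by apply/funext => x; rewrite phase0 cos0.
by field.
Qed.

(** On both sides the shift c contributes the factor cos c only, so equality of the laws reduces to
    c = 0. *)
Lemma ident_forms_iff :
  (forall A : set SolM, measurable A -> P (lhs @^-1` A) = P (rhs @^-1` A)) <->
  (forall y, inH a y -> charf mu (2 * y) = charf mu y ^+ 2 * (1 + charf mu (2 * y)) / 2).
Proof.
have [Ql hl] := law_exists P measurable_lhs.
have [Qr hr] := law_exists P measurable_rhs.
have el y c : inH a y -> Ex Ql (fun x => cos (phase y x + c)) = cos c * phi (2 * y).
  move=> hy; rewrite (Ex_law measurable_lhs (fun A _ => hl A) (bmf_cos_phase c hy)).
  exact: Ex_lhs.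
have er y c : inH a y -> Ex Qr (fun x => cos (phase y x + c)) =
    cos c * (phi y ^+ 2 * (1 + phi (2 * y)) / 2).
  move=> hy; rewrite (Ex_law measurable_rhs (fun A _ => hr A) (bmf_cos_phase c hy)).
  exact: Ex_rhs.
split=> [h y hy|h A mA].
  have e1 := el y 0 hy; have e2 := er y 0 hy; rewrite cos0 !mul1r in e1 e2.
  rewrite -[LHS]e1 -[RHS]e2.
  by apply: Ex_eq => A mA; rewrite hl hr h.
rewrite -hl -hr; apply: fourier_unique => // y c hy.
by rewrite el // er // /phi -h.
Qed.

End FunctionalEquation.

(** * From hyperbolic secant to equidistribution of the forms *)

Section Lifting.
Variable R : realType.
Implicit Types u v w : R.

Lemma cos_gt0_reduce u : 0 < cos u -> exists w, `|w| < pi / 2 /\ eqm (2 * pi) u w.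
Proof.
move=> h; apply: cos_gt_small; last by rewrite cos_pihalf.
by have := pi_ge0 R => p; apply/andP; split; lra.
Qed.

Lemma cos_eq1_eqm u : cos u = 1 -> eqm (2 * pi) u 0.
Proof.
have [w [/andP[w1 w2] uw]] := eqm_reduce u.
rewrite (cos_eqm uw) -(cos_norm w) => c1.
apply: eqm_trans uw _; suff -> : w = 0 by exact: eqm_refl.
have h1 : `|w| \in `[0, pi] by rewrite in_itv /= normr_ge0 ler_norml w1 ltW.
have h0 : 0 \in `[0, pi : R] by rewrite in_itv /= lexx pi_ge0.
by apply/normr0_eq0; apply: (cos_inj h1 h0); rewrite c1 cos0.
Qed.

Lemma eqm_trig u v : cos u = cos v -> sin u = sin v -> eqm (2 * pi) u v.
Proof.
move=> hc hs; have : cos (u - v) = 1 by rewrite cosB hc hs -!expr2 cos2Dsin2.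
move=> /cos_eq1_eqm h; have := eqmD h (eqm_refl _ v).
by rewrite subrK add0r.
Qed.

(* Both sides of the congruence 2 r_{n+1} = r_n mod 2 pi have absolute value < pi. *)
Lemma lift_dyadic (u : nat -> R) : (forall n, 0 < cos (u n)) ->
  (forall n, eqm (2 * pi) (2 * u n.+1) (u n)) ->
  exists l, forall n, eqm (2 * pi) (u n) (l / 2 ^+ n).
Proof.
move=> hu h2.
have /choice[r hr] : forall n, exists w, `|w| < pi / 2 /\ eqm (2 * pi) (u n) w.
  by move=> n; exact: cos_gt0_reduce.
have rS n : 2 * r n.+1 = r n.
  have [a1 b1] := hr n; have [a2 b2] := hr n.+1.
  apply: (@eqm_small _ (2 * pi)); first by rewrite mulr_gt0 // pi_gt0.
    apply: eqm_trans b1; apply: eqm_trans (h2 n).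
    exact: (eqmMz 2 (eqm_sym b2)).
  move: a1 a2; rewrite !ltr_norml => /andP[? ?] /andP[? ?].
  by apply/andP; split; lra.
exists (r 0%N) => n; have [_] := hr n; suff -> : r n = r 0%N / 2 ^+ n by [].
elim: n => [|n ih]; first by rewrite expr0 divr1.
have -> : r n.+1 = r n / 2 by have := rS n; lra.
by rewrite ih exprSr invfM mulrA.
Qed.

Lemma cvg_dyadic_floor (t : R) :
  (fun n => (Num.floor (t * 2 ^+ n))%:~R / 2 ^+ n : R) @ \oo --> t.
Proof.
have h0 : (fun n => (2 ^-1 : R) ^+ n) @ \oo --> (0 : R).
  by apply: cvg_expr; rewrite ger0_norm // invf_lt1 // ltr1n.
have hl : (fun n => t - (2 ^-1) ^+ n) @ \oo --> t.
  by rewrite -[X in _ --> X]subr0; apply: cvgB => //; exact: cvg_cst.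
apply: (squeeze_cvgr _ hl (cvg_cst t)); apply: nearW => n.
have /andP[h1 h2] := floor_itv (t * 2 ^+ n).
rewrite intrD in h2; rewrite ler_pdivrMr // h1 andbT.
rewrite ler_pdivlMr // mulrBl exprVn mulVf ?gt_eqF //.
by rewrite lerBlDr ltW.
Qed.

(** Near 0 the cosine of g is positive, so the values at c / 2^n lift to l / 2^n. Additivity fixes g
    on the dyadic multiples of c, and continuity on their limits, which are all reals. *)
Lemma circle_hom_lift (g : R -> R) :
  (forall s t, eqm (2 * pi) (g (s + t)) (g s + g t)) ->
  continuous (fun t => cos (g t)) -> continuous (fun t => sin (g t)) ->
  exists l, forall t, eqm (2 * pi) (g t) (l * t).
Proof.
move=> gD cc cs.
have g0 : eqm (2 * pi) (g 0) 0.
  have := eqmB (gD 0 0) (eqm_refl _ (g 0)); rewrite addr0 addrK subrr.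
  exact: eqm_sym.
have gMn k t : eqm (2 * pi) (g (k%:R * t)) (k%:R * g t).
  elim: k => [|k ih]; first by rewrite !mul0r.
  have e (z : R) : k.+1%:R * z = k%:R * z + z by rewrite -natr1 mulrDl mul1r.
  rewrite !e; apply: eqm_trans (gD _ _) _.
  by apply: eqmD ih (eqm_refl _ _).
have gN t : eqm (2 * pi) (g (- t)) (- g t).
  have := eqmB (gD t (- t)) (eqm_refl _ (g t)); rewrite subrr addrAC subrr add0r => h.
  apply: eqm_trans (eqm_sym h) _; rewrite -[X in eqm _ _ X]add0r.
  by apply: eqmB g0 (eqm_refl _ _).
have gMz k t : eqm (2 * pi) (g (k%:~R * t)) (k%:~R * g t).
  case: k => k; first exact: gMn.
  rewrite NegzE mulrNz !mulNr; apply: eqm_trans (gN _) _.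
  by apply: eqmN; exact: gMn.
have [del d0 hdel] : exists2 del : R, 0 < del & forall t, `|t| < del -> 0 < cos (g t).
  have : nbhs (0 : R) [set t | 0 < cos (g t)].
    have -> : [set t | 0 < cos (g t)] = (fun t => cos (g t)) @^-1` `]0, +oo[%classic.
      by apply/seteqP; split => x /=; rewrite in_itv /= andbT.
    apply: cc; apply: open_nbhs_nbhs; split; first exact: interval_open.
    by rewrite /= in_itv /= andbT (cos_eqm g0) cos0.
  move=> /nbhs_ballP[e /= e0 he]; exists e => // t te; apply: he.
  by rewrite /ball /= sub0r normrN.
(* Half of [del], so that already the first point c / 2^0 lies strictly inside the neighbourhood. *)
pose c := del / 2; have c0 : 0 < c by rewrite divr_gt0.
have [|n|l hl] := @lift_dyadic (fun n => g (c / 2 ^+ n)).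
- move=> n; apply: hdel.
  have p0 : 1 <= 2 ^+ n :> R by rewrite exprn_ege1 // ler1n.
  rewrite ger0_norm; last by rewrite divr_ge0 ?ltW // (lt_le_trans _ p0).
  rewrite ltr_pdivrMr ?(lt_le_trans _ p0) //.
  apply: (@lt_le_trans _ _ del); first by rewrite /c; lra.
  by rewrite ler_peMr // ltW.
- apply: eqm_trans (eqm_sym (gMn 2%N _)) _.
  suff -> : 2%:R * (c / 2 ^+ n.+1) = c / 2 ^+ n by exact: eqm_refl.
  by rewrite exprS invfM; move: (2 ^+ n)^-1 => w; lra.
exists (l / c) => t.
pose q n : R := (Num.floor (t / c * 2 ^+ n))%:~R / 2 ^+ n.
have tq : (fun n => q n * c) @ \oo --> t.
  rewrite -[X in _ --> X](divfK (lt0r_neq0 c0)); apply: cvgM; last exact: cvg_cst.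
  exact: cvg_dyadic_floor.
have gq n : eqm (2 * pi) (g (q n * c)) (l / c * (q n * c)).
  have -> : l / c * (q n * c) = q n * l by field; rewrite gt_eqF.
  have -> : q n * c = (Num.floor (t / c * 2 ^+ n))%:~R * (c / 2 ^+ n).
    by rewrite /q mulrAC -mulrA.
  apply: eqm_trans (gMz _ _) _.
  have -> : q n * l = (Num.floor (t / c * 2 ^+ n))%:~R * (l / 2 ^+ n).
    by rewrite /q mulrAC -mulrA.
  exact: eqmMz.
have lq : (fun n => l / c * (q n * c)) @ \oo --> l / c * t.
  by apply: cvgM => //; exact: cvg_cst.
apply: eqm_trig.
- have h1 : (fun n => cos (g (q n * c))) @ \oo --> cos (g t).
    exact: (continuous_cvg _ (cc t) tq).
  have h2 : (fun n => cos (l / c * (q n * c))) @ \oo --> cos (l / c * t).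
    exact: (continuous_cvg _ (@continuous_cos R _) lq).
  rewrite (funext (fun n => cos_eqm (gq n)) : (fun n => cos (g (q n * c))) = _) in h1.
  exact: cvg_unique h1 h2.
- have h1 : (fun n => sin (g (q n * c))) @ \oo --> sin (g t).
    exact: (continuous_cvg _ (cs t) tq).
  have h2 : (fun n => sin (l / c * (q n * c))) @ \oo --> sin (l / c * t).
    exact: (continuous_cvg _ (@continuous_sin R _) lq).
  rewrite (funext (fun n => sin_eqm (gq n)) : (fun n => sin (g (q n * c))) = _) in h1.
  exact: cvg_unique h1 h2.
Qed.

End Lifting.

(** * Separation by characters; compact sets are closed *)

Section Topology.
Variables (R : realType) (a : seqa).
Local Notation Sol := (Sol R a).
Local Notation SolM := (SolM R a).
Implicit Types (x : Sol) (K U V : set Sol).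

Lemma sol_openI U V : sol_open U -> sol_open V -> sol_open (U `&` V).
Proof.
move=> oU oV p [/= Up Vp]; have [e [e0 [n hn]]] := oU p Up; have [e' [e0' [m hm]]] := oV p Vp.
exists (Num.min e e'); split; first by rewrite lt_min e0 e0'.
exists (maxn n m) => s y; rewrite lt_min => /andP[h1 h2] h3; split.
  by apply: hn => // k kn; apply: h3; rewrite (leq_trans kn) // leq_maxl.
by apply: hm => // k kn; apply: h3; rewrite (leq_trans kn) // leq_maxr.
Qed.

Lemma sol_open_local U :
  (forall x, U x -> exists V, [/\ sol_open V, V x & V `<=` U]) -> sol_open U.
Proof.
move=> h p /= Up; have [V [oV Vp VU]] := h _ Up.
have [e [e0 [n hn]]] := oV p Vp; exists e; split => //; exists n => s y h1 h2.
by apply: VU; exact: hn.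
Qed.

Lemma sol_openT : sol_open (@setT Sol).
Proof. by move=> p _; exists 1; split => //; exists 0%N. Qed.

Lemma sol_separated x x' : x <> x' -> exists U V,
  [/\ sol_open U, sol_open V, U x, V x' & U `&` V = set0].
Proof.
move=> xx'; have [y [hy ny]] : exists y, inH a y /\ ~ eqm (2 * pi) (phase y x) (phase y x').
  apply: contrapT => h; apply: xx'; apply: phase_inj => y hy.
  by apply: contrapT => h'; apply: h; exists y.
set p := phase y x in ny.
have c1 : cos (phase y x' - p) < 1.
  rewrite lt_neqAle cos_le1 andbT; apply/eqP => /cos_eq1_eqm h; apply: ny.
  by apply: eqm_sym; have := eqmD h (eqm_refl _ p); rewrite subrK add0r.
(* The threshold is halfway between the values of cos (phase y z - p) at x' and at x; adding pi
   writes the condition of being below it as another arc. *)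
pose t := (cos (phase y x' - p) + 1) / 2.
exists [set z | t < cos (phase y z + - p)], [set z | - t < cos (phase y z + (- p + pi))]; split.
- exact: sol_open_cos_gt.
- exact: sol_open_cos_gt.
- by rewrite /= subrr cos0 /t; lra.
- by rewrite /= addrA cosDpi /t; lra.
- apply/seteqP; split => z //= [h1]; rewrite addrA cosDpi; lra.
Qed.

(** The Hausdorff argument: K is covered by open sets disjoint from some neighbourhood of x, and a
    finite subcover leaves a common neighbourhood. It makes K a Borel set, so that m_K (K) = 1 can
    be exploited. *)
Lemma sol_compact_open_setC K : sol_compact K -> sol_open (~` K).
Proof.
move=> cK; apply: sol_open_local => x nKx.
pose C := [set U | sol_open U /\ exists V, [/\ sol_open V, V x & U `&` V = set0]].
have [|k Kk|F [FC KF]] := cK C.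
- by move=> U [].
- have [U [V [oU oV Uk Vx UV]]] : exists U V,
      [/\ sol_open U, sol_open V, U k, V x & U `&` V = set0].
    by apply: sol_separated => e; apply: nKx; rewrite -e.
  by exists U => //; split => //; exists V.
suff [V [oV Vx VF]] : exists V, [/\ sol_open V, V x & forall U, U \in F -> U `&` V = set0].
  exists V; split => // z Vz Kz; have [U /= UF Uz] := KF z Kz.
  by have : (U `&` V) z by []; rewrite VF.
elim: F FC {KF} => [|U F ih] FC.
  by exists setT; split => //; exact: sol_openT.
have [|V [oV Vx VF]] := ih; first by move=> W /= WF; apply: FC; rewrite /= inE WF orbT.
have [_ [V' [oV' V'x UV']]] : C U by apply: FC; rewrite /= inE eqxx.
exists (V `&` V'); split => //; first exact: sol_openI.
move=> W; rewrite inE => /orP[/eqP ->|WF].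
  by rewrite (setIC V) setIA UV' set0I.
by rewrite setIA VF // set0I.
Qed.

Lemma sol_compact_measurable K : sol_compact K -> measurable (K : set SolM).
Proof.
move=> /sol_compact_open_setC h; rewrite -(setCK K); apply: measurableC.
exact: sub_sigma_algebra.
Qed.

End Topology.

(** Multiplying the equations by x and y and adding eliminates s. When c and s are a cosine and a
    sine, they say that (x, y) is fixed by a nontrivial rotation. *)
Lemma rotation_fixed (R : realType) (c s x y : R) : c < 1 ->
  x = c * x - s * y -> y = c * y + s * x -> x = 0 /\ y = 0.
Proof.
move=> c1 e1 e2; have : (x ^+ 2 + y ^+ 2) * (1 - c) = 0.
  have f1 : x * (1 - c) = - s * y by lra.
  have f2 : y * (1 - c) = s * x by lra.
  have -> : (x ^+ 2 + y ^+ 2) * (1 - c) = x * (x * (1 - c)) + y * (y * (1 - c)) by ring.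
  by rewrite f1 f2; ring.
move=> /eqP; rewrite mulf_eq0 subr_eq0 [1 == _]eq_sym (lt_eqF c1) orbF.
by rewrite paddr_eq0 ?sqr_ge0 // !sqrf_eq0 => /andP[/eqP A0 /eqP B0].
Qed.

(** * Fourier transform of the Haar distribution of a subgroup *)

Section Haar.
Variables (R : realType) (a : seqa).
Local Notation SolM := (SolM R a).
Variables (K : set (Sol R a)) (mK : probability SolM R).

Definition annihilates y := forall k : Sol R a, K k -> eqm (2 * pi) (phase y k) (0 : R).

Lemma Ex_haar_in y c : inH a y -> measurable (K : set SolM) -> mK K = 1%E -> annihilates y ->
  Ex mK (fun x : SolM => cos (phase y x + c)) = cos c.
Proof.
move=> hy mKm mK1 ay; rewrite -[RHS](Ex_cst mK); apply: Ex_ae.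
- exact: bmf_cos_phase.
- exact: bmf_cst.
exists (~` K); split; first exact: measurableC.
  by rewrite probability_setC // [X in (_ - X)%E](_ : _ = 1%E) // subee.
move=> x /= h Kx; apply: h; apply: cos_eqm.
by rewrite -[X in eqm _ _ X]add0r; apply: eqmD (ay x Kx) (eqm_refl _ _).
Qed.

Hypothesis inv : forall k, K k -> forall E : set SolM, measurable E ->
    mK [set sol_add k x | x in E] = mK E.

Lemma Ex_haar_shift k (g : SolM -> R) : K k -> bmf g ->
  Ex mK (fun x : SolM => g (sol_add k x)) = Ex mK g.
Proof.
move=> Kk bg; have mk : measurable_fun setT (fun x : SolM => sol_add k x : SolM).
  by apply: measurable_sol_add => //; exact: measurable_cst.
rewrite -(@Ex_law _ _ _ _ _ mK mK _ _ mk) // => A mA.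
rewrite -[RHS](inv Kk); last by rewrite -[X in measurable X]setTI; exact: mk.
congr (mK _); apply/seteqP; split => x /=.
  move=> Ax; exists (sol_add (sol_opp k) x) => /=.
    by rewrite sol_addA (sol_addC k) sol_addN sol_add0.
  by rewrite sol_addA (sol_addC k) sol_addN sol_add0.
by move=> [z Az <-].
Qed.

(** Translation by a point k of K with phase y k nonzero modulo 2 pi makes the pair of cosine and
    sine integrals a fixed point of the rotation by that angle. *)
Lemma Ex_haar_notin y c : inH a y -> ~ annihilates y ->
  Ex mK (fun x : SolM => cos (phase y x + c)) = 0.
Proof.
move=> hy ny; have [k [Kk nk]] : exists k, K k /\ ~ eqm (2 * pi) (phase y k) (0 : R).
  by apply: contrapT => h; apply: ny => k Kk; apply: contrapT => h'; apply: h; exists k.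
set th := phase y k in nk.
pose A := Ex mK (fun x : SolM => cos (phase y x)).
pose B := Ex mK (fun x : SolM => sin (phase y x)).
have E e : Ex mK (fun x : SolM => cos (phase y x + e)) = cos e * A - sin e * B.
  rewrite (_ : (fun x => _) =
    (fun x => cos e * cos (phase y x) - sin e * sin (phase y x))); last first.
    by apply/funext => x; rewrite cosD ![_ * cos (phase y x)]mulrC ![_ * sin (phase y x)]mulrC.
  have b1 := bmf_cosp hy; have b2 := bmf_sinp hy.
  by rewrite ExB ?ExZ //; exact: bmfZ.
have S e : cos e * A - sin e * B = cos (e + th) * A - sin (e + th) * B.
  rewrite -!E -(Ex_haar_shift Kk (bmf_cos_phase e hy)); congr (Ex _ _).
  apply/funext => x; apply: cos_eqm.
  have -> : phase y x + (e + th) = th + phase y x + e by ring.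
  by apply: eqmD (phase_add _ _ hy) (eqm_refl _ _).
have S0 := S 0; rewrite cos0 sin0 add0r mul1r mul0r subr0 in S0.
(* The shifts 0 and pi / 2 give the cosine and the sine line of the rotation. *)
have S1 := S (pi / 2).
rewrite cos_pihalf sin_pihalf [_ + th]addrC cosDpihalf sinDpihalf in S1.
have c1 : cos th < 1.
  by rewrite lt_neqAle cos_le1 andbT; apply/eqP => /cos_eq1_eqm.
have S2 : B = cos th * B + sin th * A by move: S1; move: A B {S0 S E} => x z; lra.
have [A0 B0] := rotation_fixed c1 S0 S2.
by rewrite E A0 B0 !mulr0 subrr.
Qed.

End Haar.

Section ProductExpectation.
Context d1 (T1 : measurableType d1) d2 (T2 : measurableType d2) (R : realType).
Variables (P1 : probability T1 R) (P2 : probability T2 R).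

(** Rectangles are known; [indep_bmf] then replaces the indicators by bounded functions, first in
    one factor, then in the other. *)
Lemma Ex_product (f : T1 -> R) (g : T2 -> R) : bmf f -> bmf g ->
  Ex (P1 \x P2)%E (fun z => f z.1 * g z.2) = Ex P1 f * Ex P2 g.
Proof.
move=> bf bg.
have b1 (f' : T1 -> R) : bmf f' -> bmf (fun z : T1 * T2 => f' z.1).
  by exact: bmf_comp measurable_fst.
have b2 (g' : T2 -> R) : bmf g' -> bmf (fun z : T1 * T2 => g' z.2).
  by exact: bmf_comp measurable_snd.
have rect A B : measurable A -> measurable B ->
    Ex (P1 \x P2)%E (fun z => \1_B z.2 * \1_A z.1) = Ex P2 \1_B * Ex P1 \1_A.
  move=> mA mB; apply: EFin_inj; rewrite EFinM !Ex_indic //.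
  rewrite muleC -product_measure1E // -Ex_indic; last exact: measurableX.
  by congr (Ex _ _)%:E; apply/funext => z; rewrite !indicE in_setX mulrC -natrM mulnb.
have E1 (T : measurableType d1) (P : probability T R) : Ex P \1_setT = 1.
  by apply: EFin_inj; rewrite Ex_indic //; exact: probability_setT.
have E2 (T : measurableType d2) (P : probability T R) : Ex P \1_setT = 1.
  by apply: EFin_inj; rewrite Ex_indic //; exact: probability_setT.
have s1 A : measurable A -> Ex (P1 \x P2)%E (fun z => g z.2 * \1_A z.1) = Ex P2 g * Ex P1 \1_A.
  move=> mA.
  have e : Ex (P1 \x P2)%E (fun z => \1_A z.1) = Ex P1 \1_A.
    have := rect A setT mA measurableT; rewrite E2 mul1r => <-; congr (Ex _ _).
    by apply/funext => z; rewrite [\1_setT _]indicE in_setT mul1r.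
  rewrite -e; apply: indep_bmf => //; first exact: b1 (bmf_indic _ mA).
  by move=> B mB; rewrite e; exact: rect.
have e : Ex (P1 \x P2)%E (fun z => g z.2) = Ex P2 g.
  have := s1 setT measurableT; rewrite E1 mulr1 => <-; congr (Ex _ _).
  by apply/funext => z; rewrite [\1_setT _]indicE in_setT mulr1.
rewrite -e; apply: (@indep_bmf _ _ _ _ _ _ P1 (fun z : T1 * T2 => z.1) (fun z => g z.2)) => //.
- exact: measurable_fst.
- exact: b2.
by move=> A mA; rewrite e mulrC -s1 //; congr (Ex _ _); apply/funext => z; rewrite mulrC.
Qed.

End ProductExpectation.

Section Sufficiency.
Variables (R : realType) (a : seqa).
Local Notation SolM := (SolM R a).
Variables (tau : R -> Sol R a) (M : probability (measurableTypeR R) R) (mK : probability SolM R).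
Hypothesis tauD : forall s t, tau (s + t) = sol_add (tau s) (tau t).
Hypothesis tauC : forall U : set (Sol R a), sol_open U -> open (tau @^-1` U).

Lemma continuous_periodic_hom y (h : R -> R) : inH a y -> continuous h ->
  (forall u v, eqm (2 * pi) u v -> h u = h v) -> continuous (fun t => h (phase y (tau t))).
Proof.
move=> hy ch hp; apply/continuousP => V oV.
have := tauC (@sol_open_phase R a y h V hy ch hp oV).
by congr open.
Qed.

Lemma hom_phase y : inH a y -> exists l, forall t, eqm (2 * pi) (phase y (tau t)) (l * t).
Proof.
move=> hy; apply: circle_hom_lift.
- by move=> s t; rewrite tauD; exact: phase_add.
- by apply: continuous_periodic_hom => //; [exact: continuous_cos|exact: cos_eqm].
- by apply: continuous_periodic_hom => //; [exact: continuous_sin|exact: sin_eqm].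
Qed.

Lemma measurable_hom : measurable_fun setT (tau : measurableTypeR R -> SolM).
Proof.
apply: measurable_sol => y hy; have [l hl] := hom_phase hy.
apply: (@trig_measurable_eqm _ _ _ (fun t => l * t)).
  by move=> t; apply: eqm_sym; exact: hl.
by apply: trig_measurable_real; apply: measurable_funM => //; exact: measurable_cst.
Qed.

(** The section at k of the preimage of E under (k, t) -> tau t + k is the set whose M-measure
    [conv_image] integrates, so mu is the image of m_K x M under this map. *)
Lemma Ex_conv_image (mu : probability SolM R) (g : SolM -> R) : bmf g ->
  (forall E : set SolM, measurable E -> mu E = conv_image tau M mK E) ->
  Ex mu g = Ex (mK \x M)%E (fun z => g (sol_add (tau z.2) z.1)).
Proof.
move=> bg h.
have mF : measurable_fun setT (fun z : SolM * measurableTypeR R => sol_add (tau z.2) z.1 : SolM).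
  apply: measurable_sol_add; last exact: measurable_fst.
  exact: (measurableT_comp measurable_hom measurable_snd).
apply: (Ex_law (P := (mK \x M)%E) mF _ bg) => E mE.
rewrite h // /conv_image /product_measure1; apply: eq_integral => k _ /=.
by congr (M _); apply/seteqP; split => t /=; rewrite /xsection /= inE.
Qed.

Lemma hyp_secant_Ex : hyp_secant M -> exists sigma : R, forall s,
  Ex M (fun x => cos (s * x)) = 2 / (expR (sigma * s) + expR (- (sigma * s))) /\
  Ex M (fun x => sin (s * x)) = 0.
Proof.
by move=> [sigma h]; exists sigma => s; have [h1 h2] := h s; split; rewrite /Ex /Rintegral ?h1 ?h2.
Qed.

Lemma charf_conv_image (mu : probability SolM R) y l : inH a y ->
  (forall E : set SolM, measurable E -> mu E = conv_image tau M mK E) ->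
  (forall t, eqm (2 * pi) (phase y (tau t)) (l * t)) ->
  Ex M (fun x => sin (l * x)) = 0 ->
  charf mu y = Ex M (fun x => cos (l * x)) * charf mK y.
Proof.
move=> hy h hl s0; have b1 := bmf_cosp hy; have b2 := bmf_sinp hy.
have ml : measurable_fun setT (fun t : measurableTypeR R => l * t).
  by apply: measurable_funM => //; exact: measurable_cst.
have b3 := bmf_cos ml; have b4 := bmf_sin ml.
rewrite /charf (Ex_conv_image b1 h).
rewrite (_ : (fun z => _) = (fun z : SolM * measurableTypeR R =>
  cos (phase y z.1) * cos (l * z.2) - sin (phase y z.1) * sin (l * z.2))); last first.
  apply/funext => z; rewrite -cosD; apply: cos_eqm; rewrite addrC.
  by apply: eqm_trans (phase_add _ _ hy) _; apply: eqmD (hl _) (eqm_refl _ _).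
rewrite ExB; last 2 first.
- apply: bmfM; first exact: (bmf_comp measurable_fst b1).
  exact: (bmf_comp measurable_snd b3).
- apply: bmfM; first exact: (bmf_comp measurable_fst b2).
  exact: (bmf_comp measurable_snd b4).
by rewrite (Ex_product mK M b1 b3) (Ex_product mK M b2 b4) s0 mulr0 subr0 mulrC.
Qed.

Lemma conv_image_functional (mu : probability SolM R) (K : set (Sol R a)) :
  hyp_secant M -> sol_compact K -> corwin K -> haar_of K mK ->
  (forall E : set SolM, measurable E -> mu E = conv_image tau M mK E) ->
  forall y, inH a y -> charf mu (2 * y) = charf mu y ^+ 2 * (1 + charf mu (2 * y)) / 2.
Proof.
move=> hM cK kK [mK1 inv] h y hy; have mKm := sol_compact_measurable cK.
have hy2 := inH_double hy.
have [l hl] := hom_phase hy.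
have hl2 t : eqm (2 * pi) (phase (2 * y) (tau t)) (2 * l * t).
  apply: eqm_trans (phaseMz 2 _ hy) _; rewrite -mulrA.
  by apply: (eqmMz 2); exact: hl.
have [sigma hs] := hyp_secant_Ex hM.
have [e1 s1] := hs l; have [e2 s2] := hs (2 * l).
rewrite (charf_conv_image hy h hl s1) (charf_conv_image hy2 h hl2 s2) e1 e2.
have c z : charf mK z = Ex mK (fun x : SolM => cos (phase z x + 0)).
  by congr (Ex _ _); apply/funext => x; rewrite addr0.
have [ay|nay] := pselect (annihilates K y).
  have ay2 : annihilates K (2 * y).
    move=> k Kk; apply: eqm_trans (phaseMz 2 k hy) _.
    by have := eqmMz 2 (ay k Kk); rewrite mulr0.
  rewrite !c (Ex_haar_in 0 hy mKm mK1 ay) (Ex_haar_in 0 hy2 mKm mK1 ay2) cos0 !mulr1.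
  (* With E = e^(sigma l) both sides are rational in E; the identity behind them is cosh 2x + 1 = 2
     cosh^2 x. *)
  have -> : sigma * (2 * l) = sigma * l + sigma * l by ring.
  rewrite opprD !expRD expRN.
  have := expR_gt0 (sigma * l); move: (expR _) => E E0.
  field; rewrite !gt_eqF //=.
  all: try by rewrite ?addr_gt0 ?mulr_gt0 ?invr_gt0.
have nay2 : ~ annihilates K (2 * y).
  move=> ay2; apply: nay => k; rewrite -[in X in X -> _]kK => -[k' Kk' <-].
  apply: eqm_trans (phase_muln 2 k' hy) _.
  by apply: eqm_trans (ay2 k' Kk'); apply: eqm_sym; exact: (phaseMz 2 _ hy).
by rewrite !c (Ex_haar_notin inv 0 hy nay) (Ex_haar_notin inv 0 hy2 nay2) !mulr0 expr0n mul0r mul0r.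
Qed.

End Sufficiency.

(** * Solutions of the functional equation *)

Section Sech.
Variable R : realType.
Implicit Types (x y z t u v e : R).

Definition ch t : R := (expR t + expR (- t)) / 2.

(** This is cosh t - 1 = 2 sinh^2 (t / 2); bounds on [ch] thus follow from bounds on e^x -
    e^(-x). *)
Lemma ch_half t : ch t - 1 = (expR (t / 2) - expR (- (t / 2))) ^+ 2 / 2.
Proof.
have e : t = t / 2 + t / 2 by lra.
rewrite /ch {1 2}e opprD !expRD.
have : expR (t / 2) * expR (- (t / 2)) = 1 by rewrite expRN divff // gt_eqF // expR_gt0.
move: (expR (t / 2)) (expR (- (t / 2))) => p q pq.
have -> : (p - q) ^+ 2 = p * p + q * q - 2 * (p * q) by ring.
by rewrite pq; lra.
Qed.

(** Derived from 1 + x <= e^x alone, like [expRB_le]. Both bounds are equivalent to 2 x at 0, the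
    only precision required when the argument is divided by 2^n. *)
Lemma expRB_ge x : 0 <= x -> 2 * x / (1 + x) <= expR x - expR (- x).
Proof.
move=> x0; have p0 : 0 < 1 + x by lra.
have h1 : 1 + x <= expR x by exact: expR_ge1Dx.
have h2 : expR (- x) <= (1 + x)^-1 by rewrite expRN lef_pV2 // posrE ?expR_gt0.
apply: (@le_trans _ _ ((1 + x) - (1 + x)^-1)); last by lra.
rewrite ler_pdivrMr // mulrBl mulVf ?gt_eqF //.
by have := mulr_ge0 x0 x0; lra.
Qed.

Lemma expRB_le x : 0 <= x < 1 -> expR x - expR (- x) <= 2 * x / (1 - x).
Proof.
move=> /andP[x0 x1]; have p0 : 0 < 1 - x by lra.
have h1 : 1 - x <= expR (- x) by exact: expR_ge1Dx.
have h2 : expR x <= (1 - x)^-1.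
  by rewrite -[x in expR x]opprK expRN lef_pV2 // posrE ?expR_gt0.
apply: (@le_trans _ _ ((1 - x)^-1 - (1 - x))); first by lra.
rewrite ler_pdivlMr // mulrBl mulVf ?gt_eqF //.
by have := mulr_ge0 x0 x0; lra.
Qed.

Lemma ch_ge1 t : 1 <= ch t.
Proof. by rewrite -subr_ge0 ch_half divr_ge0 // sqr_ge0. Qed.

(** Since 1 - 1 / c <= c - 1 for c >= 1, [ch_half] and [expRB_le] apply. Together with
    [sech_defect_ge] this says that 1 - 1 / ch t is equivalent to t^2 / 2 at 0. *)
Lemma sech_defect_le t : 0 <= t < 2 -> 1 - (ch t)^-1 <= t ^+ 2 / 2 / (1 - t / 2) ^+ 2.
Proof.
move=> /andP[t0 t2]; have c1 := ch_ge1 t.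
have h : 1 - (ch t)^-1 <= ch t - 1.
  have ci : (ch t)^-1 * ch t = 1 by rewrite mulVf // gt_eqF // (lt_le_trans _ c1).
  have i1 : (ch t)^-1 <= 1 by rewrite invf_le1 // (lt_le_trans _ c1).
  have : 0 <= (1 - (ch t)^-1) * (ch t - 1) by rewrite mulr_ge0 // subr_ge0.
  by lra.
apply: le_trans h _; rewrite ch_half.
have x01 : 0 <= t / 2 < 1 by lra.
have := expRB_le x01; set D := expR _ - expR _ => hD.
have D0 : 0 <= D.
  by apply: le_trans (expRB_ge (_ : 0 <= t / 2)); rewrite ?divr_ge0 //; lra.
have p0 : 0 < 1 - t / 2 by lra.
rewrite -mulrA [2^-1 * _]mulrC mulrA ler_pM2r ?invr_gt0 //.
have -> : t ^+ 2 / (1 - t / 2) ^+ 2 = (2 * (t / 2) / (1 - t / 2)) ^+ 2.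
  by rewrite expr_div_n; congr (_ ^+ 2 / _); lra.
by rewrite ler_sqr ?nnegrE // divr_ge0 ?mulr_ge0 ?divr_ge0 // ltW.
Qed.

Lemma sech_defect_ge t : 0 <= t ->
  t ^+ 2 / 2 / ((1 + t / 2) ^+ 2 + t ^+ 2 / 2) <= 1 - (ch t)^-1.
Proof.
move=> t0; have c1 := ch_ge1 t.
have p0 : 0 < 1 + t / 2 by lra.
have h := expRB_ge (_ : 0 <= t / 2).
have {}h : t ^+ 2 / 2 / (1 + t / 2) ^+ 2 <= ch t - 1.
  rewrite ch_half -mulrA [2^-1 * _]mulrC mulrA ler_pM2r ?invr_gt0 //.
  have -> : t ^+ 2 / (1 + t / 2) ^+ 2 = (2 * (t / 2) / (1 + t / 2)) ^+ 2.
    by rewrite expr_div_n; congr (_ ^+ 2 / _); lra.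
  have q0 : 0 <= 2 * (t / 2) / (1 + t / 2) by rewrite divr_ge0 ?mulr_ge0 ?divr_ge0 // ltW.
  have hh := h (divr_ge0 t0 (ler0n _ 2)).
  by rewrite ler_sqr ?nnegrE // (le_trans q0).
have s0 : 0 < (1 + t / 2) ^+ 2 by rewrite exprn_gt0.
have d0 : 0 < (1 + t / 2) ^+ 2 + t ^+ 2 / 2 by rewrite ltr_pwDl // divr_ge0 // sqr_ge0.
have {}h : t ^+ 2 / 2 <= (ch t - 1) * (1 + t / 2) ^+ 2 by rewrite -ler_pdivrMr.
have cp : 0 < ch t by rewrite (lt_le_trans _ c1).
have -> : 1 - (ch t)^-1 = (ch t - 1) / ch t by rewrite mulrBl divff ?gt_eqF // mul1r.
rewrite ler_pdivrMr // [leRHS]mulrAC ler_pdivlMr //.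
move: h; move: (t ^+ 2 / 2) ((1 + t / 2) ^+ 2) (ch t) => a b c h; lra.
Qed.

Lemma sqrD_weighted (p q t : R) : 0 < t -> (p + q) ^+ 2 <= (1 + t) * p ^+ 2 + (1 + t^-1) * q ^+ 2.
Proof.
move=> t0; rewrite -subr_ge0.
have -> : (1 + t) * p ^+ 2 + (1 + t^-1) * q ^+ 2 - (p + q) ^+ 2 = (t * p - q) ^+ 2 / t.
  by field; rewrite gt_eqF.
by rewrite divr_ge0 ?sqr_ge0 // ltW.
Qed.

(** As 1 - cos u is half of |1 - e^(iu)|^2, this is the square of a triangle inequality, with the
    cross term split by the weight t. Being linear in the defects, it can be integrated directly. *)
Lemma cos_defect_subadditive u v t : 0 < t ->
  1 - cos (u + v) <= (1 + t) * (1 - cos u) + (1 + t^-1) * (1 - cos v).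
Proof.
move=> t0.
have half x : 1 - cos x = 2 * sin (x / 2) ^+ 2.
  have -> : cos x = cos (x / 2 *+ 2) by congr cos; rewrite -mulr_natr; lra.
  by rewrite cos_mulr2n sin2cos2 -mulr_natr; lra.
rewrite !half (_ : (u + v) / 2 = u / 2 + v / 2); last by lra.
rewrite sinD; set a := sin (u / 2); set b := cos (v / 2); set c := cos (u / 2); set d := sin (v / 2).
have h := sqrD_weighted (a * b) (c * d) t0.
have b1 : b ^+ 2 <= 1 by rewrite /b cos2sin2 lerBlDr lerDl sqr_ge0.
have c1 : c ^+ 2 <= 1 by rewrite /c cos2sin2 lerBlDr lerDl sqr_ge0.
have i0 : 0 < t^-1 by rewrite invr_gt0.
have h1 : (1 + t) * (a * b) ^+ 2 <= (1 + t) * a ^+ 2.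
  rewrite ler_pM2l; last by lra.
  by rewrite exprMn -[leRHS]mulr1 ler_wpM2l // sqr_ge0.
have h2 : (1 + t^-1) * (c * d) ^+ 2 <= (1 + t^-1) * d ^+ 2.
  rewrite ler_pM2l; last by lra.
  by rewrite exprMn -[leRHS]mul1r ler_wpM2r // sqr_ge0.
have -> : (1 + t) * (2 * a ^+ 2) + (1 + t^-1) * (2 * d ^+ 2) =
  2 * ((1 + t) * a ^+ 2 + (1 + t^-1) * d ^+ 2) by ring.
by rewrite ler_pM2l //; apply: le_trans h _; exact: lerD.
Qed.

End Sech.

(** * The equation on a group of reals closed under halving *)

Section SechEquation.
Variables (R : realType) (H : R -> Prop) (f : R -> R).
Hypotheses (H0 : H 0) (HD : forall y z, H y -> H z -> H (y + z))
  (HN : forall y, H y -> H (- y)) (Hhalf : forall y, H y -> H (y / 2)).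
Hypothesis Hcomm : forall y z, H y -> H z -> 0 < y -> 0 < z ->
  exists p q : nat, [/\ (0 < p)%N, (0 < q)%N & p%:R * y = q%:R * z].
Hypotheses (f0 : f 0 = 1) (fN : forall y, H y -> f (- y) = f y)
  (f1 : forall y, H y -> `|f y| <= 1).
Hypothesis fE : forall y, H y -> f (2 * y) = f y ^+ 2 * (1 + f (2 * y)) / 2.
(* For f = charf mu, 1 - f y is half the integral of |1 - e^(i phase y)|^2. *)
Hypothesis fsub : forall y z t, H y -> H z -> 0 < t ->
  1 - f (y + z) <= (1 + t) * (1 - f y) + (1 + t^-1) * (1 - f z).
Implicit Types y z : R.

Definition supp y := H y /\ f y != 0.

(** The equation is linear in f (2 y), and |f| <= 1 keeps its coefficient 2 - f(y)^2 away from 0.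
    Applied to y / 2, it exhibits f y as a nonnegative quotient. *)
Lemma f_double y : H y -> f (2 * y) = f y ^+ 2 / (2 - f y ^+ 2) /\ 1 <= 2 - f y ^+ 2.
Proof.
move=> hy; have h1 : f y ^+ 2 <= 1 by rewrite -real_normK ?num_real // exprn_ile1 // f1.
have h2 : 1 <= 2 - f y ^+ 2 by lra.
split=> //; have h3 : 2 - f y ^+ 2 != 0 by rewrite gt_eqF // (lt_le_trans _ h2).
apply: (mulIf h3); rewrite divfK //.
by have := fE hy; move: (f (2 * y)) (f y ^+ 2) => a b; lra.
Qed.

Lemma f_half y : H y -> f y = f (y / 2) ^+ 2 / (2 - f (y / 2) ^+ 2).
Proof.
move=> hy; have [<- _] := f_double (Hhalf hy).
by congr f; lra.
Qed.

Lemma f_ge0 y : H y -> 0 <= f y.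
Proof.
move=> hy; rewrite f_half //; have [_ h] := f_double (Hhalf hy).
by rewrite divr_ge0 ?sqr_ge0 // (le_trans _ h).
Qed.

Lemma supp_gt0 y : supp y -> 0 < f y.
Proof. by move=> [hy ny]; rewrite lt0r ny f_ge0. Qed.

Lemma supp0 : supp 0.
Proof. by split => //; rewrite f0 oner_eq0. Qed.

Lemma suppN y : supp y -> supp (- y).
Proof. by move=> [hy ny]; split; [exact: HN|rewrite fN]. Qed.

Lemma supp_half y : supp y -> supp (y / 2).
Proof.
move=> [hy ny]; split; first exact: Hhalf.
by apply: contra_neq ny => h; rewrite f_half // h expr0n mul0r.
Qed.

Lemma supp_double y : supp y -> supp (2 * y).
Proof.
move=> [hy ny]; split; first by rewrite (_ : 2 * y = y + y); [exact: HD|lra].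
have [-> h] := f_double hy.
by rewrite mulf_neq0 ?expf_neq0 // invr_neq0 // gt_eqF // (lt_le_trans _ h).
Qed.

Lemma supp_pow2 n y : supp (y / 2 ^+ n) <-> (supp y /\ H (y / 2 ^+ n)).
Proof.
split.
  move=> h; split; last by case: h.
  elim: n y h => [|n ih] y; first by rewrite expr0 divr1.
  move=> h; apply: ih; have := supp_double h; congr supp.
  by rewrite exprS invfM mulrCA mulVKf //.
move=> [h _]; elim: n => [|n ih]; first by rewrite expr0 divr1.
by have := supp_half ih; rewrite exprSr invfM mulrA.
Qed.

Lemma H_pow2 n y : H y -> H (y / 2 ^+ n).
Proof.
move=> hy; elim: n => [|n ih]; first by rewrite expr0 divr1.
by have := Hhalf ih; rewrite exprSr invfM mulrA.
Qed.

(* arcosh (1 / f y), so that f = 1 / ch lift on the support of f. *)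
Definition lift y : R := ln ((f y)^-1 + Num.sqrt ((f y)^-1 ^+ 2 - 1)).

Lemma inv_f_ge1 y : supp y -> 1 <= (f y)^-1.
Proof.
move=> sy; have fp := supp_gt0 sy; rewrite -invf_le1 ?invr_gt0 // invrK.
by apply: le_trans (ler_norm _) _; apply: f1; case: sy.
Qed.

Lemma lift_ge0 y : supp y -> 0 <= lift y.
Proof.
move=> sy; apply: ln_ge0; apply: le_trans (inv_f_ge1 sy) _.
by rewrite lerDl sqrtr_ge0.
Qed.

Lemma f_lift y : supp y -> f y = (ch (lift y))^-1.
Proof.
move=> sy; have c1 := inv_f_ge1 sy; rewrite -[LHS]invrK; congr (_^-1).
rewrite /lift; set c := (f y)^-1 in c1 *.
have c0 : 0 <= c ^+ 2 - 1 by rewrite subr_ge0 expr_ge1 // (le_trans _ c1).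
set s := Num.sqrt _; have s0 : 0 <= s by exact: sqrtr_ge0.
have s2 : s ^+ 2 = c ^+ 2 - 1 by rewrite sqr_sqrtr.
have g0 : 0 < c + s by lra.
rewrite /ch expRN lnK ?posrE //.
have -> : (c + s)^-1 = c - s.
  apply: (mulIf (lt0r_neq0 g0)); rewrite mulVf ?gt_eqF //.
  have -> : (c - s) * (c + s) = c ^+ 2 - s ^+ 2 by ring.
  by rewrite s2; lra.
by lra.
Qed.

Lemma lift_double y : supp y -> lift (2 * y) = 2 * lift y.
Proof.
move=> sy; have c1 := inv_f_ge1 sy; have [hy ny] := sy.
(* The duplication formula of cosh, satisfied by 1 / f. With s = sqrt (c^2 - 1), which plays the
   role of sinh, the argument of ln at 2 y becomes (c + s)^2. *)
have e : (f (2 * y))^-1 = 2 * (f y)^-1 ^+ 2 - 1.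
  have [-> h] := f_double hy; have h0 : 2 - f y ^+ 2 != 0 by rewrite gt_eqF // (lt_le_trans _ h).
  by field; rewrite ny h0.
rewrite /lift e; set c := (f y)^-1 in c1 *.
have c0 : 0 <= c ^+ 2 - 1 by rewrite subr_ge0 expr_ge1 // (le_trans _ c1).
have -> : (2 * c ^+ 2 - 1) ^+ 2 - 1 = (2 * c) ^+ 2 * (c ^+ 2 - 1) by ring.
rewrite sqrtrM ?sqr_ge0 // sqrtr_sqr ger0_norm; last by lra.
set s := Num.sqrt _; have s0 : 0 <= s by exact: sqrtr_ge0.
have s2 : s ^+ 2 = c ^+ 2 - 1 by rewrite sqr_sqrtr.
have -> : 2 * c ^+ 2 - 1 + 2 * c * s = (c + s) ^+ 2.
  have -> : (c + s) ^+ 2 = c ^+ 2 + 2 * c * s + s ^+ 2 by ring.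
  by rewrite s2; lra.
by rewrite expr2 lnM ?posrE //; lra.
Qed.

Lemma lift_pow2 n y : supp y -> lift (y / 2 ^+ n) = lift y / 2 ^+ n.
Proof.
move=> sy; elim: n => [|n ih]; first by rewrite expr0 !divr1.
have sn : supp (y / 2 ^+ n.+1) by apply/supp_pow2; split => //; apply: H_pow2; case: sy.
have := lift_double sn; rewrite {1}exprS {1}invfM [2 * (y * _)]mulrCA mulVKf // ih => e.
have -> : lift y / 2 ^+ n.+1 = lift y / 2 ^+ n / 2 by rewrite exprSr invfM mulrA.
by rewrite e; lra.
Qed.

Lemma cvg_pow2V : (fun n => (2 ^+ n)^-1 : R) @ \oo --> (0 : R).
Proof.
rewrite (_ : (fun n => _) = (fun n => (2^-1 : R) ^+ n)); last first.
  by apply/funext => n; rewrite exprVn.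
by apply: cvg_expr; rewrite ger0_norm // invf_lt1 // ltr1n.
Qed.

Lemma cvg_f_pow2 y : supp y -> (fun n => f (y / 2 ^+ n)) @ \oo --> (1 : R).
Proof.
move=> sy; have c0 : (fun n => lift y * (2 ^+ n)^-1) @ \oo --> (0 : R).
  by rewrite -[X in _ --> X](mulr0 (lift y)); apply: cvgM cvg_pow2V; exact: cvg_cst.
have fE' n : f (y / 2 ^+ n) = (ch (lift y * (2 ^+ n)^-1))^-1.
  rewrite -lift_pow2 // -f_lift //; apply/supp_pow2; split => //.
  by apply: H_pow2; case: sy.
rewrite (funext fE').
have cE (g : nat -> R) : g @ \oo --> (0 : R) -> (fun n => expR (g n)) @ \oo --> (1 : R).
  by move=> hg; rewrite -expR0; apply: (continuous_cvg _ (@continuous_expR R _) hg).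
rewrite -[X in _ --> X]invr1; apply: cvgV; first exact: oner_neq0.
rewrite [X in _ --> X](_ : 1 = (1 + 1) / 2); last by lra.
apply: cvgM; last exact: cvg_cst.
apply: cvgD; first exact: cE.
by apply: cE; rewrite -[X in _ --> X]oppr0; exact: cvgN.
Qed.

(** By [fsub] with t = 1, f ((y + z) / 2^n) is nonzero once f (y / 2^n) and f (z / 2^n) are close
    enough to 1; n doublings lead back to y + z inside the support. *)
Lemma suppD y z : supp y -> supp z -> supp (y + z).
Proof.
move=> sy sz; have [hy _] := sy; have [hz _] := sz.
have cd : (fun n => 2 * (1 - f (y / 2 ^+ n)) + 2 * (1 - f (z / 2 ^+ n))) @ \oo --> (0 : R).
  have h w : supp w -> (fun n => 2 * (1 - f (w / 2 ^+ n))) @ \oo --> (0 : R).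
    move=> sw; rewrite [X in _ --> X](_ : 0 = 2 * (1 - 1)); last by lra.
    by apply: cvgM; [exact: cvg_cst|apply: cvgB; [exact: cvg_cst|exact: cvg_f_pow2]].
  by rewrite -[X in _ --> X]addr0; apply: cvgD; exact: h.
have [n hn] : exists n, 2 * (1 - f (y / 2 ^+ n)) + 2 * (1 - f (z / 2 ^+ n)) < 1.
  have /cvgrPdist_lt /(_ 1 ltr01) [n _ /(_ n (leqnn n))] := cd.
  by rewrite /= sub0r normrN => /(le_lt_trans (ler_norm _)) h; exists n.
have hyz : H ((y + z) / 2 ^+ n) by apply: H_pow2; exact: HD.
suff : supp ((y + z) / 2 ^+ n) by move=> /supp_pow2[].
split=> //; apply/eqP => e.
have := fsub (H_pow2 n hy) (H_pow2 n hz) ltr01.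
by rewrite -mulrDl e invr1; lra.
Qed.

(** [fsub] is applied at y / 2^n and z / 2^n, where [lift] is divided by 2^n. As 1 - 1 / ch s is
    equivalent to s^2 / 2 at 0, rescaling by 2^(2n+1) and letting n grow turns defects into squares
    of [lift]. *)
Lemma lift_weighted y z t : supp y -> supp z -> 0 < t ->
  lift (y + z) ^+ 2 <= (1 + t) * lift y ^+ 2 + (1 + t^-1) * lift z ^+ 2.
Proof.
move=> sy sz t0; have syz := suppD sy sz.
have [hy _] := sy; have [hz _] := sz.
have A0 := lift_ge0 sy; have B0 := lift_ge0 sz; have C0 := lift_ge0 syz.
set A := lift y in A0 *; set B := lift z in B0 *; set C := lift (y + z) in C0 *.
pose e n : R := (2 ^+ n)^-1.
have ce : e @ \oo --> (0 : R) := cvg_pow2V.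
have e0 n : 0 < e n by rewrite invr_gt0 exprn_gt0.
have c1 k : (fun n => (1 + k * e n) ^+ 2) @ \oo --> (1 : R).
  rewrite [X in _ --> X](_ : 1 = (1 + k * 0) * (1 + k * 0)); last by lra.
  rewrite (_ : (fun n => _) = (fun n => (1 + k * e n) * (1 + k * e n))); last first.
    by apply/funext => n; rewrite expr2.
  by apply: cvgM; apply: cvgD; (try exact: cvg_cst); apply: cvgM => //; exact: cvg_cst.
have cl : (fun n => C ^+ 2 / ((1 + C / 2 * e n) ^+ 2 + C ^+ 2 / 2 * (e n * e n))) @ \oo --> C ^+ 2.
  rewrite -[X in _ --> X]mulr1; apply: cvgM; first exact: cvg_cst.
  rewrite -[X in _ --> X]invr1; apply: cvgV; first exact: oner_neq0.
  rewrite -[X in _ --> X]addr0; apply: cvgD; first exact: c1.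
  rewrite [X in _ --> X](_ : 0 = C ^+ 2 / 2 * (0 * 0)); last by lra.
  by apply: cvgM; [exact: cvg_cst|exact: cvgM].
have cr D : (fun n => D ^+ 2 / (1 + - (D / 2) * e n) ^+ 2) @ \oo --> D ^+ 2.
  rewrite -[X in _ --> X]mulr1; apply: cvgM; first exact: cvg_cst.
  by rewrite -[X in _ --> X]invr1; apply: cvgV; [exact: oner_neq0|exact: c1].
have crr : (fun n => (1 + t) * (A ^+ 2 / (1 + - (A / 2) * e n) ^+ 2) +
   (1 + t^-1) * (B ^+ 2 / (1 + - (B / 2) * e n) ^+ 2)) @ \oo -->
   (1 + t) * A ^+ 2 + (1 + t^-1) * B ^+ 2.
  by apply: cvgD; apply: cvgM => //; exact: cvg_cst.
apply: (ler_cvg_to cl crr).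
have small D : \forall n \near \oo, D * e n < 2.
  have cD : (fun n => D * e n) @ \oo --> (0 : R).
    by rewrite -[X in _ --> X](mulr0 D); apply: cvgM => //; exact: cvg_cst.
  have /cvgrPdist_lt /(_ 2 (ltr0n _ 2)) := cD; apply: filterS => n.
  by rewrite sub0r normrN => /(le_lt_trans (ler_norm _)).
near=> n.
have sA : A * e n < 2 by near: n; exact: small.
have sB : B * e n < 2 by near: n; exact: small.
have sup w : supp w -> supp (w / 2 ^+ n).
  by move=> sw; apply/supp_pow2; split => //; apply: H_pow2; case: sw.
have E w : supp w -> f (w / 2 ^+ n) = (ch (lift w * e n))^-1.
  by move=> sw; rewrite f_lift ?lift_pow2 //; exact: sup.
have hs := fsub (H_pow2 n hy) (H_pow2 n hz) t0.
rewrite -mulrDl (E _ sy) (E _ sz) (E _ syz) -/A -/B -/C in hs.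
have en := e0 n.
have lb := sech_defect_ge (mulr_ge0 C0 (ltW en)).
have ubA : 1 - (ch (A * e n))^-1 <= (A * e n) ^+ 2 / 2 / (1 - A * e n / 2) ^+ 2.
  by apply: sech_defect_le; rewrite mulr_ge0 // ltW.
have ubB : 1 - (ch (B * e n))^-1 <= (B * e n) ^+ 2 / 2 / (1 - B * e n / 2) ^+ 2.
  by apply: sech_defect_le; rewrite mulr_ge0 // ltW.
have i0 : 0 < t^-1 by rewrite invr_gt0.
have hA : (1 + t) * (1 - (ch (A * e n))^-1) <= (1 + t) * ((A * e n) ^+ 2 / 2 / (1 - A * e n / 2) ^+ 2).
  by rewrite ler_pM2l // addr_gt0.
have hB : (1 + t^-1) * (1 - (ch (B * e n))^-1) <= (1 + t^-1) * ((B * e n) ^+ 2 / 2 / (1 - B * e n / 2) ^+ 2).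
  by rewrite ler_pM2l // addr_gt0.
have := le_trans lb (le_trans hs (lerD hA hB)).
(* Each term carries the factor e_n^2 / 2; removing it leaves the sequences of [cl] and [crr]. *)
have q0 : 0 < e n ^+ 2 / 2 by rewrite divr_gt0 // exprn_gt0.
have exA D : (D * e n) ^+ 2 / 2 / (1 - D * e n / 2) ^+ 2 =
    e n ^+ 2 / 2 * (D ^+ 2 / (1 + - (D / 2) * e n) ^+ 2).
  have -> : 1 - D * e n / 2 = 1 + - (D / 2) * e n by rewrite mulNr mulrAC.
  by rewrite exprMn; ring.
have -> : (C * e n) ^+ 2 / 2 / ((1 + C * e n / 2) ^+ 2 + (C * e n) ^+ 2 / 2) =
    e n ^+ 2 / 2 * (C ^+ 2 / ((1 + C / 2 * e n) ^+ 2 + C ^+ 2 / 2 * (e n * e n))).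
  have -> : 1 + C * e n / 2 = 1 + C / 2 * e n by rewrite mulrAC.
  have -> : (C * e n) ^+ 2 / 2 = C ^+ 2 / 2 * (e n * e n) by ring.
  by move: (_ + _ : R) => D; ring.
rewrite !exA.
have -> a b c d : a * (e n ^+ 2 / 2 * b) + c * (e n ^+ 2 / 2 * d) = e n ^+ 2 / 2 * (a * b + c * d) by ring.
by rewrite ler_pM2l.
Unshelve. all: by end_near.
Qed.

Lemma lift_subadditive y z : supp y -> supp z -> lift (y + z) <= lift y + lift z.
Proof.
move=> sy sz; have A0 := lift_ge0 sy; have B0 := lift_ge0 sz; have C0 := lift_ge0 (suppD sy sz).
apply/ler_addgt0Pr => d d0.
set A := lift y in A0 *; set B := lift z in B0 *; set C := lift (y + z) in C0 *.
pose A' := A + d / 2; pose B' := B + d / 2.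
have A'0 : 0 < A' by rewrite /A'; lra.
have B'0 : 0 < B' by rewrite /B'; lra.
(* This weight optimises [lift_weighted]; d only keeps A' positive. *)
have t0 : 0 < B' / A' by rewrite divr_gt0.
have h := lift_weighted sy sz t0; rewrite -/A -/B -/C in h.
have hA : A ^+ 2 <= A' ^+ 2 by rewrite ler_sqr ?nnegrE //; rewrite /A'; lra.
have hB : B ^+ 2 <= B' ^+ 2 by rewrite ler_sqr ?nnegrE //; rewrite /B'; lra.
have {}h : C ^+ 2 <= (A' + B') ^+ 2.
  apply: le_trans h _.
  have -> : (A' + B') ^+ 2 = (1 + B' / A') * A' ^+ 2 + (1 + (B' / A')^-1) * B' ^+ 2.
    by field; rewrite !gt_eqF.
  by apply: lerD; apply: ler_wpM2l => //; rewrite addr_ge0 // ?invr_ge0 ltW.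
move: h; rewrite ler_sqr ?nnegrE //; last by lra.
by rewrite /A' /B'; lra.
Qed.

Lemma supp_muln n y : supp y -> supp (n%:R * y).
Proof.
move=> sy; elim: n => [|n ih]; first by rewrite mul0r; exact: supp0.
by rewrite -natr1 mulrDl mul1r; exact: suppD.
Qed.

(** Subadditivity gives the upper bound for every multiple. For the lower bound, n y and (2^n - n) y
    add up to 2^n y, where [lift] is exactly homogeneous, so neither upper bound can be strict. *)
Lemma lift_muln n y : supp y -> lift (n%:R * y) = n%:R * lift y.
Proof.
move=> sy; have ub m : lift (m%:R * y) <= m%:R * lift y.
  elim: m => [|m ih]; first by rewrite !mul0r /lift f0 invr1 expr1n subrr sqrtr0 addr0 ln1.
  rewrite -natr1 !mulrDl !mul1r; apply: le_trans (lift_subadditive (supp_muln m sy) sy) _.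
  by rewrite lerD2r.
apply/eqP; rewrite eq_le ub /=.
have hp k : lift ((2 ^ k)%:R * y) = (2 ^ k)%:R * lift y.
  elim: k => [|k ih]; first by rewrite expn0 !mul1r.
  by rewrite expnS natrM -!mulrA -ih lift_double //; exact: supp_muln.
have n2 : (n <= 2 ^ n)%N by rewrite ltnW // ltn_expl.
have := lift_subadditive (supp_muln n sy) (supp_muln (2 ^ n - n) sy).
rewrite -mulrDl -natrD subnKC // hp => h.
have := ub (2 ^ n - n)%N; rewrite natrB // in h *; lra.
Qed.

Lemma sech_equation_solution :
  exists sigma : R, forall y, supp y -> f y = 2 / (expR (sigma * y) + expR (- (sigma * y))).
Proof.
have chV t : (ch t)^-1 = 2 / (expR t + expR (- t)) by rewrite /ch invfM invrK mulrC.
(* If the support is {0}, any sigma fits and 0 is taken; otherwise sigma is the slope of [lift] at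
   one positive z0. *)
have [[z0 [sz z00]]|none] := pselect (exists z0, supp z0 /\ 0 < z0); last first.
  exists 0 => y sy; rewrite mul0r oppr0 expR0.
  have -> : y = 0.
    apply/eqP; rewrite eq_le; apply/andP; split; rewrite leNgt; apply/negP => h; apply: none.
      by exists y.
    by exists (- y); split; [exact: suppN|rewrite oppr_gt0].
  by rewrite f0 -[1 + 1]/(2 : R) divff.
exists (lift z0 / z0).
have pos y : supp y -> 0 < y -> f y = 2 / (expR (lift z0 / z0 * y) + expR (- (lift z0 / z0 * y))).
  move=> sy y0; rewrite -chV f_lift //; congr (ch _)^-1.
  have [hy _] := sy; have [hz _] := sz.
  (* From p y = q z0 follows p lift y = q lift z0, so lift y / y is the same for all positive y of
     the support. *)
  have [p [q [p0 q0 e]]] := Hcomm hy hz y0 z00.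
  have := lift_muln p sy; rewrite e lift_muln // => e2.
  have pn : p%:R != 0 :> R by rewrite pnatr_eq0 -lt0n.
  have -> : lift y = q%:R * lift z0 / p%:R by rewrite e2 mulrC mulKf.
  have -> : y = q%:R * z0 / p%:R by rewrite -e mulrC mulKf.
  by field; rewrite pn gt_eqF.
move=> y sy; have [y0|y0|->] := ltgtP y 0; last first.
- by rewrite mulr0 oppr0 expR0 f0 -[1 + 1]/(2 : R) divff.
- exact: pos.
rewrite -fN; last by case: sy.
rewrite pos ?oppr_gt0 //; last exact: suppN.
by rewrite !mulrN opprK addrC.
Qed.

End SechEquation.

(** * From the functional equation to the factorization *)

Section Compactness.
Variables (R : realType) (a : seqa).
Local Notation Sol := (Sol R a).
Implicit Types (x : Sol) (K : set Sol).

Let space : topologicalType := (R * prod_topology (fun _ : nat => nat))%type.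
Let rep x : space := (sol_t x, digit (sol_x x)).

Lemma nbhs_cylinder (g : prod_topology (fun _ : nat => nat)) N :
  nbhs g [set h : prod_topology (fun _ : nat => nat) | forall k, (k < N)%N -> h k = g k].
Proof.
elim: N => [|N ih]; first by apply: filterS filterT.
have hN : nbhs g [set h : prod_topology (fun _ : nat => nat) | h N = g N].
  exact: (@proj_continuous _ (fun _ : nat => nat) N g _ (discrete_set1 (g N))).
apply: filterS (filterI ih hN) => h [h1 h2] k; rewrite ltnS leq_eqVlt => /orP[/eqP -> //|].
exact: h1.
Qed.

Lemma sol_open_nbhs (U : set Sol) (p : space) (y : Delta a) : sol_open U ->
  p.2 = digit y -> U (sol_proj p.1 y) ->
  nbhs p [set q | forall x, rep x = q -> U x].
Proof.
move=> oU py Up; have [e [e0 [N hN]]] := oU (p.1, y) Up.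
exists (ball p.1 e, [set h : prod_topology (fun _ : nat => nat) | forall k, (k < N)%N -> h k = p.2 k]).
  by split; [exact: nbhsx_ballx|exact: nbhs_cylinder].
move=> [s h] /= [hs hh] x [xs xh]; rewrite -(sol_projK x); apply: hN => /=.
  by move: hs; rewrite -xs /ball /= distrC.
by move=> k kN; rewrite -py -hh // -xh.
Qed.

(** The interval is closed although representatives have t < 1: a cluster point with t = 1 still has
    a class under [sol_proj], and open sets are tested on the product. Each digit has finitely many
    values, so Tychonoff's theorem applies. *)
Lemma compact_rep : compact ([set t : R | t \in `[0, 1]] `*`
  [set h : prod_topology (fun _ : nat => nat) | forall n, [set k | (k < a n)%N] (h n)]).
Proof.
apply: compact_setX; first exact: segment_compact.
apply: (@tychonoff _ (fun _ : nat => nat) (fun n => [set k | (k < a n)%N])) => n.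
by apply: finite_compact; exact: finite_II.
Qed.

(** Without a finite subcover the uncovered parts of K generate a proper filter on representatives.
    The class of a cluster point lies in K, whose complement is open, hence in some member U of the
    cover; but the filter contains a set avoiding U. *)
Lemma sol_compact_closed K : sol_open (~` K) -> sol_compact K.
Proof.
move=> oK C Copen KC; apply: contrapT => nF.
pose D := [set F : seq (set Sol) | [set` F] `<=` C].
pose B (F : seq (set Sol)) := rep @` (K `\` \bigcup_(U in [set` F]) U).
have Bcat F G : B (F ++ G) `<=` B F `&` B G.
  move=> _ [x [Kx nx] <-]; split; exists x => //; split => // -[U /= UF Ux]; apply: nx.
    by exists U => //=; rewrite mem_cat UF.
  by exists U => //=; rewrite mem_cat UF orbT.
have pF : ProperFilter (filter_from D B).
  apply: filter_from_proper.
    apply: filter_from_filter; first by exists [::].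
    move=> F G DF DG; exists (F ++ G); last exact: Bcat.
    by move=> U /=; rewrite mem_cat => /orP[/DF|/DG].
  move=> F DF; apply: contrapT => Be; apply: nF; exists F; split => // x Kx.
  by apply: contrapT => nx; apply: Be; exists (rep x); exists x.
have [|[t g] [[/= t01 gA] clu]] := compact_rep pF.
  exists [::] => // _ [x _ <-]; split => /=.
    by have /andP[h0 h1] := sol_range x; rewrite in_itv /= h0 ltW.
  by move=> n; case: (sol_x x).
pose y : Delta a := exist _ g gA.
have meets U F : sol_open U -> D F -> U (sol_proj t y) ->
    exists x, [/\ K x, U x & ~ (\bigcup_(V in [set` F]) V) x].
  move=> oU DF Ut; have nb := @sol_open_nbhs U (t, g) y oU erefl Ut.
  have fB : filter_from D B (B F) by exists F.
  have [_ [[x [Kx nx] <-] h]] := clu _ _ fB nb.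
  by exists x; split => //; exact: h.
have Kt : K (sol_proj t y).
  by apply: contrapT => nK; have [//|x [Kx nKx _]] := @meets _ [::] oK _ nK.
have [U CU Ut] := KC _ Kt.
have [|x [_ Ux]] := @meets U [:: U] (Copen _ CU) _ Ut.
  by move=> V /=; rewrite inE => /eqP ->.
by apply; exists U => //=; rewrite inE.
Qed.

End Compactness.

(** * Divisibility by 2 of H_a and of the solenoid *)

Section Halving.
Variables (R : realType) (a : seqa).
Local Notation Sol := (Sol R a).
Local Notation PR := (PR a R).
Hypothesis no_order2 : forall x : Sol, sol_muln 2 x = sol0 R a -> x = sol0 R a.

(* Otherwise the coordinates P_n / 2 would define an element of order 2. *)
Lemma double_Pa n : exists m, (n <= m)%N /\ (2 * Pa a n %| Pa a m)%N.
Proof.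
apply: contrapT => h.
have odda m : (n <= m)%N -> odd (a m).
  move=> nm; apply: contrapT => /negP ev; apply: h; exists m.+1; split; first exact: leqW.
  by rewrite PaS mulnC dvdn_mul ?dvdn_Pa // dvdn2.
(* For odd a_k, P_(k+1) / 2 and P_k / 2 differ by (a_k - 1) / 2 times P_k. Below n, where a_k may be
   even, the coordinate P_n / 2 is used instead, whence the maximum further on. *)
have half k : eqm (PR k) (PR k.+1 / 2) (PR k / 2) \/ ~ (n <= k)%N.
  have [nk|nk] := leqP n k; last by right.
  left; exists (a k)./2%:Z; have := odda k nk => oa.
  rewrite /PR PaS natrM -[in LHS](odd_double_half (a k)) oa -muln2 natrD natrM /=.
  by rewrite -pmulrn; lra.
have [|x hx] := @coord_exists R a (fun k => PR (maxn k n) / 2).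
  move=> k; have [nk|nk] := leqP n k.
    by rewrite (maxn_idPl (leqW nk)); case: (half k).
  by rewrite (maxn_idPr nk); exact: eqm_refl.
have x2 : sol_muln 2 x = sol0 R a.
  apply: coord_inj => k; apply: eqm_trans (coord_muln k 2 x) _.
  apply: eqm_trans (eqmMz 2 (hx k)) _; apply: eqm_sym; apply: eqm_trans (coord0 R a k) _.
  have /dvdnP[q e] := dvdn_Pa a (leq_maxl k n).
  exists (- q%:Z); rewrite /PR e natrM mulrNz -pmulrn.
  by lra.
have := hx n; rewrite (no_order2 x2) maxnn => h1.
have [k hk] := eqm_trans (eqm_sym (coord0 R a n)) h1.
have p0 := PR_gt0 a R n.
have : (2 * k + 1)%:~R * PR n = 0 :> R.
  by rewrite intrD intrM mulrDl mul1r -mulrA; move: hk; lra.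
move=> /eqP; rewrite mulf_eq0 (gt_eqF p0) orbF intr_eq0 => /eqP; lia.
Qed.

Lemma inH_half (y : R) : inH a y -> inH a (y / 2).
Proof.
move=> [n [j hj]]; have [m [_ /dvdnP[q e]]] := double_Pa n.
exists m, (j * q%:Z); rewrite /PR e mulnA !natrM intrM -hj /PR -pmulrn.
by lra.
Qed.

(** If 2 P_n divides P_m, the coordinate of x at level m is defined modulo 2 P_n, and its half
    modulo P_n. These halves are compatible and form the coordinates of x'. *)
Lemma sol_half (x : Sol) : exists x', sol_muln 2 x' = x.
Proof.
have /choice[m hm] := double_Pa.
have cm n k : (m n <= k)%N -> eqm (2 * PR n) (coord k x) (coord (m n) x).
  move=> mk; have [_ /dvdnP[q e]] := hm n.
  have := coord_le x mk; rewrite /PR e natrM => /(@eqm_dvd _ _ q%:Z).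
  by rewrite natrM.
have halve c u v : eqm (2 * c) u v -> eqm c (u / 2) (v / 2) :> Prop.
  by move=> [k ->]; exists k; lra.
have [|x' hx'] := @coord_exists R a (fun n => coord (m n) x / 2).
  move=> n; apply: halve; pose k := maxn (m n) (m n.+1).
  apply: eqm_trans (cm n k (leq_maxl _ _)).
  apply: eqm_sym; have := cm n.+1 k (leq_maxr _ _).
  have /dvdnP[q e] := dvdn_Pa a (leqnSn n).
  rewrite /PR e natrM mulrCA; exact: (@eqm_dvd _ _ q%:Z).
exists x'; apply: coord_inj => n; apply: eqm_trans (coord_muln n 2 x') _.
apply: eqm_trans (eqmMz 2 (hx' n)) _.
have -> : 2%:~R * (coord (m n) x / 2) = coord (m n) x by lra.
by apply: coord_le; have [] := hm n.
Qed.

End Halving.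

(** The derivative of sin at 0, along a dyadic sequence. It recovers a real number from sines of its
    dyadic fractions, hence will express L through measurable functions. *)
Lemma cvg_sin_quotient (R : realType) (c : R) :
  (fun n => sin (c / 2 ^+ n) * 2 ^+ n) @ \oo --> c.
Proof.
have [->|c0] := eqVneq c 0.
  by under eq_fun do rewrite mul0r sin0 mul0r; exact: cvg_cst.
have h : (fun t : R => t^-1 *: (sin (t *: 1 + 0) - sin 0)) @ 0^' --> (1 : R).
  rewrite [X in _ --> X](_ : 1 = 'D_1 (@sin R) 0); last by rewrite derive_val cos0.
  exact: derivable_sin.
have w0 : (fun n => c / 2 ^+ n) @ \oo --> (0 : R).
  rewrite -[X in _ --> X](mulr0 c); apply: cvgM; [exact: cvg_cst|exact: cvg_pow2V].
have w1 : (fun n => c / 2 ^+ n) @ \oo --> 0^'.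
  move=> A hA; have hA' : nbhs (0 : R) [set t | t != 0 -> A t] := hA.
  have [n0 _ hn] := w0 _ hA'; exists n0 => // n nn; apply: (hn n nn).
  by rewrite mulf_neq0 // invr_neq0 // expf_neq0.
have : ((fun t : R => t^-1 *: (sin (t *: 1 + 0) - sin 0)) \o (fun n => c / 2 ^+ n)) @ \oo --> (1 : R).
  exact: cvg_comp w1 h.
have -> : (fun t : R => t^-1 *: (sin (t *: 1 + 0) - sin 0)) \o (fun n => c / 2 ^+ n) =
    (fun n => (sin (c / 2 ^+ n) * 2 ^+ n) / c).
  apply/funext => n /=; rewrite sin0 subr0 addr0 /GRing.scale /= mulr1 invfM invrK.
  by rewrite mulrC mulrA mulrAC.
move=> hh; have : (fun n => sin (c / 2 ^+ n) * 2 ^+ n / c * c) @ \oo --> 1 * c.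
  by apply: cvgM => //; exact: cvg_cst.
by rewrite mul1r; under eq_fun do rewrite divfK //.
Qed.

(** * Reading tau, M, K and m_K off the distribution mu *)

Section Necessity.
Variables (R : realType) (a : seqa).
Local Notation Sol := (Sol R a).
Local Notation SolM := (SolM R a).
Local Notation PR := (PR a R).
Hypothesis no_order2 : forall x : Sol, sol_muln 2 x = sol0 R a -> x = sol0 R a.
Variable mu : probability SolM R.
Hypothesis sym : symmetric_distr mu.
Hypothesis fE : forall y, inH a y -> charf mu (2 * y) = charf mu y ^+ 2 * (1 + charf mu (2 * y)) / 2.
Implicit Types (y z s t : R) (x : Sol).

Let f := charf mu.
Let H := @inH R a.
Let N := supp H f.

Lemma charf0 : f 0 = 1.
Proof.
rewrite /f /charf -[RHS](Ex_cst mu); congr (Ex _ _).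
by apply/funext => x; rewrite phase0 cos0.
Qed.

Lemma charfN y : H y -> f (- y) = f y.
Proof.
move=> hy; congr (Ex _ _); apply/funext => x.
by rewrite (cos_eqm (phaseN x hy)) cosN.
Qed.

Lemma charf_le1 y : H y -> `|f y| <= 1.
Proof.
move=> hy; have b := bmf_cosp hy; rewrite ler_norml; apply/andP; split.
  rewrite -(Ex_cst mu (-1)); apply: ler_Ex => //; first exact: bmf_cst.
  by move=> x; exact: cos_geN1.
rewrite -(Ex_cst mu 1); apply: ler_Ex => //; first exact: bmf_cst.
Qed.

Lemma Ex_cos_defect y : H y -> Ex mu (fun x => 1 - cos (phase y x)) = 1 - f y.
Proof.
by move=> hy; rewrite ExB ?Ex_cst //; [exact: bmf_cst|exact: bmf_cosp].
Qed.

Lemma charf_sub y z t : H y -> H z -> 0 < t ->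
  1 - f (y + z) <= (1 + t) * (1 - f y) + (1 + t^-1) * (1 - f z).
Proof.
move=> hy hz t0; have hyz := inHD hy hz.
have b w : H w -> bmf (fun x : SolM => 1 - cos (phase w x)).
  by move=> hw; apply: bmfB; [exact: bmf_cst|exact: bmf_cosp].
rewrite -!Ex_cos_defect // -!ExZ; try exact: b.
rewrite -ExD; try by apply: bmfZ; exact: b.
apply: ler_Ex; first exact: b.
  by apply: bmfD; apply: bmfZ; exact: b.
move=> x; rewrite (cos_eqm (phaseD x hy hz)).
exact: cos_defect_subadditive.
Qed.

Lemma inH_commensurable y z : H y -> H z -> z != 0 ->
  exists p q : int, p != 0 /\ p%:~R * y = q%:~R * z.
Proof.
move=> [n hn] [m hm] z0.
have [j hj] := int_at_le (leq_maxl n m) hn.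
have [k hk] := int_at_le (leq_maxr n m) hm.
have p0 := PR_gt0 a R (maxn n m).
exists k, j; split.
  apply: contra_neq z0 => k0; move: hk; rewrite k0 => /eqP.
  by rewrite mulf_eq0 (gt_eqF p0) orbF => /eqP.
by rewrite -hj -hk; ring.
Qed.

Lemma inH_commensurable_nat y z : H y -> H z -> 0 < y -> 0 < z ->
  exists p q : nat, [/\ (0 < p)%N, (0 < q)%N & p%:R * y = q%:R * z].
Proof.
move=> hy hz y0 z0; have [p [q [p0 e]]] := inH_commensurable hy hz (lt0r_neq0 z0).
exists `|p|%N, `|q|%N.
have e2 : `|p|%N%:R * y = `|q|%N%:R * z.
  rewrite !natr_absz !intr_norm -{1}(gtr0_norm y0) -{1}(gtr0_norm z0) -!normrM e //.
have pp : (0 < `|p|)%N by rewrite absz_gt0.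
split => //; rewrite lt0n; apply/eqP => q0; move: e2; rewrite q0 mul0r => /eqP.
by rewrite mulf_eq0 pnatr_eq0 (gt_eqF y0) orbF -leqn0 leqNgt pp.
Qed.

Let H0 : H 0 := inH0 R a.
Let HD : forall y z, H y -> H z -> H (y + z) := @inHD R a.
Let HN : forall y, H y -> H (- y) := @inHN R a.
Let Hhalf : forall y, H y -> H (y / 2) := inH_half no_order2.

Lemma supp_inH y : N y -> inH a y. Proof. by case. Qed.

Lemma charf_notin y : H y -> ~ N y -> f y = 0.
Proof. by move=> hy ny; apply: contrapT => h; apply: ny; split => //; exact/eqP. Qed.

Lemma suppB y z : N y -> N z -> N (y - z).
Proof.
move=> ny nz; apply: (suppD HD Hhalf charf_le1 fE charf_sub) => //.
exact: (suppN HN charfN).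
Qed.

Lemma supp_pow2_in n y : N y -> N (y / 2 ^+ n).
Proof.
move=> ny; apply/(supp_pow2 HD Hhalf charf_le1 fE); split => //.
exact: (H_pow2 Hhalf _ (supp_inH ny)).
Qed.

Lemma supp_mulz (k : int) y : N y -> N (k%:~R * y).
Proof.
move=> ny; have h n : N (n%:R * y).
  exact: (supp_muln H0 HD Hhalf charf0 charf_le1 fE charf_sub).
case: k => n; first exact: h.
by rewrite NegzE mulrNz mulNr; apply: (suppN HN charfN); exact: h.
Qed.

(** The linear bound 1 - 1 / ch t <= 2 t is enough for summability, since t is l(y) / 2^n here. The
    form c / 2^(n+1) is that of a geometric series with sum c. *)
Lemma charf_defect_pow2 y n : N y -> 1 - f (y / 2 ^+ n) <= 4 * lift f y / (2 ^ n.+1)%:R.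
Proof.
move=> ny.
have hn := supp_pow2_in n ny; have l1 := lift_ge0 Hhalf charf_le1 fE hn.
rewrite (f_lift Hhalf charf_le1 fE hn).
have -> : 4 * lift f y / (2 ^ n.+1)%:R = 2 * lift f (y / 2 ^+ n).
  rewrite (lift_pow2 HD Hhalf charf_le1 fE) // natrX exprS invfM.
  by move: (2 ^+ n)^-1 => w; field.
move: (lift f (y / 2 ^+ n)) l1 => t t0.
(* For t >= 1/2 the bound holds because the left side is below 1; for smaller t, (1 - t / 2)^2 >=
   9/16 in [sech_defect_le]. *)
have [t2|t2] := ltP t (1 / 2); last first.
  have : 0 < (ch t)^-1 by rewrite invr_gt0 (lt_le_trans _ (ch_ge1 t)).
  by lra.
have tt : 0 <= t < 2 by lra.
apply: le_trans (sech_defect_le tt) _.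
have p0 : 0 < 1 - t / 2 by lra.
rewrite ler_pdivrMr ?exprn_gt0 //.
have -> : t ^+ 2 / 2 = t * (t / 2) by ring.
rewrite [2 * t]mulrC -mulrA; apply: ler_wpM2l => //.
have : 9 / 16 <= (1 - t / 2) ^+ 2.
  have -> : 9 / 16 = (3 / 4) ^+ 2 :> R by field.
  by rewrite ler_sqr ?nnegrE; lra.
by lra.
Qed.

Lemma phase_pow2 y n m x : H y ->
  eqm (2 * pi) (2 ^+ m * phase (y / 2 ^+ (n + m)) x) (phase (y / 2 ^+ n) x).
Proof.
move=> hy; have h := @phaseMz R a (2 ^ m)%N (y / 2 ^+ (n + m)) x (H_pow2 Hhalf _ hy).
rewrite -pmulrn natrX in h; apply: eqm_sym; move: h; congr eqm; congr phase.
by rewrite exprD invfM mulrCA; congr (_ * _); rewrite mulrC divfK // expf_neq0.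
Qed.

(* Borel-Cantelli: mu {cos (phase (y / 2^n)) <= 0} <= 1 - f (y / 2^n) is summable. *)
Lemma ae_real_lift y : N y -> y != 0 ->
  {ae mu, forall x, exists l : R, forall n, eqm (2 * pi) (phase (y / 2 ^+ n) x) (2 * pi * y * l / 2 ^+ n)}.
Proof.
move=> ny y0; have pi0 := pi_gt0 R.
have hy n : H (y / 2 ^+ n) by apply: H_pow2 => //; case: ny.
pose F n : set SolM := [set x | cos (phase (y / 2 ^+ n) x) <= 0].
have mF n : measurable (F n).
  have [mc _] := bmf_cosp (hy n).
  have := mc measurableT `]-oo, 0]%classic (measurable_itv _); rewrite setTI.
  by congr measurable; apply/seteqP; split => x /=; rewrite in_itv.
have muF n : (mu (F n) <= (4 * lift f y / (2 ^ n.+1)%:R)%:E)%E.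
  rewrite -Ex_indic // lee_fin; apply: le_trans (charf_defect_pow2 n ny).
  rewrite -Ex_cos_defect //; apply: ler_Ex; first exact: bmf_indic.
    by apply: bmfB; [exact: bmf_cst|exact: (bmf_cosp (hy n))].
  move=> x; rewrite indicE; case: (boolP (x \in F n)) => [|_] /=.
    by rewrite inE /F /= => h; lra.
  by rewrite subr_ge0 cos_le1.
have l0 := lift_ge0 Hhalf charf_le1 fE ny.
have null : mu (lim_sup_set F) = 0.
  apply: lim_sup_set_cvg0 => //.
  apply: (@le_lt_trans _ _ (4 * lift f y)%:E); last exact: ltry.
  apply: le_trans (epsilon_trick0 xpredT _); last by rewrite mulr_ge0.
  by apply: lee_nneseries => // n _; exact: muF.
exists (lim_sup_set F); split => //.
  apply: bigcap_measurable; first by exists 0%N.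
  by move=> n _; apply: bigcup_measurable => k _; exact: mF.
move=> x /= nl; apply: contrapT => nx; apply: nl.
have [n0 hn0] : exists n0, forall n, (n0 <= n)%N -> 0 < cos (phase (y / 2 ^+ n) x).
  apply: contrapT => h; apply: nx => n _ /=; apply: contrapT => h'; apply: h; exists n => k nk.
  by rewrite ltNge; apply/negP => hk; apply: h'; exists k.
have [|n|l hl] := @lift_dyadic R (fun n => phase (y / 2 ^+ (n0 + n)) x).
- by move=> n; apply: hn0; exact: leq_addr.
- have := @phase_pow2 y (n0 + n) 1 x (supp_inH ny).
  by rewrite expr1 addn1 addnS.
(* The dyadic lift starts at index n0, where the cosines have become positive; the factor 2^n0
   undoes this shift, and the congruences for every n are recovered by doubling n0 times. *)
exists (2 ^+ n0 * l / (2 * pi * y)) => n.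
apply: eqm_trans (eqm_sym (@phase_pow2 y n n0 x (supp_inH ny))) _.
have := eqmMz (2 ^ n0)%N (hl n); rewrite -pmulrn natrX [(n0 + n)%N]addnC.
congr eqm; have -> : 2 * pi * y * (2 ^+ n0 * l / (2 * pi * y)) = 2 ^+ n0 * l; last by rewrite mulrA.
have pz : 2 * pi * y != 0 by rewrite !mulf_neq0 // gt_eqF.
by rewrite mulrC divfK.
Qed.

Lemma eqm_pow2_eq0 (D : R) : (forall n, eqm (2 * pi) (D / 2 ^+ n) 0) -> D = 0.
Proof.
move=> h; have c : (fun n => D / 2 ^+ n) @ \oo --> (0 : R).
  by rewrite -[X in _ --> X](mulr0 D); apply: cvgM; [exact: cvg_cst|exact: cvg_pow2V].
have p0 : 0 < 2 * pi :> R by rewrite mulr_gt0 // pi_gt0.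
have /cvgrPdist_lt /(_ _ p0) [n _ /(_ n (leqnn n))] := c.
rewrite /= distrC => hn; have := eqm_small p0 (h n) hn.
by move/eqP; rewrite mulf_eq0 invr_eq0 expf_eq0 pnatr_eq0 andbF orbF => /eqP.
Qed.

(** The last clause expresses the density of N through its consequences for L and sigma: the
    products z L x and sigma z converge, not z itself. In this form it also holds when N = {0},
    where L = 0 and sigma = 0. *)
Lemma real_lift_exists : exists (L : SolM -> R) (sigma : R),
  [/\ measurable_fun setT L,
      forall y, N y -> f y = 2 / (expR (sigma * y) + expR (- (sigma * y))),
      forall y, N y -> {ae mu, forall x, eqm (2 * pi) (phase y x) (2 * pi * y * L x)} &
      forall s, exists z : nat -> R, [/\ forall m, N (z m),
        forall x, (fun m => z m * L x) @ \oo --> s * L x &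
        (fun m => sigma * z m) @ \oo --> sigma * s]].
Proof.
have pi0 := pi_gt0 R.
have [[z0 [nz0 z00]]|none] := pselect (exists z0, N z0 /\ z0 != 0); last first.
  have triv y : N y -> y = 0.
    by move=> ny; apply: contrapT => h; apply: none; exists y; split => //; exact/eqP.
  exists (fun=> 0), 0; split.
  - exact: measurable_cst.
  - by move=> y /triv ->; rewrite charf0 mul0r oppr0 expR0 -[1 + 1]/(2 : R) divff.
  - by move=> y /triv ->; apply: aeW => x; rewrite phase0 !mulr0; exact: eqm_refl.
  - move=> s; exists (fun=> 0); split.
    + by move=> _; exact: (supp0 H0 charf0).
    + by move=> x; rewrite !mulr0; exact: cvg_cst.
    + by rewrite mulr0 mul0r; exact: cvg_cst.
have [sigma hsigma] := sech_equation_solution H0 HD HN Hhalf inH_commensurable_nat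
  charf0 charfN charf_le1 fE charf_sub.
have hz n : inH a (z0 / 2 ^+ n) := supp_inH (supp_pow2_in n nz0).
pose h n (x : SolM) : R := sin (phase (z0 / 2 ^+ n) x) * 2 ^+ n / (2 * pi * z0).
have mh n : measurable_fun setT (h n).
  have [ms _] := bmf_sinp (hz n).
  by apply: measurable_funM => //; apply: measurable_funM => //; exact: measurable_cst.
(* An upper limit is measurable without any convergence assumption. It equals the real lift wherever
   that exists, hence almost everywhere. *)
pose L (x : SolM) : R := fine (limn_esup (fun n => (h n x)%:E)).
have mL : measurable_fun setT L.
  apply: (@measurableT_comp _ _ _ _ _ _ fine); first exact: fine_measurable.
  by apply: measurable_fun_limn_esup => n; apply/measurable_EFinP.
have pz : 2 * pi * z0 != 0 by rewrite !mulf_neq0 // gt_eqF.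
have Lval x l : (forall n, eqm (2 * pi) (phase (z0 / 2 ^+ n) x) (2 * pi * z0 * l / 2 ^+ n)) -> L x = l.
  move=> hl; have c : (fun n => h n x) @ \oo --> l.
    have c := @cvg_sin_quotient R (2 * pi * z0 * l).
    rewrite -[X in _ --> X](mulKf pz) mulrC; apply: cvgM; last exact: cvg_cst.
    rewrite (_ : (fun n => _) = (fun n => sin (2 * pi * z0 * l / 2 ^+ n) * 2 ^+ n)) //.
    by apply/funext => n; rewrite (sin_eqm (hl n)).
  have ce : (fun n => (h n x)%:E) @ \oo --> l%:E by apply: cvg_EFin => //; exact: nearW.
  by rewrite /L (cvg_limn_einf_sup ce).2.
exists L, sigma; split => //.
- move=> y ny; have [->|y0] := eqVneq y 0.
    by apply: aeW => x; rewrite phase0 mulr0 mul0r; exact: eqm_refl.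
  apply: ae_mono2 (ae_real_lift ny y0) (ae_real_lift nz0 z00) => x [l1 h1] [l2 h2].
  rewrite (Lval x l2 h2); have := h1 0%N; rewrite expr0 !divr1.
  (* The lifts along y and along z0 coincide: as p y = q z0, the numbers 2 pi p y l1 / 2^n and 2 pi
     q z0 l2 / 2^n are arguments of one character, so their difference is 0 modulo 2 pi for every
     n. *)
  have [p [q [p0 e]]] := inH_commensurable (supp_inH ny) (supp_inH nz0) z00.
  suff -> : l1 = l2 by [].
  have pp : 2 * pi * (p%:~R * y) != 0 by rewrite !mulf_neq0 ?intr_eq0 // gt_eqF.
  apply: (mulfI pp); apply/eqP; rewrite -subr_eq0; apply/eqP; apply: eqm_pow2_eq0 => n.
  have a1 := eqmMz p (h1 n); have a2 := eqmMz q (h2 n).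
  have b1 := phaseMz p x (supp_inH (supp_pow2_in n ny)).
  have b2 := phaseMz q x (hz n).
  have e1 : p%:~R * (y / 2 ^+ n) = q%:~R * (z0 / 2 ^+ n) by rewrite !mulrA e.
  rewrite e1 in b1.
  have a3 := eqm_trans (eqm_trans (eqm_sym a1) (eqm_sym b1)) (eqm_trans b2 a2).
  have := eqmB a3 (eqm_refl _ (q%:~R * (2 * pi * z0 * l2 / 2 ^+ n))).
  rewrite subrr; congr eqm; move: (2 ^+ n)^-1 => w.
  have -> : q%:~R * (2 * pi * z0 * l2 * w) = 2 * pi * (q%:~R * z0) * l2 * w by ring.
  by rewrite -e; ring.
- move=> s; pose zz n := (Num.floor (s / z0 * 2 ^+ n))%:~R / 2 ^+ n * z0.
  have cz : zz @ \oo --> s.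
    rewrite -[X in _ --> X](divfK z00); apply: cvgM; last exact: cvg_cst.
    exact: cvg_dyadic_floor.
  exists zz; split.
  + by move=> m; rewrite /zz mulrAC -mulrA; apply: supp_mulz; exact: supp_pow2_in.
  + by move=> x; apply: cvgM => //; exact: cvg_cst.
  + by apply: cvgM => //; exact: cvg_cst.
Qed.

Lemma supp_annihilator_open :
  sol_open (~` [set x : Sol | forall y, N y -> eqm (2 * pi) (phase y x) 0]).
Proof.
apply: sol_open_local => x /= nx.
have [y [ny hy]] : exists y, N y /\ ~ eqm (2 * pi) (phase y x) 0.
  by apply: contrapT => h; apply: nx => y ny; apply: contrapT => h'; apply: h; exists y.
have c1 : cos (phase y x) < 1.
  by rewrite lt_neqAle cos_le1 andbT; apply/eqP => /cos_eq1_eqm.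
exists [set z | -1 < cos (phase y z + pi)]; split.
- exact: sol_open_cos_gt (supp_inH ny).
- by rewrite /= cosDpi; lra.
- move=> z /=; rewrite cosDpi => hz h; have := cos_eqm (h y ny); rewrite cos0 => e.
  by move: hz; rewrite e; lra.
Qed.

(** H_a is countable: its elements are j / P_n, and the pairs (n, j) are encoded in nat. *)
Lemma ae_inH (Q : R -> SolM -> Prop) :
  (forall y, H y -> {ae mu, forall x, Q y x}) ->
  {ae mu, forall x, forall y, H y -> Q y x}.
Proof.
move=> hQ.
have : {ae mu, forall x, forall m : nat, if unpickle m is Some (n, j)
    then Q (j%:~R / PR n) x else True}.
  apply: ae_foralln => m; case: (unpickle m) => [[n j]|]; last exact: aeW.
  by apply: hQ; exists n, j; rewrite divfK // gt_eqF // PR_gt0.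
apply: ae_mono => x hx y [n [j e]].
have := hx (pickle (n, j : int)); rewrite pickleK -e mulfK //.
by rewrite gt_eqF // PR_gt0.
Qed.

Lemma necessity :
  exists (tau : R -> Sol) (M : probability (measurableTypeR R) R) (K : set Sol),
      [/\ cont_monomorphism tau, hyp_secant M,
          sol_subgroup K /\ sol_compact K, corwin K &
          exists mK : probability SolM R, haar_of K mK /\
            forall E : set SolM, measurable E -> mu E = conv_image tau M mK E].
Proof.
have pi0 := pi_gt0 R.
have [L [sigma [mL hsech hL happ]]] := real_lift_exists.
pose tau t : Sol := sol_proj t (dnat a 0).
have ctau n t : eqm (PR n) (coord n (tau t)) t.
  apply: eqm_trans (coord_proj _ _ _) _.
  by apply: eqm_trans (eqmB (eqm_refl _ t) (dval_dnat _ _ _ _)) _; rewrite subr0; exact: eqm_refl.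
have ptau y t : H y -> eqm (2 * pi) (phase y (tau t)) (2 * pi * y * t).
  by move=> hy; apply: (@phase_char _ _ y (tau t) (fun=> t) hy) => n; exact: ctau.
pose K := [set x : Sol | forall y, N y -> eqm (2 * pi) (phase y x) 0].
have oK := supp_annihilator_open.
have mK : measurable (K : set SolM).
  by rewrite -(setCK K); apply: measurableC; apply: sub_sigma_algebra; exact: oK.
have mtau : measurable_fun setT (tau : measurableTypeR R -> SolM).
  apply: measurable_sol => y hy.
  apply: (@trig_measurable_eqm _ _ _ (fun t => 2 * pi * y * t)).
    by move=> t; apply: eqm_sym; exact: ptau.
  by apply: trig_measurable_real; apply: measurable_funM => //; exact: measurable_cst.
pose kap (x : SolM) : SolM := sol_add x (sol_opp (tau (L x))).
have mkap : measurable_fun setT kap.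
  apply: measurable_sol_add => //; apply: measurable_sol_opp.
  exact: (measurableT_comp mtau mL).
have pkap y x : H y -> eqm (2 * pi) (phase y (kap x)) (phase y x - 2 * pi * y * L x).
  move=> hy; apply: eqm_trans (phase_add _ _ hy) _; apply: eqmD (eqm_refl _ _) _.
  by apply: eqm_trans (phase_opp _ hy) _; apply: eqmN; exact: ptau.
have [M hM] := @law_exists _ _ _ (measurableTypeR R) R mu L mL.
have [m hm] := law_exists mu mkap.
have bcosL s : bmf (fun t : measurableTypeR R => cos (s * t)).
  by apply: bmf_cos; apply: measurable_funM => //; exact: measurable_cst.
have bsinL s : bmf (fun t : measurableTypeR R => sin (s * t)).
  by apply: bmf_sin; apply: measurable_funM => //; exact: measurable_cst.
have EM g : bmf g -> Ex M g = Ex mu (g \o L).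
  by move=> bg; exact: (@Ex_law _ SolM _ (measurableTypeR R) R mu M L g mL (fun A _ => hM A) bg).
have Em g : bmf g -> Ex m g = Ex mu (g \o kap).
  by move=> bg; exact: Ex_law mkap (fun A _ => hm A) bg.
have mphL y : H y -> trig_measurable (fun x : SolM => phase y x).
  by move=> hy; exact: trig_measurable_phase.
(* For a frequency in N the integral is f; dominated convergence along [z] reaches every real s. *)
have cosM s : Ex M (fun t => cos (2 * pi * s * t)) =
    2 / (expR (sigma * s) + expR (- (sigma * s))).
  have [z [nz cz cs]] := happ s.
  have h1 : (fun k => Ex M (fun t => cos (2 * pi * z k * t))) @ \oo -->
      Ex M (fun t => cos (2 * pi * s * t)).
    have e k : Ex M (fun t => cos (2 * pi * z k * t)) = Ex mu ((fun t => cos (2 * pi * z k * t)) \o L).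
      exact: (EM _ (bcosL _)).
    rewrite (funext e) (EM _ (bcosL _)).
    apply: (@Ex_cvg _ _ _ _ _ _ 1).
    - by move=> k; exact: bmf_comp mL (bcosL _).
    - exact: bmf_comp mL (bcosL _).
    - by move=> k x; exact: cos_max.
    - apply: aeW => x /=; apply: (continuous_cvg _ (@continuous_cos R _)).
      rewrite -mulrA; under eq_fun do rewrite -mulrA.
      by apply: cvgM; [exact: cvg_cst|exact: cz].
  have h2 : (fun k => 2 / (expR (sigma * z k) + expR (- (sigma * z k)))) @ \oo -->
      2 / (expR (sigma * s) + expR (- (sigma * s))).
    have cE (u : nat -> R) l : u @ \oo --> l -> (fun n => expR (u n)) @ \oo --> expR l.
      by move=> hu; exact: (continuous_cvg _ (@continuous_expR R _) hu).
    apply: cvgM; first exact: cvg_cst.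
    apply: cvgV; first by rewrite gt_eqF // addr_gt0 ?expR_gt0.
    by apply: cvgD; apply: cE => //; exact: cvgN.
  have e k : Ex M (fun t => cos (2 * pi * z k * t)) = 2 / (expR (sigma * z k) + expR (- (sigma * z k))).
    rewrite -hsech // (EM _ (bcosL _)).
    apply: (@Ex_ae _ _ _ mu _ (fun x : SolM => cos (phase (z k) x))).
    - exact: bmf_comp mL (bcosL _).
    - exact: bmf_cosp (supp_inH (nz k)).
    - by apply: ae_mono (hL _ (nz k)) => x hx; apply: esym; exact: cos_eqm.
  rewrite (funext e) in h1; exact: cvg_unique h1 h2.
have sinM s : Ex M (fun t => sin (2 * pi * s * t)) = 0.
  have [z [nz cz _]] := happ s.
  have h1 : (fun k => Ex M (fun t => sin (2 * pi * z k * t))) @ \oo -->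
      Ex M (fun t => sin (2 * pi * s * t)).
    have e k : Ex M (fun t => sin (2 * pi * z k * t)) = Ex mu ((fun t => sin (2 * pi * z k * t)) \o L).
      exact: (EM _ (bsinL _)).
    rewrite (funext e) (EM _ (bsinL _)).
    apply: (@Ex_cvg _ _ _ _ _ _ 1).
    - by move=> k; exact: bmf_comp mL (bsinL _).
    - exact: bmf_comp mL (bsinL _).
    - by move=> k x; exact: sin_max.
    - apply: aeW => x /=; apply: (continuous_cvg _ (@continuous_sin R _)).
      rewrite -mulrA; under eq_fun do rewrite -mulrA.
      by apply: cvgM; [exact: cvg_cst|exact: cz].
  have e k : Ex M (fun t => sin (2 * pi * z k * t)) = 0.
    rewrite -(symmetric_sin sym (supp_inH (nz k))) (EM _ (bsinL _)); apply: Ex_ae.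
    - exact: bmf_comp mL (bsinL _).
    - exact: bmf_sinp (supp_inH (nz k)).
    - by apply: ae_mono (hL _ (nz k)) => x hx; apply: esym; exact: sin_eqm.
  rewrite (funext e) in h1; exact: cvg_unique h1 (cvg_cst _).
have kap_in y c : N y -> Ex m (fun x => cos (phase y x + c)) = cos c.
  move=> ny; rewrite Em; last exact: bmf_cos_phase (supp_inH ny).
  rewrite -[RHS](Ex_cst mu); apply: Ex_ae.
  - exact: bmf_comp mkap (bmf_cos_phase c (supp_inH ny)).
  - exact: bmf_cst.
  - apply: ae_mono (hL _ ny) => x hx /=; apply: cos_eqm; rewrite -[X in eqm _ _ X]add0r.
    apply: eqmD (eqm_refl _ _); apply: eqm_trans (pkap y x (supp_inH ny)) _.
    by have := eqmB hx (eqm_refl _ (2 * pi * y * L x)); rewrite subrr.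
(* The correction y L x is a limit of z_k L x with z_k in N. Replacing it by z_k L x gives, almost
   everywhere, the argument of the character y - z_k, which lies outside the group N, so every
   integral of the sequence is 0. *)
have kap_notin y c : H y -> ~ N y -> Ex m (fun x => cos (phase y x + c)) = 0.
  move=> hy ny; rewrite Em; last exact: bmf_cos_phase.
  have [z [nz cz _]] := happ y.
  have bz s : bmf (fun x : SolM => cos (phase y x - 2 * pi * s * L x + c)).
    apply: trig_measurable_cosD; apply: trig_measurableD; first exact: mphL.
    apply: trig_measurableN; apply: trig_measurable_real.
    by apply: measurable_funM => //; exact: measurable_cst.
  have h1 : (fun k => Ex mu (fun x => cos (phase y x - 2 * pi * z k * L x + c))) @ \oo -->
      Ex mu (fun x => cos (phase y x - 2 * pi * y * L x + c)).
    apply: (@Ex_cvg _ _ _ _ _ _ 1) => //.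
    - by move=> k x; exact: cos_max.
    - apply: aeW => x /=; apply: (continuous_cvg _ (@continuous_cos R _)).
      apply: cvgD; last exact: cvg_cst.
      apply: cvgB; first exact: cvg_cst.
      rewrite -mulrA; under eq_fun do rewrite -mulrA.
      by apply: cvgM; [exact: cvg_cst|exact: cz].
  have e k : Ex mu (fun x => cos (phase y x - 2 * pi * z k * L x + c)) = 0.
    have hz := supp_inH (nz k); have hyz := inHB hy hz.
    have -> : (0 : R) = Ex mu (fun x => cos (phase (y - z k) x + c)).
      rewrite symmetric_cosD // -/f charf_notin ?mulr0 // => nyz; apply: ny.
      have := suppB nyz (suppN HN charfN (nz k)); by rewrite opprK subrK.
    apply: Ex_ae => //; first exact: bmf_cos_phase.
    apply: ae_mono (hL _ (nz k)) => x hx; apply: cos_eqm; apply: eqmD (eqm_refl _ _).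
    apply: eqm_sym; apply: eqm_trans (phaseB x hy hz) _.
    exact: eqmB (eqm_refl _ _) hx.
  rewrite (funext e) in h1; rewrite -[RHS](cvg_unique _ h1 (cvg_cst _)) //.
  congr (Ex _ _); apply/funext => x /=; apply: cos_eqm.
  by apply: eqmD (eqm_refl _ _); exact: pkap.
have Ktwo x : K x -> K (sol_muln 2 x).
  move=> Kx y ny; apply: eqm_trans (phase_muln 2 x (supp_inH ny)) _.
  by have := eqmMz 2 (Kx y ny); rewrite mulr0.
exists tau, M, K; split.
- split; [|split].
  + move=> s t; apply: coord_inj => n; apply: eqm_trans (ctau n _) _.
    by apply: eqm_sym; apply: eqm_trans (coord_add _ _ _) _; exact: eqmD.
  + move=> s t e; apply: contrapT => st.
    have hst n : eqm (PR n) s t.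
      by apply: eqm_trans (eqm_sym (ctau n s)) _; rewrite e; exact: ctau.
    (* Since every a_n is at least 2, some P_n exceeds |s - t|, and the congruence of s and t modulo
       P_n becomes an equality. *)
    have P2 n : (2 ^ n <= Pa a n)%N.
      elim: n => [|n ih]; first by rewrite /Pa big_ord0.
      by rewrite PaS expnSr; apply: leq_mul => //; exact: aseq_gt1.
    apply: st; pose n := Num.bound `|s - t|; apply: (@eqm_small _ (PR n)) => //.
      exact: PR_gt0.
    apply: lt_le_trans (archi_boundP (normr_ge0 _)) _.
    by rewrite ler_nat; apply: leq_trans (P2 n); rewrite ltnW // ltn_expl.
  + move=> U oU; rewrite openE => t Ut.
    have [e [e0 [n hn]]] := oU (t, dnat a 0) Ut.
    by exists e => // s; rewrite /ball /= => hs; apply: hn => //=; rewrite distrC.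
(* [cosM] is stated at the frequency 2 pi s of the characters, whereas the definition of the secant
   law uses s. *)
- exists (sigma / (2 * pi)) => s.
  have es : s = 2 * pi * (s / (2 * pi)) by rewrite mulrC divfK // gt_eqF // mulr_gt0.
  split; rewrite ExE //; congr EFin.
    rewrite [in LHS]es cosM; have -> : sigma * (s / (2 * pi)) = sigma / (2 * pi) * s by ring.
    by [].
  by rewrite es sinM.
- split; last exact: sol_compact_closed oK.
  split; [|split].
  + by move=> y ny; exact: phase_sol0 (supp_inH ny).
  + move=> x x' Kx Kx' y ny; apply: eqm_trans (phase_add _ _ (supp_inH ny)) _.
    by have := eqmD (Kx y ny) (Kx' y ny); rewrite addr0.
  + move=> x Kx y ny; apply: eqm_trans (phase_opp _ (supp_inH ny)) _.
    by have := eqmN (Kx y ny); rewrite oppr0.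
- apply/seteqP; split; first by move=> _ [x Kx <-]; exact: Ktwo.
  (* Any half x of k lies in K: for y in N, y / 2 is in N too, and the character y at x equals the
     character y / 2 at 2 x = k. *)
  move=> k Kk; have [x hx] := sol_half no_order2 k; exists x => // y ny.
  have ny2 := supp_half Hhalf charf_le1 fE ny.
  have e2 : y = 2%:~R * (y / 2) by lra.
  rewrite e2; apply: eqm_trans (phaseMz 2 x (supp_inH ny2)) _.
  apply: eqm_trans (eqm_sym (phase_muln 2 x (supp_inH ny2))) _.
  by rewrite hx; exact: Kk.
exists m; split; first split.
(* Membership in K involves all y of N at once; countability of H_a gathers the exceptional null
   sets. *)
- rewrite hm; have aeK : {ae mu, forall x, K (kap x)}.
    have : {ae mu, forall x, forall y, H y -> N y -> eqm (2 * pi) (phase y x) (2 * pi * y * L x)}.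
      apply: ae_inH => y hy; have [ny|ny] := pselect (N y); last exact: aeW.
      by apply: ae_mono (hL y ny) => x hx _.
    apply: ae_mono => x hx y ny; apply: eqm_trans (pkap y x (supp_inH ny)) _.
    have := eqmB (hx y (supp_inH ny) ny) (eqm_refl _ (2 * pi * y * L x)).
    by rewrite subrr.
  have mpre : measurable (kap @^-1` K).
    by rewrite -[X in measurable X]setTI; exact: mkap.
  exact: ae_probability1.
- move=> k Kk E mE.
  have mopp : measurable_fun setT (fun x : SolM => sol_add (sol_opp k) x : SolM).
    by apply: measurable_sol_add => //; exact: measurable_cst.
  have -> : [set sol_add k x | x in E] = (fun x : SolM => sol_add (sol_opp k) x) @^-1` E.
    apply/seteqP; split => x /=.
      by move=> [z Ez <-]; rewrite sol_addA sol_addN sol_add0.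
    move=> Ex0; exists (sol_add (sol_opp k) x) => //.
    by rewrite sol_addA (sol_addC k) sol_addN sol_add0.
  (* Translation by k in K leaves the characters of N unchanged, and the other ones have integral 0
     with every shift; so the translated law has the same Fourier transform as m. *)
  have [Q hQ] := law_exists m mopp; rewrite -hQ.
  apply: fourier_unique mE => y c hy.
  rewrite (Ex_law mopp (fun A _ => hQ A) (bmf_cos_phase c hy)).
  rewrite (_ : _ \o _ = (fun x : SolM => cos (phase y x + (- phase y k + c)))); last first.
    apply/funext => x /=; apply: cos_eqm; rewrite addrA; apply: eqmD (eqm_refl _ _).
    apply: eqm_trans (phase_add _ _ hy) _; rewrite addrC.
    by apply: eqmD (eqm_refl _ _); exact: phase_opp.
  have [ny|ny] := pselect (N y); last by rewrite !kap_notin.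
  rewrite !kap_in //; apply: cos_eqm; rewrite -[X in eqm _ _ X]add0r.
  apply: eqmD (eqm_refl _ _); rewrite -oppr0; apply: eqmN; exact: Kk.
- move=> E mE.
  have mF : measurable_fun setT (fun z : SolM * measurableTypeR R => sol_add (tau z.2) z.1 : SolM).
    apply: measurable_sol_add; last exact: measurable_fst.
    exact: (measurableT_comp mtau measurable_snd).
  have [Q hQ] := law_exists (m \x M)%E mF.
  have -> : conv_image tau M m E = Q E.
    rewrite hQ /conv_image /product_measure1; apply: eq_integral => k _ /=.
    by congr (M _); apply/seteqP; split => t /=; rewrite /xsection /= inE.
  apply: fourier_unique mE => y c hy.
  rewrite (Ex_law mF (fun A _ => hQ A) (bmf_cos_phase c hy)).
  have b1 := bmf_cos_phase c hy.
  have b2 : bmf (fun x : SolM => sin (phase y x + c)).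
    have := bmf_cos_phase (c - pi / 2) hy.
    by under [X in bmf X]eq_fun do rewrite addrA cosBpihalf.
  rewrite (_ : _ \o _ = (fun z : SolM * measurableTypeR R =>
     cos (phase y z.1 + c) * cos (2 * pi * y * z.2) - sin (phase y z.1 + c) * sin (2 * pi * y * z.2))); last first.
    apply/funext => z /=; rewrite -cosD; apply: cos_eqm.
    rewrite addrAC; apply: eqmD (eqm_refl _ _); rewrite addrC.
    apply: eqm_trans (phase_add _ _ hy) _.
    by apply: eqmD (eqm_refl _ _); exact: ptau.
  rewrite ExB; last 2 first.
  + by apply: bmfM; [exact: (bmf_comp measurable_fst b1)|exact: (bmf_comp measurable_snd (bcosL _))].
  + by apply: bmfM; [exact: (bmf_comp measurable_fst b2)|exact: (bmf_comp measurable_snd (bsinL _))].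
  (* The transform of the convolution is a product: 1 times the secant on N, and 0 outside N, which
     is f in both cases. *)
  rewrite (Ex_product m M b1 (bcosL _)) (Ex_product m M b2 (bsinL _)) sinM mulr0 subr0.
  rewrite symmetric_cosD // -/f.
  have [ny|ny] := pselect (N y).
    by rewrite kap_in // cosM -hsech.
  by rewrite kap_notin // charf_notin // mulr0 mul0r.
Qed.

End Necessity.

Theorem theorem2p4 (R : realType) (a : seqa)
  (no_order2 : forall x : Sol R a, sol_muln 2 x = sol0 R a -> x = sol0 R a)
  (d : measure_display) (Omega : measurableType d) (P : probability Omega R)
  (xi1 xi2 xi3 : Omega -> SolM R a) (alpha : Omega -> nat)
  (mu : probability (SolM R a) R) :
  (* xi1, xi2, xi3, alpha are random variables *)
  measurable_fun setT xi1 -> measurable_fun setT xi2 ->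
  measurable_fun setT xi3 -> measurable_fun setT alpha ->
  (* xi1, xi2, xi3 are identically distributed with distribution mu *)
  (forall A : set (SolM R a), measurable A ->
     [/\ P (xi1 @^-1` A) = mu A, P (xi2 @^-1` A) = mu A & P (xi3 @^-1` A) = mu A]) ->
  (* xi1, xi2, xi3 are independent *)
  (forall A1 A2 A3 : set (SolM R a),
     measurable A1 -> measurable A2 -> measurable A3 ->
     P (xi1 @^-1` A1 `&` xi2 @^-1` A2 `&` xi3 @^-1` A3) =
     (P (xi1 @^-1` A1) * P (xi2 @^-1` A2) * P (xi3 @^-1` A3))%E) ->
  (* mu is symmetric *)
  symmetric_distr mu ->
  (* alpha is Bernoulli: values 0 and 1 with probability 1/2 each *)
  P (alpha @^-1` [set 0%N]) = (1 / 2)%:E ->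
  P (alpha @^-1` [set 1%N]) = (1 / 2)%:E ->
  (* alpha is independent of the random vector (xi1, xi2, xi3) *)
  (forall (E : set (SolM R a * SolM R a * SolM R a)) (F : set nat),
     measurable E -> measurable F ->
     P ((fun w => (xi1 w, xi2 w, xi3 w)) @^-1` E `&` alpha @^-1` F) =
     (P ((fun w => (xi1 w, xi2 w, xi3 w)) @^-1` E) * P (alpha @^-1` F))%E) ->
  (* (i) 2 xi1 and xi1 + xi2 + 2 alpha xi3 are identically distributed *)
  ((forall A : set (SolM R a), measurable A ->
      P ((fun w => sol_muln 2 (xi1 w)) @^-1` A) =
      P ((fun w => sol_add (sol_add (xi1 w) (xi2 w))
                           (sol_muln (2 * alpha w) (xi3 w))) @^-1` A))
   <->
  (* (ii) mu = tau(M) * m_K *)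
   (exists (tau : R -> Sol R a) (M : probability (measurableTypeR R) R)
           (K : set (Sol R a)),
      [/\ cont_monomorphism tau, hyp_secant M,
          sol_subgroup K /\ sol_compact K, corwin K &
          exists mK : probability (SolM R a) R, haar_of K mK /\
            forall E : set (SolM R a), measurable E ->
              mu E = conv_image tau M mK E])).
Proof.
move=> m1 m2 m3 malpha ident indep sym alpha0 alpha1 indep_alpha.
have E := ident_forms_iff m1 m2 m3 malpha ident indep sym alpha0 alpha1 indep_alpha.
split=> [/E fE|[tau [M [K [[tauD [_ tauC]] hM [_ cK] kK [mK [hK h]]]]]]].
  exact: necessity.
by apply/E; exact: (conv_image_functional tauD tauC hM cK kK hK h).
Qed.
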